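(* As $N\to+\infty$ inside $2\mathbb{Z}$, the matrix Whittaker kernel $K$ with parameters $z=z_0+N$, $z'=z_0'+N$, rescaled by $x=\xi/N$, $y=\eta/N$, tends to a matrix kernel $K^{lim}$; i.e. for all $\xi,\eta>0$ and each choice of signs $\epsilon,\delta\in\{+,-\}$, $$\lim_{N\to+\infty,\,N\in2\mathbb{Z}}\frac1N K_{\epsilon\delta}\left(\frac{\xi}{N},\frac{\eta}{N}\right)=K^{lim}_{\epsilon\delta}(\xi,\eta),$$ where $$K^{lim}_{++}(\xi,\eta)=\frac{A(\xi)\widetilde A(\eta)-\widetilde A(\xi)A(\eta)}{\xi-\eta},$$ $$K^{lim}_{+-}(\xi,\eta)=-\frac{2\sqrt{\sin(\pi z_0)\sin(\pi z_0')}}{\pi}\,\frac{A(\xi)\widetilde B(\eta)-\widetilde A(\xi)B(\eta)}{\xi+\eta},$$ $$K^{lim}_{-+}(\xi,\eta)=-K^{lim}_{+-}(\eta,\xi),$$ $$K^{lim}_{--}(\xi,\eta)=\frac{4\sin(\pi z_0)\sin(\pi z_0')}{\pi^2}\,\frac{B(\xi)\widetilde B(\eta)-\widetilde B(\xi)B(\eta)}{\xi-\eta}.$$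
   Context: Parameters: $z_0,z_0'$ are fixed with either $z_0,z_0'\in\mathbb{C}\setminus\mathbb{Z}$ and $z_0'=\bar z_0$, or $z_0,z_0'\in\mathbb{R}\setminus\mathbb{Z}$ and $m<z_0,z_0'<m+1$ for some $m\in\mathbb{Z}$. Put $\mu=\frac{z_0-z_0'}2$. The pair $z=z_0+N$, $z'=z_0'+N$ satisfies the same restrictions; $a=\frac{z+z'}2$ and $\frac{z-z'}{2}=\mu$. Functions of $\xi>0$ (with $J_\nu$ the Bessel function of the first kind, $K_\nu$ the Macdonald function, i.e. the modified Bessel function $K_\nu(X)=\frac{\pi}{2\sin(\pi\nu)}(I_{-\nu}(X)-I_\nu(X))$, and primes denoting derivatives): $$A(\xi)=\frac{\sin(\pi z_0)J_{2\mu}(2\sqrt\xi)-\sin(\pi z_0')J_{-2\mu}(2\sqrt\xi)}{\sin(2\pi\mu)},\qquad B(\xi)=K_{2\mu}(2\sqrt\xi),$$ $$\widetilde A(\xi)=\xi\frac{d}{d\xi}A(\xi)=\sqrt\xi\,\frac{\sin(\pi z_0)J'_{2\mu}(2\sqrt\xi)-\sin(\pi z_0')J'_{-2\mu}(2\sqrt\xi)}{\sin(2\pi\mu)},\qquad \widetilde B(\xi)=\xi\frac{d}{d\xi}B(\xi)=\sqrt\xi\,K'_{2\mu}(2\sqrt\xi).$$ For $\mu=0$ these expressions are understood by continuity in $\mu$ (with $\frac{z_0+z_0'}2$ fixed). Expressions with denominators $\xi-\eta$ or $x-y$ are understood on the diagonal by continuity. $W_{\kappa,\mu}(x)$, $x>0$,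 is the Whittaker function: for $\mu\neq0$, $$x^{-1/2}e^{x/2}W_{\kappa,\mu}(x)=\frac{\Gamma(-2\mu)x^{\mu}}{\Gamma(\frac12-\kappa-\mu)}\,{}_1F_1(\tfrac12-\kappa+\mu;2\mu+1;x)+\frac{\Gamma(2\mu)x^{-\mu}}{\Gamma(\frac12-\kappa+\mu)}\,{}_1F_1(\tfrac12-\kappa-\mu;-2\mu+1;x),$$ and for $\mu=0$ it is defined by the limit $\mu\to0$. Put $$\varphi(x)=x^{-1/2}W_{a+\frac12,\mu}(x),\quad \varphi_-(x)=x^{-1/2}W_{a-\frac12,\mu}(x),\quad \psi(x)=x^{-1/2}W_{-a+\frac12,\mu}(x),\quad \psi_-(x)=x^{-1/2}W_{-a-\frac12,\mu}(x).$$ The matrix Whittaker kernel with parameters $z,z'$ is $K=\begin{bmatrix} K_{++} & K_{+-} \\ K_{-+} & K_{--} \end{bmatrix}$, whose blocks are the kernels on $\mathbb{R}_+=(0,+\infty)$ $$K_{++}(x,y)=\frac{1}{\Gamma(z)\Gamma(z')}\,\frac{\varphi(x)\varphi_-(y)-\varphi_-(x)\varphi(y)}{x-y},\qquad K_{--}(x,y)=\frac{1}{\Gamma(-z)\Gamma(-z')}\,\frac{\psi(x)\psi_-(y)-\psi_-(x)\psi(y)}{x-y},$$ $$K_{+-}(x,y)=\frac{\sqrt{\sin(\pi z)\sin(\pi z')}}{\pi}\,\frac{\varphi(x)\psi(y)+zz'\varphi_-(x)\psi_-(y)}{x+y},\qquad K_{-+}(x,y)=-K_{+-}(y,x).$$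 *)

(* Defs.v *)
From Stdlib Require Import Reals Factorial.
From Coquelicot Require Import Coquelicot.

Open Scope R_scope.

(* As for Coquelicot's [Lim], [Series] and [Derive], the values of the total
   operators [Clim], [CSeries] and [CDerive] are meaningful when the limit, sum
   or derivative exists. *)

Definition Clim {T : Type} (F : (T -> Prop) -> Prop) (f : T -> C) : C :=
  @iota C_CompleteNormedModule (fun l : C => filterlim f F (locally l)).

Definition CSeries (a : nat -> C) : C :=
  @iota C_CompleteNormedModule (fun l : C => is_series a l).

Definition CDerive (f : R -> C) (x : R) : C :=
  @iota C_R_CompleteNormedModule
    (fun l : C => @is_derive R_AbsRing C_R_NormedModule f x l).

Definition Cexp (w : C) : C :=
  (exp (Re w) * cos (Im w), exp (Re w) * sin (Im w)).

Definition Csin (w : C) : C :=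
  ((Cexp (Ci * w) - Cexp (- (Ci * w))) / (2 * Ci))%C.

(* [Rcpow x s] is x^s for a real base x > 0 and a complex exponent s. *)
Definition Rcpow (x : R) (s : C) : C := Cexp (s * ln x).

(* Pochhammer symbol: a (a + 1) ... (a + n - 1). *)
Fixpoint Cpoch (a : C) (n : nat) : C :=
  match n with
  | O => 1
  | S m => (Cpoch a m * (a + INR m))%C
  end.

(* Euler's limit formula n! n^s / (s (s + 1) ... (s + n)). At the poles
   s = 0, -1, -2, ... it yields 0, because [/ 0 = 0]; hence [/ CGamma s] is the
   entire function 1/Gamma at every s. *)
Definition CGamma (s : C) : C :=
  Clim eventually
    (fun n : nat => (INR (fact n) * Rcpow (INR n) s / Cpoch s (S n))%C).

Definition BesselJ (nu : C) (X : R) : C :=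
  CSeries (fun k : nat =>
    ((- (1)) ^ k * Rcpow (X / 2) (2 * INR k + nu)
       / (INR (fact k) * CGamma (INR k + nu + 1)))%C).

Definition BesselI (nu : C) (X : R) : C :=
  CSeries (fun k : nat =>
    (Rcpow (X / 2) (2 * INR k + nu)
       / (INR (fact k) * CGamma (INR k + nu + 1)))%C).

(* Macdonald function; for integer orders, where sin (pi nu) vanishes, it is
   the limit over nearby orders. *)
Definition BesselK (nu : C) (X : R) : C :=
  let formula (nu : C) : C :=
    (PI / (2 * Csin (PI * nu)) * (BesselI (- nu) X - BesselI nu X))%C in
  if Ceq_dec (Csin (PI * nu)) 0 then Clim (locally' nu) formula else formula nu.

Definition hypergeom1F1 (a c : C) (x : R) : C :=
  CSeries (fun k : nat =>
    (Cpoch a k / Cpoch c k * (x ^ k)%R / INR (fact k))%C).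

(* The defining formula is only singular at the values of mu with 2 mu an
   integer; among these, only mu = 0 is relevant here, since |Re (2 mu)| < 1. *)
Definition WhittakerW (kappa mu : C) (x : R) : C :=
  let formula (mu : C) : C :=
    (sqrt x * exp (- x / 2) *
     (CGamma (- (2 * mu)) * Rcpow x mu / CGamma (1 / 2 - kappa - mu)
        * hypergeom1F1 (1 / 2 - kappa + mu) (2 * mu + 1) x
      + CGamma (2 * mu) * Rcpow x (- mu) / CGamma (1 / 2 - kappa + mu)
        * hypergeom1F1 (1 / 2 - kappa - mu) (- (2 * mu) + 1) x))%C in
  if Ceq_dec mu 0 then Clim (locally' (RtoC 0)) formula else formula mu.

(* Extension of a kernel to the diagonal by continuity: k(x,x) is the limit of
   k(x,y) as y -> x, y <> x. *)
Definition diag_ext (k : R -> R -> C) (x y : R) : C :=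
  if Req_EM_T x y then Clim (locally' x) (k x) else k x y.

Definition is_integer (w : C) : Prop := exists m : Z, w = IZR m.

Definition admissible (z z' : C) : Prop :=
  ~ is_integer z /\ ~ is_integer z' /\
  (z' = Cconj z \/
   (Im z = 0 /\ Im z' = 0 /\
    exists m : Z, IZR m < Re z < IZR m + 1 /\ IZR m < Re z' < IZR m + 1)).

(* For admissible parameters sin (pi z) sin (pi z') is a positive real number;
   this is its positive square root. *)
Definition sqrt_sin_sin (z z' : C) : R :=
  sqrt (Re (Csin (PI * z) * Csin (PI * z'))).

Inductive block_sign := Plus | Minus.

Section WhittakerKernel.

Variables z z' : C.

Let a : C := ((z + z') / 2)%C.
Let mu : C := ((z - z') / 2)%C.

Definition phi (x : R) : C :=
  (/ sqrt x * WhittakerW (a + 1 / 2) mu x)%C.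
Definition phi_minus (x : R) : C :=
  (/ sqrt x * WhittakerW (a - 1 / 2) mu x)%C.
Definition psi (x : R) : C :=
  (/ sqrt x * WhittakerW (- a + 1 / 2) mu x)%C.
Definition psi_minus (x : R) : C :=
  (/ sqrt x * WhittakerW (- a - 1 / 2) mu x)%C.

Definition Kpp : R -> R -> C := diag_ext (fun x y : R =>
  (1 / (CGamma z * CGamma z')
   * ((phi x * phi_minus y - phi_minus x * phi y) / (x - y)))%C).

Definition Kmm : R -> R -> C := diag_ext (fun x y : R =>
  (1 / (CGamma (- z) * CGamma (- z'))
   * ((psi x * psi_minus y - psi_minus x * psi y) / (x - y)))%C).

Definition Kpm (x y : R) : C :=
  (sqrt_sin_sin z z' / PI
   * ((phi x * psi y + z * z' * phi_minus x * psi_minus y) / (x + y)))%C.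

Definition Kmp (x y : R) : C := (- Kpm y x)%C.

Definition matrix_Whittaker_kernel (e d : block_sign) : R -> R -> C :=
  match e, d with
  | Plus, Plus => Kpp
  | Plus, Minus => Kpm
  | Minus, Plus => Kmp
  | Minus, Minus => Kmm
  end.

End WhittakerKernel.

(* Meaningful for mu <> 0 only. *)
Definition limA_formula (z0 z0' : C) (xi : R) : C :=
  let mu : C := ((z0 - z0') / 2)%C in
  ((Csin (PI * z0) * BesselJ (2 * mu) (2 * sqrt xi)
    - Csin (PI * z0') * BesselJ (- (2 * mu)) (2 * sqrt xi))
   / Csin (2 * PI * mu))%C.

Section LimitKernel.

Variables z0 z0' : C.

Let mu : C := ((z0 - z0') / 2)%C.

(* For mu = 0 the limit mu -> 0 keeps c = (z0 + z0') / 2 fixed. *)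
Definition limA (xi : R) : C :=
  if Ceq_dec mu 0 then
    let c : C := ((z0 + z0') / 2)%C in
    Clim (locally' (RtoC 0)) (fun m : C => limA_formula (c + m) (c - m) xi)
  else limA_formula z0 z0' xi.

Definition limB (xi : R) : C := BesselK (2 * mu) (2 * sqrt xi).

Definition limA_tilde (xi : R) : C := (xi * CDerive limA xi)%C.
Definition limB_tilde (xi : R) : C := (xi * CDerive limB xi)%C.

Definition Klim_pp : R -> R -> C := diag_ext (fun xi eta : R =>
  ((limA xi * limA_tilde eta - limA_tilde xi * limA eta) / (xi - eta))%C).

Definition Klim_pm (xi eta : R) : C :=
  (- (2 * sqrt_sin_sin z0 z0' / PI
      * ((limA xi * limB_tilde eta - limA_tilde xi * limB eta) / (xi + eta))))%C.

Definition Klim_mp (xi eta : R) : C := (- Klim_pm eta xi)%C.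

Definition Klim_mm : R -> R -> C := diag_ext (fun xi eta : R =>
  (4 * Csin (PI * z0) * Csin (PI * z0') / PI ^ 2
   * ((limB xi * limB_tilde eta - limB_tilde xi * limB eta) / (xi - eta)))%C).

Definition limit_kernel (e d : block_sign) : R -> R -> C :=
  match e, d with
  | Plus, Plus => Klim_pp
  | Plus, Minus => Klim_pm
  | Minus, Plus => Klim_mp
  | Minus, Minus => Klim_mm
  end.

End LimitKernel.

(* Main.v *)
Require Import Defs.
From Stdlib Require Import Reals Factorial Lra Lia List FunctionalExtensionality.
From Coquelicot Require Import Coquelicot.
Open Scope R_scope.

(** Write z = a + mu, z' = a - mu with a = c + N, and let t = ln x. The
    reflection formula turns the definition of the Whittaker function into
      x^(-1/2) W_(a+1/2, mu) (x) = e^(-x/2) pi / sin (2 pi mu) (h (- mu) - h (mu)),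
      h (m) = 1 / Gamma (- a - m)
              sum_k (- a + m)_k e^((k + m) t) / (k! Gamma (k + 1 + 2 m)),
    and the function F_0 multiplying e^(-x/2) has, with F_j = (d/dt)^j F_0, the
    same expression with an additional factor (k + m)^j in the terms
    ([oddser], [WhittakerW_oddser]). Lowering the first index by one gives
    (F_1 - a F_0) / (z z') ([oddser_lowering]); the terms in a cancel in the
    determinants, so that the diagonal blocks are
      K_{++} (x, y) = e^(-(x+y)/2) / (Gamma z Gamma z' z z')
                      (F_0 (x) F_1 (y) - F_1 (x) F_0 (y)) / (x - y)
    and the same for K_{--} with (z, z') replaced by (- z', - z), while in
    K_{+-} the antisymmetric combination comes with the factor a, which grows
    like N, and everything else stays bounded. The limit kernel has the same
    form, with Bessel series in place of the confluent ones.

    Hence only the rescaled series have to be followed as N tends to infinity.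
    At x = xi / N the coefficient (- a + m)_k / N^k tends to (- 1)^k, the
    prefactor N^(- m) / Gamma (- a - m), divided by N! N^c with N even, tends to
    - sin (pi (c + m)) / pi by Euler's formula and the reflection formula, and the terms are dominated by those of an
    exponential series, so the sums converge ([tannery]). This is
    [plus_oddser_tends]; [minus_oddser_tends] is its analogue with - a, where
    the signs disappear and the Bessel functions J become I.

    For mu = 0 all functions are limits as m tends to 0 of odd functions of m
    divided by sin (2 pi m), and this limit has to be exchanged with the one in
    N and with derivatives in x. The functions of m are uniform limits of
    polynomials on a disc ([Hol]), and for these Cauchy's estimate bounds the
    rate of convergence of the difference quotients at 0 by a bound for the
    function on the disc alone ([Hol_difference_quotient]). As the bounds are
    uniform in N and locally in x, the exchange is legitimate, and pointwise
    convergence for m <> 0 is enough ([oddser_tends], [cderive_oddser]).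

    1 / Gamma is obtained as the limit of the reciprocals of Euler's
    approximants, whose successive quotients are 1 + O (1 / n^2) locally
    uniformly ([egam_growth]); the reflection formula comes from the integrals
    of cos (2 s t) cos^n t over a quarter period ([invG_reflection]). *)

(** * Limits of complex-valued functions *)

Definition ctends {T : Type} (F : (T -> Prop) -> Prop) (f : T -> C) (l : C) : Prop :=
  forall eps : R, 0 < eps -> F (fun x => Cmod (f x - l)%C < eps).

Lemma ctends_filterlim {T : Type} {F : (T -> Prop) -> Prop} {FF : Filter F} (f : T -> C) (l : C) :
  ctends F f l -> filterlim f F (locally l).
Proof.
  intros H. apply filterlim_locally. intros eps.
  generalize (H eps (cond_pos eps)). apply filter_imp. intros x Hx.
  apply C_NormedModule_mixin_compat1. exact Hx.
Qed.

Lemma filterlim_ctends {T : Type} {F : (T -> Prop) -> Prop} {FF : Filter F} (f : T -> C) (l : C) :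
  filterlim f F (locally l) -> ctends F f l.
Proof.
  intros H eps He.
  assert (Hs : 0 < sqrt 2) by (apply sqrt_lt_R0; lra).
  assert (Hd : 0 < eps / sqrt 2) by (apply Rdiv_lt_0_compat; lra).
  generalize (proj1 (filterlim_locally f l) H (mkposreal _ Hd)).
  apply filter_imp. intros x Hx.
  generalize (C_NormedModule_mixin_compat2 _ _ _ Hx). simpl.
  replace (sqrt 2 * (eps / sqrt 2)) with eps by (field; lra).
  intros Hlt. exact Hlt.
Qed.

Lemma Cmod_sub_sym (x y : C) : Cmod (x - y)%C = Cmod (y - x)%C.
Proof. rewrite <- Cmod_opp. f_equal. ring. Qed.

Lemma Cmod_triangle_inv (x y : C) : Cmod x <= Cmod (x - y)%C + Cmod y.
Proof. replace x with ((x - y) + y)%C at 1 by ring. apply Cmod_triangle. Qed.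

Lemma Cmod_minus_le (x y : C) : Cmod (x - y)%C <= Cmod x + Cmod y.
Proof. unfold Cminus. eapply Rle_trans. apply Cmod_triangle. rewrite Cmod_opp. lra. Qed.

Lemma Cmod_minus_eq_0 (x y : C) : Cmod (x - y)%C = 0 -> x = y.
Proof.
  intros H. apply Cmod_eq_0 in H. replace x with ((x - y) + y)%C by ring.
  rewrite H. ring.
Qed.

Lemma ctends_unique {T : Type} {F : (T -> Prop) -> Prop} {FF : ProperFilter F} (f : T -> C) (l l' : C) :
  ctends F f l -> ctends F f l' -> l = l'.
Proof.
  intros H H'. apply Cmod_minus_eq_0.
  destruct (Rle_lt_or_eq_dec 0 (Cmod (l - l')%C) (Cmod_ge_0 _)) as [Hlt | Heq]; [ | now symmetry ].
  exfalso.
  assert (Hp : 0 < Cmod (l - l')%C / 2) by lra.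
  destruct (filter_ex _ (filter_and _ _ (H _ Hp) (H' _ Hp))) as [x [H1 H2]].
  rewrite Cmod_sub_sym in H1.
  generalize (Cmod_triangle (l - f x)%C (f x - l')%C).
  replace ((l - f x) + (f x - l'))%C with (l - l')%C by ring. lra.
Qed.

Lemma Clim_eq {T : Type} {F : (T -> Prop) -> Prop} {FF : ProperFilter F} (f : T -> C) (l : C) :
  ctends F f l -> Clim F f = l.
Proof.
  intros H. unfold Clim.
  apply (@iota_filterlim_locally C_AbsRing C_CompleteNormedModule T F).
  - apply Proper_StrongProper, FF.
  - apply ctends_filterlim; [ exact H ].
Qed.

Lemma ctends_const {T : Type} {F : (T -> Prop) -> Prop} {FF : Filter F} (l : C) :
  ctends F (fun _ => l) l.
Proof.
  intros eps He. apply filter_forall. intros _.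
  replace (l - l)%C with (RtoC 0) by ring. rewrite Cmod_0. exact He.
Qed.

Lemma ctends_ext_loc {T : Type} {F : (T -> Prop) -> Prop} {FF : Filter F} (f g : T -> C) (l : C) :
  F (fun x => f x = g x) -> ctends F f l -> ctends F g l.
Proof.
  intros He H eps Heps. generalize (filter_and _ _ He (H _ Heps)).
  apply filter_imp. intros x [-> Hx]. exact Hx.
Qed.

Lemma ctends_ext {T : Type} {F : (T -> Prop) -> Prop} {FF : Filter F} (f g : T -> C) (l : C) :
  (forall x, f x = g x) -> ctends F f l -> ctends F g l.
Proof. intros He. apply ctends_ext_loc; [ now apply filter_forall ]. Qed.

Lemma ctends_value {T : Type} (F : (T -> Prop) -> Prop) (f : T -> C) (l l' : C) :
  l = l' -> ctends F f l -> ctends F f l'.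
Proof. now intros ->. Qed.

Lemma ctends_filter_le {T : Type} (F G : (T -> Prop) -> Prop) (f : T -> C) (l : C) :
  filter_le F G -> ctends G f l -> ctends F f l.
Proof. intros HFG H eps He. apply HFG, H, He. Qed.

Lemma ctends_plus {T : Type} {F : (T -> Prop) -> Prop} {FF : Filter F} (f g : T -> C) (l m : C) :
  ctends F f l -> ctends F g m -> ctends F (fun x => f x + g x)%C (l + m)%C.
Proof.
  intros Hf Hg eps He. assert (He2 : 0 < eps / 2) by lra.
  generalize (filter_and _ _ (Hf _ He2) (Hg _ He2)). apply filter_imp.
  intros x [H1 H2].
  replace (f x + g x - (l + m))%C with ((f x - l) + (g x - m))%C by ring.
  generalize (Cmod_triangle (f x - l)%C (g x - m)%C). lra.
Qed.

Lemma ctends_opp {T : Type} {F : (T -> Prop) -> Prop} {FF : Filter F} (f : T -> C) (l : C) :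
  ctends F f l -> ctends F (fun x => - f x)%C (- l)%C.
Proof.
  intros Hf eps He. generalize (Hf _ He). apply filter_imp. intros x Hx.
  replace (- f x - - l)%C with (- (f x - l))%C by ring. rewrite Cmod_opp. exact Hx.
Qed.

Lemma ctends_minus {T : Type} {F : (T -> Prop) -> Prop} {FF : Filter F} (f g : T -> C) (l m : C) :
  ctends F f l -> ctends F g m -> ctends F (fun x => f x - g x)%C (l - m)%C.
Proof.
  intros Hf Hg. apply ctends_plus; [ exact Hf | ].
  apply ctends_opp; assumption.
Qed.

Lemma ctends_bounded {T : Type} {F : (T -> Prop) -> Prop} {FF : Filter F} (f : T -> C) (l : C) :
  ctends F f l -> F (fun x => Cmod (f x) <= Cmod l + 1).
Proof.
  intros Hf. generalize (Hf 1 Rlt_0_1). apply filter_imp. intros x Hx.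
  generalize (Cmod_triangle_inv (f x) l). lra.
Qed.

Lemma ctends_mult {T : Type} {F : (T -> Prop) -> Prop} {FF : Filter F} (f g : T -> C) (l m : C) :
  ctends F f l -> ctends F g m -> ctends F (fun x => f x * g x)%C (l * m)%C.
Proof.
  intros Hf Hg eps He.
  set (K := Cmod l + Cmod m + 1).
  assert (HK : 0 < K) by (unfold K; generalize (Cmod_ge_0 l) (Cmod_ge_0 m); lra).
  assert (He2 : 0 < eps / (2 * K)) by (apply Rdiv_lt_0_compat; lra).
  generalize (filter_and _ _ (ctends_bounded (F := F) f l Hf)
    (filter_and _ _ (Hf _ He2) (Hg _ He2))). apply filter_imp.
  intros x [H0 [H1 H2]].
  replace (f x * g x - l * m)%C with (f x * (g x - m) + (f x - l) * m)%C by ring.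
  eapply Rle_lt_trans; [ apply Cmod_triangle | ]. rewrite !Cmod_mult.
  assert (E : eps = K * (eps / (2 * K)) + (eps / (2 * K)) * K) by (field; lra).
  rewrite E. generalize (Cmod_ge_0 l) (Cmod_ge_0 m) (Cmod_ge_0 (f x))
    (Cmod_ge_0 (g x - m)%C) (Cmod_ge_0 (f x - l)%C). intros.
  assert (Cmod (f x) * Cmod (g x - m)%C <= K * Cmod (g x - m)%C)
    by (apply Rmult_le_compat_r; unfold K; lra).
  assert (Cmod (f x - l)%C * Cmod m <= Cmod (f x - l)%C * K)
    by (apply Rmult_le_compat_l; unfold K; lra).
  assert (K * Cmod (g x - m)%C < K * (eps / (2 * K))) by (apply Rmult_lt_compat_l; lra).
  assert (Cmod (f x - l)%C * K < (eps / (2 * K)) * K) by (apply Rmult_lt_compat_r; lra).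
  lra.
Qed.

Lemma ctends_neq0 {T : Type} {F : (T -> Prop) -> Prop} {FF : Filter F} (f : T -> C) (l : C) :
  l <> 0%C -> ctends F f l -> F (fun x => Cmod l / 2 <= Cmod (f x)).
Proof.
  intros Hl Hf. apply Cmod_gt_0 in Hl.
  assert (Hp : 0 < Cmod l / 2) by lra.
  generalize (Hf _ Hp). apply filter_imp. intros x Hx.
  generalize (Cmod_triangle_inv l (f x)). rewrite Cmod_sub_sym. lra.
Qed.

Lemma ctends_inv {T : Type} {F : (T -> Prop) -> Prop} {FF : Filter F} (f : T -> C) (l : C) :
  l <> 0%C -> ctends F f l -> ctends F (fun x => / f x)%C (/ l)%C.
Proof.
  intros Hl Hf eps He. pose proof (proj1 (Cmod_gt_0 l) Hl) as Hl0.
  assert (Hp : 0 < eps * (Cmod l * Cmod l / 2)).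
  { apply Rmult_lt_0_compat; [ exact He | ]. generalize (Rmult_lt_0_compat _ _ Hl0 Hl0). lra. }
  generalize (filter_and _ _ (ctends_neq0 (F := F) f l Hl Hf) (Hf _ Hp)). apply filter_imp.
  intros x [H1 H2].
  assert (Hx : 0 < Cmod (f x)) by lra. pose proof (proj2 (Cmod_gt_0 (f x)) Hx) as Hx0.
  replace (/ f x - / l)%C with (- ((f x - l) / (f x * l)))%C
    by (field; now split).
  rewrite Cmod_opp, Cmod_div, Cmod_mult by (now apply Cmult_neq_0).
  apply Rmult_lt_reg_r with (Cmod (f x) * Cmod l); [ now apply Rmult_lt_0_compat | ].
  unfold Rdiv. rewrite Rmult_assoc, Rinv_l, Rmult_1_r
    by (apply Rgt_not_eq, Rmult_lt_0_compat; assumption).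
  eapply Rlt_le_trans; [ exact H2 | ].
  apply Rmult_le_compat_l; [ lra | ].
  apply Rle_trans with (Cmod l / 2 * Cmod l); [ lra | ].
  apply Rmult_le_compat_r; lra.
Qed.

Lemma ctends_div {T : Type} {F : (T -> Prop) -> Prop} {FF : Filter F} (f g : T -> C) (l m : C) :
  m <> 0%C -> ctends F f l -> ctends F g m ->
  ctends F (fun x => f x / g x)%C (l / m)%C.
Proof.
  intros Hm Hf Hg. apply ctends_mult; [ exact Hf | ].
  now apply ctends_inv.
Qed.

Lemma ctends_RtoC {T : Type} {F : (T -> Prop) -> Prop} {FF : Filter F} (f : T -> R) (l : R) :
  filterlim f F (locally l) -> ctends F (fun x => RtoC (f x)) (RtoC l).
Proof.
  intros H eps He. generalize (proj1 (filterlim_locally f l) H (mkposreal _ He)).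
  apply filter_imp. intros x Hx. rewrite <- RtoC_minus, Cmod_R. exact Hx.
Qed.

Lemma ctends_bound {T : Type} {F : (T -> Prop) -> Prop} {FF : ProperFilter F} (f : T -> C) (l : C) (M : R) :
  F (fun x => Cmod (f x) <= M) -> ctends F f l -> Cmod l <= M.
Proof.
  intros HM Hf. apply Rnot_lt_le. intros Hlt.
  assert (Hp : 0 < Cmod l - M) by lra.
  destruct (filter_ex _ (filter_and _ _ HM (Hf _ Hp))) as [x [H1 H2]].
  generalize (Cmod_triangle_inv l (f x)). rewrite Cmod_sub_sym. lra.
Qed.

Lemma ctends_squeeze {T : Type} {F : (T -> Prop) -> Prop} {FF : Filter F} (f : T -> C) (l : C) (b : T -> R) :
  F (fun x => Cmod (f x - l)%C <= b x) -> filterlim b F (locally 0) ->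
  ctends F f l.
Proof.
  intros Hb H0 eps He.
  generalize (filter_and _ _ Hb (proj1 (filterlim_locally b 0) H0 (mkposreal _ He))).
  apply filter_imp. intros x [H1 H2].
  change (Rabs (b x - 0) < eps) in H2. generalize (Rle_abs (b x - 0)). lra.
Qed.

(** Every exchange of limits below has this form: partial sums against the
    parameter of the terms, and [m -> 0] against [N -> oo]. *)
Lemma ctends_interchange {S T : Type} {F : (S -> Prop) -> Prop} {G : (T -> Prop) -> Prop}
  {FF : Filter F} {GG : ProperFilter G}
  (f : S -> T -> C) (u : S -> C) (v : T -> C) (l : C) (b : T -> R) :
  G (fun m => F (fun n => Cmod (f n m - u n)%C <= b m)) ->
  filterlim b G (locally 0) ->
  G (fun m => ctends F (fun n => f n m) (v m)) -> ctends G v l -> ctends F u l.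
Proof.
  intros Hu Hb Hv Hl eps He. assert (He4 : 0 < eps / 4) by lra.
  pose proof (proj1 (filterlim_locally b 0) Hb (mkposreal _ He4)) as Hb'.
  destruct (filter_ex _ (filter_and _ _ Hu (filter_and _ _ Hv (filter_and _ _ Hb' (Hl _ He4)))))
    as [m [H0 [H1 [H2 H3]]]].
  change (Rabs (b m - 0) < eps / 4) in H2. generalize (Rle_abs (b m - 0)). intros Hbm.
  generalize (filter_and _ _ H0 (H1 _ He4)). apply filter_imp. intros n [H4 H5].
  replace (u n - l)%C with (- (f n m - u n) + ((f n m - v m) + (v m - l)))%C by ring.
  eapply Rle_lt_trans; [ apply Cmod_triangle | ]. rewrite Cmod_opp.
  generalize (Cmod_triangle (f n m - v m)%C (v m - l)%C). lra.
Qed.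

Lemma Cminus_0_r (x : C) : (x - 0)%C = x.
Proof. ring. Qed.

Lemma locally'_0_intro (P : C -> Prop) (r : R) :
  0 < r -> (forall m : C, m <> 0%C -> Cmod m <= r -> P m) -> locally' (RtoC 0) P.
Proof.
  intros Hr H.
  assert (Hs : 0 < sqrt 2) by (apply sqrt_lt_R0; lra).
  assert (Hd : 0 < r / sqrt 2) by (apply Rdiv_lt_0_compat; lra).
  exists (mkposreal _ Hd). intros m Hm Hm0. apply H; [ exact Hm0 | ].
  generalize (C_NormedModule_mixin_compat2 _ _ _ Hm). simpl.
  replace (sqrt 2 * (r / sqrt 2)) with r by (field; lra).
  change (minus m (RtoC 0)) with (m - 0)%C.
  rewrite Cminus_0_r. lra.
Qed.

Global Instance locally'_0_filter : ProperFilter (locally' (RtoC 0)).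
Proof.
  split.
  - intros P [d Hd]. exists (RtoC (d / 2)). apply Hd.
    + apply C_NormedModule_mixin_compat1.
      change (Cmod (RtoC (d / 2) - 0)%C < d).
      rewrite Cminus_0_r, Cmod_R, Rabs_right; generalize (cond_pos d); lra.
    + intros H. apply RtoC_inj in H. generalize (cond_pos d); lra.
  - apply within_filter, locally_filter.
Qed.

Global Instance locally'_R_filter (x : R) : ProperFilter (locally' x).
Proof.
  split.
  - intros P [d Hd]. exists (x + d / 2). generalize (cond_pos d); intros Hp. apply Hd.
    + change (Rabs (x + d / 2 - x) < d). replace (x + d / 2 - x) with (d / 2) by ring.
      rewrite Rabs_right; lra.
    + lra.
  - apply within_filter, locally_filter.
Qed.

Lemma ctends_id_0 : ctends (locally' (RtoC 0)) (fun m => m) 0.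
Proof.
  intros eps He. apply locally'_0_intro with (eps / 2); [ lra | ]. intros m _ Hm.
  rewrite Cminus_0_r. lra.
Qed.

Lemma filterlim_Cmod_0 (K : R) :
  filterlim (fun m : C => K * Cmod m) (locally' (RtoC 0)) (locally 0).
Proof.
  apply filterlim_locally. intros eps.
  assert (HK : 0 < Rabs K + 1) by (generalize (Rabs_pos K); lra).
  assert (Hp : 0 < eps / (2 * (Rabs K + 1)))
    by (apply Rdiv_lt_0_compat; [ apply cond_pos | lra ]).
  apply locally'_0_intro with (1 := Hp). intros m _ Hm.
  change (Rabs (K * Cmod m - 0) < eps). rewrite Rminus_0_r, Rabs_mult, (Rabs_pos_eq (Cmod m)) by apply Cmod_ge_0.
  apply Rle_lt_trans with ((Rabs K + 1) * (eps / (2 * (Rabs K + 1)))).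
  - apply Rmult_le_compat; try apply Rabs_pos; try apply Cmod_ge_0; [ lra | exact Hm ].
  - replace ((Rabs K + 1) * (eps / (2 * (Rabs K + 1)))) with (eps / 2) by (field; lra).
    generalize (cond_pos eps); lra.
Qed.

(** * Complex-valued functions of a real variable *)

Definition cderive (f : R -> C) (x : R) (l : C) : Prop :=
  @is_derive R_AbsRing C_R_NormedModule f x l.

Lemma Cext (u v : C) : Re u = Re v -> Im u = Im v -> u = v.
Proof. destruct u, v. simpl. now intros -> ->. Qed.

Lemma Cmod_le_Re_Im (u : C) : Cmod u <= Rabs (Re u) + Rabs (Im u).
Proof.
  unfold Cmod. apply Rsqr_incr_0_var; [ | generalize (Rabs_pos (Re u)) (Rabs_pos (Im u)); lra ].
  rewrite Rsqr_sqrt by nra. unfold Rsqr.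
  rewrite <- (pow2_abs (fst u)), <- (pow2_abs (snd u)).
  change (fst u) with (Re u). change (snd u) with (Im u).
  generalize (Rabs_pos (Re u)) (Rabs_pos (Im u)). nra.
Qed.

Lemma Im_le_Cmod (u : C) : Rabs (Im u) <= Cmod u.
Proof. eapply Rle_trans; [ | apply Rmax_Cmod ]. apply Rmax_r. Qed.

Lemma cderive_Re_Im (f : R -> C) (x : R) (l : C) :
  is_derive (fun t => Re (f t)) x (Re l) -> is_derive (fun t => Im (f t)) x (Im l) ->
  cderive f x l.
Proof.
  intros H1 H2. unfold cderive.
  assert (H : @is_derive R_AbsRing C_R_NormedModule
    (fun t => plus (scal (Re (f t)) (1, 0) : C_R_NormedModule) (scal (Im (f t)) (0, 1))) x
    (plus (scal (Re l) (1, 0) : C_R_NormedModule) (scal (Im l) (0, 1)))).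
  { apply (@is_derive_plus R_AbsRing C_R_NormedModule).
    - apply (@is_derive_scal_l R_AbsRing C_R_NormedModule _ x _ (1, 0)), H1.
    - apply (@is_derive_scal_l R_AbsRing C_R_NormedModule _ x _ (0, 1)), H2. }
  assert (E : forall u : C, plus (scal (Re u) (1, 0) : C_R_NormedModule) (scal (Im u) (0, 1)) = u).
  { intros [a b]. apply Cext; cbn; ring. }
  rewrite E in H. eapply is_derive_ext; [ | exact H ]. intros t. apply E.
Qed.

Lemma is_linear_Re : @is_linear R_AbsRing C_R_NormedModule R_NormedModule Re.
Proof. exact (@is_linear_fst R_AbsRing R_NormedModule R_NormedModule). Qed.

Lemma is_linear_Im : @is_linear R_AbsRing C_R_NormedModule R_NormedModule Im.
Proof. exact (@is_linear_snd R_AbsRing R_NormedModule R_NormedModule). Qed.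

Lemma cderive_Re (f : R -> C) (x : R) (l : C) :
  cderive f x l -> is_derive (fun t => Re (f t)) x (Re l).
Proof.
  intros H. unfold is_derive.
  apply (filterdiff_ext_lin _ (fun y : R => Re (@scal _ C_R_NormedModule y l))).
  - apply (@filterdiff_comp R_AbsRing R_NormedModule C_R_NormedModule R_NormedModule
      (locally x) _ f Re (fun y => scal y l) Re H).
    apply filterdiff_linear, is_linear_Re.
  - intros y. reflexivity.
Qed.

Lemma cderive_Im (f : R -> C) (x : R) (l : C) :
  cderive f x l -> is_derive (fun t => Im (f t)) x (Im l).
Proof.
  intros H. unfold is_derive.
  apply (filterdiff_ext_lin _ (fun y : R => Im (@scal _ C_R_NormedModule y l))).
  - apply (@filterdiff_comp R_AbsRing R_NormedModule C_R_NormedModule R_NormedModule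
      (locally x) _ f Im (fun y => scal y l) Im H).
    apply filterdiff_linear, is_linear_Im.
  - intros y. reflexivity.
Qed.

Lemma cderive_unique (f : R -> C) (x : R) (l l' : C) :
  cderive f x l -> cderive f x l' -> l = l'.
Proof.
  intros H H'. apply Cext.
  - rewrite <- (is_derive_unique _ _ _ (cderive_Re f x l H)).
    apply is_derive_unique, cderive_Re, H'.
  - rewrite <- (is_derive_unique _ _ _ (cderive_Im f x l H)).
    apply is_derive_unique, cderive_Im, H'.
Qed.

Lemma CDerive_eq (f : R -> C) (x : R) (l : C) : cderive f x l -> CDerive f x = l.
Proof.
  intros H. unfold CDerive.
  apply (@iota_unique R_AbsRing C_R_CompleteNormedModule
    (fun l : C => @is_derive R_AbsRing C_R_NormedModule f x l) l).
  - intros y Hy. exact (cderive_unique f x y l Hy H).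
  - exact H.
Qed.

Lemma cderive_ext_loc (f g : R -> C) (x : R) (l : C) :
  locally x (fun t => f t = g t) -> cderive f x l -> cderive g x l.
Proof. exact (@is_derive_ext_loc R_AbsRing C_R_NormedModule f g x l). Qed.

Lemma cderive_ext (f g : R -> C) (x : R) (l : C) :
  (forall t, f t = g t) -> cderive f x l -> cderive g x l.
Proof. exact (@is_derive_ext R_AbsRing C_R_NormedModule f g x l). Qed.

Lemma cderive_const (c : C) (x : R) : cderive (fun _ => c) x 0.
Proof. exact (@is_derive_const R_AbsRing C_R_NormedModule c x). Qed.

Lemma cderive_plus (f g : R -> C) (x : R) (l m : C) :
  cderive f x l -> cderive g x m -> cderive (fun t => f t + g t)%C x (l + m)%C.
Proof. intros Hf Hg. exact (@is_derive_plus R_AbsRing C_R_NormedModule f g x l m Hf Hg). Qed.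

Lemma cderive_opp (f : R -> C) (x : R) (l : C) :
  cderive f x l -> cderive (fun t => - f t)%C x (- l)%C.
Proof. intros Hf. exact (@is_derive_opp R_AbsRing C_R_NormedModule f x l Hf). Qed.

Lemma cderive_minus (f g : R -> C) (x : R) (l m : C) :
  cderive f x l -> cderive g x m -> cderive (fun t => f t - g t)%C x (l - m)%C.
Proof. intros Hf Hg. apply cderive_plus; [ exact Hf | now apply cderive_opp ]. Qed.

Lemma cderive_mult (f g : R -> C) (x : R) (l m : C) :
  cderive f x l -> cderive g x m ->
  cderive (fun t => f t * g t)%C x (l * g x + f x * m)%C.
Proof.
  intros Hf Hg.
  pose proof (cderive_Re _ _ _ Hf) as A1. pose proof (cderive_Im _ _ _ Hf) as A2.
  pose proof (cderive_Re _ _ _ Hg) as B1. pose proof (cderive_Im _ _ _ Hg) as B2.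
  assert (P : forall (u v : R -> R) (a b : R), is_derive u x a -> is_derive v x b ->
    is_derive (fun t => u t * v t) x (a * v x + u x * b)).
  { intros u v a b Hu Hv. apply (is_derive_mult u v x a b Hu Hv). intros; apply Rmult_comm. }
  apply cderive_Re_Im.
  - apply (is_derive_ext (fun t => Re (f t) * Re (g t) - Im (f t) * Im (g t))); [ reflexivity | ].
    replace (Re (l * g x + f x * m)%C)
      with (minus (Re l * Re (g x) + Re (f x) * Re m) (Im l * Im (g x) + Im (f x) * Im m))
      by (unfold minus, plus, opp; simpl; unfold Re, Im; ring).
    apply (is_derive_minus (V := R_NormedModule)); apply P; assumption.
  - apply (is_derive_ext (fun t => Re (f t) * Im (g t) + Im (f t) * Re (g t))); [ reflexivity | ].
    replace (Im (l * g x + f x * m)%C)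
      with (plus (Re l * Im (g x) + Re (f x) * Im m) (Im l * Re (g x) + Im (f x) * Re m))
      by (unfold plus; simpl; unfold Re, Im; ring).
    apply (is_derive_plus (V := R_NormedModule)); apply P; assumption.
Qed.

Lemma cderive_cmult (c : C) (f : R -> C) (x : R) (l : C) :
  cderive f x l -> cderive (fun t => c * f t)%C x (c * l)%C.
Proof.
  intros Hf. replace (c * l)%C with (0 * f x + c * l)%C by ring.
  apply (cderive_mult (fun _ => c)); [ apply cderive_const | exact Hf ].
Qed.

Lemma cderive_comp (f : R -> C) (u : R -> R) (x a : R) (l : C) :
  cderive f (u x) l -> is_derive u x a -> cderive (fun t => f (u t)) x (a * l)%C.
Proof.
  intros Hf Hu.
  pose proof (@is_derive_comp R_AbsRing C_R_NormedModule f u x l a Hf Hu) as H.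
  replace (a * l)%C with (@scal R_AbsRing C_R_NormedModule a l); [ exact H | ].
  apply Cext; cbn; ring.
Qed.

Lemma cderive_RtoC (u : R -> R) (x a : R) :
  is_derive u x a -> cderive (fun t => RtoC (u t)) x (RtoC a).
Proof.
  intros H. apply cderive_Re_Im; [ exact H | ].
  exact (@is_derive_const R_AbsRing R_NormedModule 0 x).
Qed.

Lemma cderive_quotient (f : R -> C) (x : R) (l : C) :
  cderive f x l ->
  ctends (locally' x) (fun y => (f y - f x) / (y - x))%C l.
Proof.
  intros H.
  assert (Q : forall (u : R -> R) (a : R), is_derive u x a -> forall eps, 0 < eps ->
    locally' x (fun y => Rabs ((u y - u x) / (y - x) - a) < eps)).
  { intros u a Hu eps He. apply is_derive_Reals in Hu.
    destruct (Hu eps He) as [d Hd]. exists d. intros y Hy Hyx.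
    specialize (Hd (y - x)). rewrite Rplus_minus in Hd.
    apply Hd; [ lra | exact Hy ]. }
  intros eps He. assert (He2 : 0 < eps / 2) by lra.
  generalize (filter_and _ _ (Q _ _ (cderive_Re _ _ _ H) _ He2)
                             (Q _ _ (cderive_Im _ _ _ H) _ He2)).
  intros HH. assert (Hne : locally' x (fun y => y <> x)).
  { exists (mkposreal 1 Rlt_0_1). intros y _ Hy. exact Hy. }
  generalize (filter_and _ _ Hne HH). apply filter_imp. intros y [Hy [H1 H2]].
  eapply Rle_lt_trans; [ apply Cmod_le_Re_Im | ].
  rewrite <- RtoC_minus. unfold Cdiv. rewrite <- RtoC_inv by (now apply Rminus_eq_contra).
  replace (Re ((f y - f x) * RtoC (/ (y - x)) - l)%C)
    with ((Re (f y) - Re (f x)) / (y - x) - Re l) by (unfold Rdiv; cbn; unfold Re; ring).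
  replace (Im ((f y - f x) * RtoC (/ (y - x)) - l)%C)
    with ((Im (f y) - Im (f x)) / (y - x) - Im l) by (unfold Rdiv; cbn; unfold Re, Im; ring).
  lra.
Qed.

Lemma cderive_of_quadratic_bound (f : R -> C) (x K d : R) (l : C) :
  0 < d -> (forall y, Rabs (y - x) <= d ->
            Cmod (f y - f x - (y - x) * l)%C <= K * (y - x) ^ 2) ->
  cderive f x l.
Proof.
  intros Hd H.
  assert (Q : forall (u : R -> R) (a : R),
    (forall y, Rabs (y - x) <= d -> Rabs (u y - u x - (y - x) * a) <= K * (y - x) ^ 2) ->
    is_derive u x a).
  { intros u a Hu. apply is_derive_Reals. intros eps He.
    assert (HK : 0 < Rabs K + 1) by (generalize (Rabs_pos K); lra).
    assert (Hp : 0 < Rmin d (eps / (Rabs K + 1)))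
      by (apply Rmin_pos; [ exact Hd | now apply Rdiv_lt_0_compat ]).
    exists (mkposreal _ Hp). intros h Hh Hhd. simpl in Hhd.
    assert (h1 : Rabs h < d) by (eapply Rlt_le_trans; [ exact Hhd | apply Rmin_l ]).
    assert (h2 : Rabs h < eps / (Rabs K + 1)) by (eapply Rlt_le_trans; [ exact Hhd | apply Rmin_r ]).
    specialize (Hu (x + h)). replace (x + h - x) with h in Hu by ring.
    specialize (Hu (Rlt_le _ _ h1)).
    assert (Hah : 0 < Rabs h) by now apply Rabs_pos_lt.
    replace ((u (x + h) - u x) / h - a) with ((u (x + h) - u x - h * a) / h) by (field; exact Hh).
    unfold Rdiv. rewrite Rabs_mult, Rabs_inv.
    apply Rmult_lt_reg_r with (Rabs h); [ exact Hah | ].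
    rewrite Rmult_assoc, Rinv_l, Rmult_1_r by lra.
    eapply Rle_lt_trans; [ exact Hu | ].
    rewrite <- (pow2_abs h). apply Rle_lt_trans with ((Rabs K + 1) * Rabs h * Rabs h).
    - generalize (Rle_abs K) (pow2_ge_0 (Rabs h)). simpl. nra.
    - apply Rmult_lt_compat_r; [ exact Hah | ].
      apply Rlt_le_trans with ((Rabs K + 1) * (eps / (Rabs K + 1))).
      + now apply Rmult_lt_compat_l.
      + right. field. lra. }
  apply cderive_Re_Im; apply Q; intros y Hy; eapply Rle_trans; [ | exact (H y Hy) | | exact (H y Hy) ].
  - eapply Rle_trans; [ | apply re_le_Cmod ]. right. f_equal. unfold Re; cbn. ring.
  - eapply Rle_trans; [ | apply Im_le_Cmod ]. right. f_equal. unfold Im; cbn. ring.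
Qed.

Lemma Cmod_increment_le (f df : R -> C) (D x y : R) :
  (forall t, Rabs (t - x) <= Rabs (y - x) -> cderive f t (df t) /\ Cmod (df t) <= D) ->
  Cmod (f y - f x)%C <= 2 * D * Rabs (y - x).
Proof.
  intros H. eapply Rle_trans; [ apply Cmod_le_Re_Im | ].
  assert (H1 : Rabs (Re (f y) - Re (f x)) <= D * Rabs (y - x)).
  { apply (bounded_variation (fun t => Re (f t)) (fun t => Re (df t))).
    intros t Ht. destruct (H t Ht) as [Hd Hb]. split; [ now apply cderive_Re | ].
    eapply Rle_trans; [ apply re_le_Cmod | exact Hb ]. }
  assert (H2 : Rabs (Im (f y) - Im (f x)) <= D * Rabs (y - x)).
  { apply (bounded_variation (fun t => Im (f t)) (fun t => Im (df t))).
    intros t Ht. destruct (H t Ht) as [Hd Hb]. split; [ now apply cderive_Im | ].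
    eapply Rle_trans; [ apply Im_le_Cmod | exact Hb ]. }
  change (Re (f y - f x)%C) with (Re (f y) - Re (f x)).
  change (Im (f y - f x)%C) with (Im (f y) - Im (f x)). lra.
Qed.

(** A bound on the second derivatives that is uniform along the filter turns
    into a second-order Taylor bound, and this passes to the pointwise limit;
    no uniform convergence of the derivatives has to be checked. *)
Lemma cderive_limit {T : Type} {F : (T -> Prop) -> Prop} {FF : ProperFilter F} (f0 f1 f2 : T -> R -> C)
  (g0 : R -> C) (x M : R) (l : C) :
  F (fun n => forall y, Rabs (y - x) <= 1 ->
       cderive (f0 n) y (f1 n y) /\ cderive (f1 n) y (f2 n y) /\ Cmod (f2 n y) <= M) ->
  (forall y, Rabs (y - x) <= 1 -> ctends F (fun n => f0 n y) (g0 y)) ->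
  ctends F (fun n => f1 n x) l ->
  cderive g0 x l.
Proof.
  intros H H0 H1. apply cderive_of_quadratic_bound with (4 * M) 1; [ lra | ].
  intros y Hy.
  apply (ctends_bound (F := F) (fun n => f0 n y - f0 n x - (y - x) * f1 n x)%C).
  - revert H. apply filter_imp. intros n Hn.
    assert (A1 : forall t, Rabs (t - x) <= 1 -> Cmod (f1 n t - f1 n x)%C <= 2 * M * Rabs (t - x)).
    { intros t Ht. apply (Cmod_increment_le (f1 n) (f2 n)). intros s Hs.
      destruct (Hn s (Rle_trans _ _ _ Hs Ht)) as [_ H2]. exact H2. }
    assert (HM : 0 <= M).
    { destruct (Hn x) as [_ [_ H2]]; [ replace (x - x) with 0 by ring; rewrite Rabs_R0; lra | ].
      generalize (Cmod_ge_0 (f2 n x)). lra. }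
    replace (f0 n y - f0 n x - (y - x) * f1 n x)%C
      with ((f0 n y - y * f1 n x) - (f0 n x - x * f1 n x))%C by ring.
    replace (4 * M * (y - x) ^ 2) with (2 * (2 * M * Rabs (y - x)) * Rabs (y - x))
      by (rewrite <- (pow2_abs (y - x)); ring).
    apply (Cmod_increment_le (fun t => f0 n t - t * f1 n x)%C (fun t => f1 n t - f1 n x)%C).
    intros t Ht. assert (Ht1 : Rabs (t - x) <= 1) by lra. split.
    + replace (f1 n t - f1 n x)%C with (f1 n t - (1 * f1 n x + t * 0))%C by ring.
      apply cderive_minus; [ apply (Hn t Ht1) | ].
      apply (cderive_mult (fun t => RtoC t) (fun _ => f1 n x)).
      * apply (cderive_RtoC (fun t => t)), (@is_derive_id R_AbsRing).
      * apply cderive_const.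
    + eapply Rle_trans; [ apply A1, Ht1 | ]. apply Rmult_le_compat_l; lra.
  - apply ctends_minus; [ apply ctends_minus; [ | ] | ].
    + apply H0, Hy.
    + apply H0. replace (x - x) with 0 by ring. rewrite Rabs_R0. lra.
    + apply ctends_mult; [ apply ctends_const | exact H1 ].
Qed.

(** * The complex exponential and sine *)

Lemma Cexp_plus (u v : C) : Cexp (u + v)%C = (Cexp u * Cexp v)%C.
Proof.
  destruct u as [a b], v as [c d]. unfold Cexp, Cmult. simpl.
  rewrite exp_plus, cos_plus, sin_plus. f_equal; ring.
Qed.

Lemma Cexp_0 : Cexp 0 = 1%C.
Proof. unfold Cexp. simpl. rewrite exp_0, cos_0, sin_0. apply Cext; simpl; ring. Qed.

Lemma Cexp_RtoC (x : R) : Cexp (RtoC x) = RtoC (exp x).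
Proof. unfold Cexp. simpl. rewrite cos_0, sin_0. apply Cext; simpl; ring. Qed.

Lemma Cexp_opp_r (u : C) : (Cexp u * Cexp (- u) = 1)%C.
Proof. rewrite <- Cexp_plus. replace (u + - u)%C with (RtoC 0) by ring. apply Cexp_0. Qed.

Lemma Cexp_neq_0 (u : C) : Cexp u <> 0%C.
Proof.
  intros H. generalize (Cexp_opp_r u). rewrite H, Cmult_0_l. intros E.
  apply RtoC_inj in E. lra.
Qed.

Lemma Cexp_opp (u : C) : (Cexp (- u) = / Cexp u)%C.
Proof.
  replace (Cexp (- u)) with (Cexp u * Cexp (- u) / Cexp u)%C
    by (field; apply Cexp_neq_0).
  rewrite Cexp_opp_r. field. apply Cexp_neq_0.
Qed.

Lemma Cmod_Cexp (u : C) : Cmod (Cexp u) = exp (Re u).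
Proof.
  unfold Cmod, Cexp. simpl fst. simpl snd.
  replace ((exp (Re u) * cos (Im u)) ^ 2 + (exp (Re u) * sin (Im u)) ^ 2)
    with ((exp (Re u)) ^ 2 * ((sin (Im u))² + (cos (Im u))²)) by (unfold Rsqr; ring).
  rewrite sin2_cos2, Rmult_1_r. rewrite sqrt_pow2; [ reflexivity | left; apply exp_pos ].
Qed.

Lemma exp_le (x y : R) : x <= y -> exp x <= exp y.
Proof. intros [H | ->]; [ left; now apply exp_increasing | right; reflexivity ]. Qed.

Lemma Re_le_Cmod (u : C) : Re u <= Cmod u.
Proof. eapply Rle_trans; [ apply Rle_abs | apply re_le_Cmod ]. Qed.

Lemma Cmod_Cexp_le (u : C) : Cmod (Cexp u) <= exp (Cmod u).
Proof. rewrite Cmod_Cexp. apply exp_le, Re_le_Cmod. Qed.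

Lemma cderive_Cexp (s : C) (t : R) : cderive (fun t => Cexp (s * t)) t (s * Cexp (s * t))%C.
Proof.
  destruct s as [a b]. apply cderive_Re_Im.
  - apply (is_derive_ext (fun t => exp (a * t) * cos (b * t))).
    + intros y. unfold Cexp, Re, Im; simpl. f_equal; f_equal; ring.
    + unfold Cexp, Re, Im; simpl. auto_derive; [ exact I | ].
      replace (a * t - b * 0) with (a * t) by ring.
      replace (a * 0 + b * t) with (b * t) by ring. ring.
  - apply (is_derive_ext (fun t => exp (a * t) * sin (b * t))).
    + intros y. unfold Cexp, Re, Im; simpl. f_equal; f_equal; ring.
    + unfold Cexp, Re, Im; simpl. auto_derive; [ exact I | ].
      replace (a * t - b * 0) with (a * t) by ring.
      replace (a * 0 + b * t) with (b * t) by ring. ring.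
Qed.

Lemma Cexp_minus_1_bound (w : C) : Cmod (Cexp w - 1)%C <= 2 * Cmod w * exp (Cmod w).
Proof.
  replace (Cexp w - 1)%C with (Cexp (w * 1%R) - Cexp (w * 0%R))%C.
  2:{ replace (w * 0%R)%C with (RtoC 0) by ring. rewrite Cexp_0.
      replace (w * 1%R)%C with w by ring. reflexivity. }
  replace (2 * Cmod w * exp (Cmod w)) with (2 * (Cmod w * exp (Cmod w)) * Rabs (1 - 0))
    by (rewrite Rminus_0_r, Rabs_R1; ring).
  apply (Cmod_increment_le (fun t => Cexp (w * t)) (fun t => w * Cexp (w * t))%C).
  intros t Ht. rewrite !Rminus_0_r, Rabs_R1 in Ht. split; [ apply cderive_Cexp | ].
  rewrite Cmod_mult. apply Rmult_le_compat_l; [ apply Cmod_ge_0 | ].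
  eapply Rle_trans; [ apply Cmod_Cexp_le | ]. apply exp_le. rewrite Cmod_mult, Cmod_R.
  generalize (Cmod_ge_0 w). nra.
Qed.

Lemma Cexp_minus_affine_bound (w : C) :
  Cmod (Cexp w - 1 - w)%C <= 4 * Cmod w ^ 2 * exp (Cmod w).
Proof.
  replace (Cexp w - 1 - w)%C with ((Cexp (w * 1%R) - w * 1%R) - (Cexp (w * 0%R) - w * 0%R))%C.
  2:{ replace (w * 0%R)%C with (RtoC 0) by ring. rewrite Cexp_0.
      replace (w * 1%R)%C with w by ring. ring. }
  replace (4 * Cmod w ^ 2 * exp (Cmod w))
    with (2 * (Cmod w * (2 * Cmod w * exp (Cmod w))) * Rabs (1 - 0))
    by (rewrite Rminus_0_r, Rabs_R1; ring).
  apply (Cmod_increment_le (fun t => Cexp (w * t) - w * t)%C (fun t => w * (Cexp (w * t) - 1))%C).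
  intros t Ht. rewrite !Rminus_0_r, Rabs_R1 in Ht. split.
  - replace (w * (Cexp (w * t) - 1))%C with (w * Cexp (w * t) - w * 1%R)%C by ring.
    apply cderive_minus; [ apply cderive_Cexp | ].
    apply cderive_cmult, (cderive_RtoC (fun t => t)), (@is_derive_id R_AbsRing).
  - rewrite Cmod_mult. apply Rmult_le_compat_l; [ apply Cmod_ge_0 | ].
    eapply Rle_trans; [ apply Cexp_minus_1_bound | ].
    assert (E : Cmod (w * t)%C <= Cmod w).
    { rewrite Cmod_mult, Cmod_R. generalize (Cmod_ge_0 w). nra. }
    generalize (Cmod_ge_0 (w * t)%C) (Cmod_ge_0 w) (exp_pos (Cmod (w * t)%C)).
    intros. apply Rmult_le_compat; [ lra | lra | lra | now apply exp_le ].
Qed.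

Lemma Ci_neq_0 : Ci <> 0%C.
Proof. intros H. apply (f_equal Im) in H. simpl in H. lra. Qed.

Lemma RtoC_neq_0 (x : R) : x <> 0 -> RtoC x <> 0%C.
Proof. intros H E. apply H, RtoC_inj, E. Qed.

Lemma Ci_sq : (Ci * Ci = - (1))%C.
Proof. apply Cext; simpl; ring. Qed.

Lemma Csin_opp (w : C) : (Csin (- w) = - Csin w)%C.
Proof.
  unfold Csin. replace (Ci * - w)%C with (- (Ci * w))%C by ring.
  replace (- - (Ci * w))%C with (Ci * w)%C by ring. field. apply Ci_neq_0.
Qed.

Lemma Cexp_Ci_RtoC (y : R) : Cexp (Ci * y) = (cos y, sin y).
Proof.
  unfold Cexp. apply Cext; simpl;
    replace (0 * y - 1 * 0) with 0 by ring;
    replace (0 * 0 + 1 * y) with y by ring; rewrite exp_0; ring.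
Qed.

Lemma Csin_shift_even (w : C) (M : nat) : Csin (PI * (w + INR (2 * M))) = Csin (PI * w).
Proof.
  assert (E : Cexp (Ci * (2 * INR M * PI)%R) = 1%C).
  { rewrite Cexp_Ci_RtoC. generalize (cos_period 0 M) (sin_period 0 M).
    rewrite !Rplus_0_l, cos_0, sin_0. intros -> ->. reflexivity. }
  unfold Csin.
  replace (Ci * (PI * (w + INR (2 * M))))%C with (Ci * (PI * w) + Ci * (2 * INR M * PI)%R)%C.
  2:{ rewrite mult_INR, !RtoC_mult. replace (INR 2) with 2 by (simpl; ring). ring. }
  replace (- (Ci * (PI * w) + Ci * (2 * INR M * PI)%R))%C
    with (- (Ci * (PI * w)) + - (Ci * (2 * INR M * PI)%R))%C by ring.
  rewrite !Cexp_plus, (Cexp_opp (Ci * (2 * INR M * PI)%R)), E. field. apply Ci_neq_0.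
Qed.

Lemma Csin_eq_0 (s : C) : Csin (PI * s) = 0%C -> is_integer s.
Proof.
  intros H.
  assert (E : Cexp (Ci * (PI * s)) = Cexp (- (Ci * (PI * s)))).
  { unfold Csin in H.
    replace (Cexp (Ci * (PI * s))) with
      ((Cexp (Ci * (PI * s)) - Cexp (- (Ci * (PI * s)))) / (2 * Ci) * (2 * Ci)
        + Cexp (- (Ci * (PI * s))))%C by (field; apply Ci_neq_0).
    rewrite H. ring. }
  pose proof PI_RGT_0 as Hpi.
  destruct s as [x y].
  assert (Hy : y = 0).
  { apply (f_equal Cmod) in E. rewrite !Cmod_Cexp in E. apply exp_inv in E.
    simpl in E. nra. }
  subst y. change (x, 0) with (RtoC x) in *.
  replace (- (Ci * (PI * x)))%C with (Ci * (- (PI * x))%R)%C in E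
    by (rewrite RtoC_opp, RtoC_mult; ring).
  rewrite <- RtoC_mult, !Cexp_Ci_RtoC in E.
  apply (f_equal Im) in E. simpl in E. rewrite sin_neg in E.
  assert (Hs : sin (PI * x) = 0) by lra.
  destruct (sin_eq_0_0 _ Hs) as [k Hk]. exists k. f_equal. nra.
Qed.

Lemma Csin_bound (w : C) : Cmod (Csin w - w)%C <= 4 * Cmod w ^ 2 * exp (Cmod w).
Proof.
  unfold Csin.
  replace ((Cexp (Ci * w) - Cexp (- (Ci * w))) / (2 * Ci) - w)%C
    with (((Cexp (Ci * w) - 1 - Ci * w) - (Cexp (- (Ci * w)) - 1 - - (Ci * w))) / (2 * Ci))%C
    by (field; apply Ci_neq_0).
  rewrite Cmod_div by (apply Cmult_neq_0; [ apply RtoC_neq_0; lra | apply Ci_neq_0 ]).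
  rewrite Cmod_mult, Cmod_Ci, Cmod_R, Rabs_pos_eq by lra.
  generalize (Cexp_minus_affine_bound (Ci * w)) (Cexp_minus_affine_bound (- (Ci * w)))
    (Cmod_minus_le (Cexp (Ci * w) - 1 - Ci * w)%C (Cexp (- (Ci * w)) - 1 - - (Ci * w))%C).
  rewrite !Cmod_opp, !Cmod_mult, !Cmod_Ci, !Rmult_1_l. lra.
Qed.

(** The factor by which the functions of [m] divided by sin (2 pi m) differ from
    difference quotients. *)
Lemma ctends_pi_div_sin :
  ctends (locally' (RtoC 0)) (fun m => PI * m / Csin (2 * PI * m))%C (/ 2)%C.
Proof.
  pose proof PI_RGT_0 as Hpi.
  assert (H : ctends (locally' (RtoC 0)) (fun m => Csin (2 * PI * m) / (PI * m))%C 2).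
  { apply ctends_squeeze with (fun m => 16 * PI * exp (2 * PI) * Cmod m).
    - apply locally'_0_intro with 1; [ lra | ]. intros m Hm0 Hm.
      replace (Csin (2 * PI * m) / (PI * m) - 2)%C
        with ((Csin (2 * PI * m) - 2 * PI * m) / (PI * m))%C
        by (field; split; [ exact Hm0 | now apply RtoC_neq_0, PI_neq0 ]).
      assert (Hp : (PI * m)%C <> 0%C)
        by (apply Cmult_neq_0; [ apply RtoC_neq_0, PI_neq0 | exact Hm0 ]).
      rewrite Cmod_div by exact Hp.
      generalize (Csin_bound (2 * PI * m)). rewrite !Cmod_mult, !Cmod_R, !Rabs_pos_eq by lra.
      intros Hb. apply Cmod_gt_0 in Hm0.
      apply Rmult_le_reg_r with (PI * Cmod m); [ nra | ].
      unfold Rdiv. rewrite Rmult_assoc, Rinv_l, Rmult_1_r by nra.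
      eapply Rle_trans; [ exact Hb | ].
      replace (16 * PI * exp (2 * PI) * Cmod m * (PI * Cmod m))
        with (4 * (2 * PI * Cmod m) ^ 2 * exp (2 * PI)) by ring.
      apply Rmult_le_compat_l; [ nra | ]. apply exp_le. nra.
    - apply filterlim_Cmod_0. }
  assert (H2 : RtoC 2 <> 0%C) by (apply RtoC_neq_0; lra).
  generalize (ctends_inv _ _ H2 H).
  apply ctends_ext_loc.
  generalize (ctends_neq0 _ _ H2 H). intros Hn.
  assert (Hne : locally' (RtoC 0) (fun m : C => m <> RtoC 0))
    by (apply locally'_0_intro with 1; [ lra | now intros ]).
  generalize (filter_and _ _ Hne Hn). apply filter_imp. intros m [Hm0 Hm].
  rewrite Cmod_R, Rabs_pos_eq in Hm by lra.
  assert (Hq : (Csin (2 * PI * m) / (PI * m))%C <> 0%C) by (apply Cmod_gt_0; lra).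
  assert (Hs : Csin (2 * PI * m) <> 0%C).
  { intros E. apply Hq. rewrite E. unfold Cdiv. ring. }
  field. repeat split; first [ exact Hm0 | exact Hs | apply RtoC_neq_0, PI_neq0 ].
Qed.

(** * Uniform limits of polynomials on a disc *)

Fixpoint ceval (p : list C) (m : C) : C :=
  match p with
  | nil => 0
  | cons a q => (a + m * ceval q m)%C
  end.

Fixpoint padd (p q : list C) : list C :=
  match p, q with
  | nil, _ => q
  | _, nil => p
  | cons a p', cons b q' => cons (a + b)%C (padd p' q')
  end.

Lemma ceval_padd (p q : list C) (m : C) : ceval (padd p q) m = (ceval p m + ceval q m)%C.
Proof.
  revert q. induction p as [ | a p IH ]; intros [ | b q ]; simpl; try ring.
  rewrite IH. ring.
Qed.

Lemma ceval_map_mult (c : C) (p : list C) (m : C) :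
  ceval (List.map (Cmult c) p) m = (c * ceval p m)%C.
Proof. induction p as [ | a p IH ]; simpl; [ ring | rewrite IH; ring ]. Qed.

Fixpoint pmul (p q : list C) : list C :=
  match p with
  | nil => nil
  | cons a p' => padd (List.map (Cmult a) q) (cons (RtoC 0) (pmul p' q))
  end.

Lemma ceval_pmul (p q : list C) (m : C) : ceval (pmul p q) m = (ceval p m * ceval q m)%C.
Proof.
  induction p as [ | a p IH ]; simpl; [ ring | ].
  rewrite ceval_padd, ceval_map_mult. simpl. rewrite IH. ring.
Qed.

Fixpoint popp (p : list C) : list C :=
  match p with
  | nil => nil
  | cons a q => cons a (List.map (Cmult (- (1))%C) (popp q))
  end.

Lemma ceval_popp (p : list C) (m : C) : ceval (popp p) m = ceval p (- m).
Proof.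
  induction p as [ | a p IH ]; simpl; [ reflexivity | ].
  rewrite ceval_map_mult, IH. ring.
Qed.

Fixpoint csum (f : nat -> C) (n : nat) : C :=
  match n with
  | O => 0
  | S n' => (csum f n' + f n')%C
  end.

Lemma csum_ext (f g : nat -> C) (n : nat) : (forall l, f l = g l) -> csum f n = csum g n.
Proof. intros H. induction n as [ | n IH ]; simpl; [ reflexivity | now rewrite IH, H ]. Qed.

Lemma csum_plus (f g : nat -> C) (n : nat) :
  csum (fun l => f l + g l)%C n = (csum f n + csum g n)%C.
Proof. induction n as [ | n IH ]; simpl; [ ring | rewrite IH; ring ]. Qed.

Lemma csum_mult (c : C) (f : nat -> C) (n : nat) :
  csum (fun l => c * f l)%C n = (c * csum f n)%C.
Proof. induction n as [ | n IH ]; simpl; [ ring | rewrite IH; ring ]. Qed.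

Lemma csum_one (n : nat) : csum (fun _ => RtoC 1) n = INR n.
Proof.
  induction n as [ | n IH ]; [ reflexivity | ].
  simpl csum. rewrite IH, S_INR, RtoC_plus. reflexivity.
Qed.

Lemma Cmod_csum_le (f : nat -> C) (M : R) (n : nat) :
  (forall l, Cmod (f l) <= M) -> Cmod (csum f n) <= INR n * M.
Proof.
  intros H. induction n as [ | n IH ]; simpl csum; [ rewrite Cmod_0; simpl; lra | ].
  rewrite S_INR. eapply Rle_trans; [ apply Cmod_triangle | ]. generalize (H n). lra.
Qed.

Lemma csum_geometric (w : C) (n : nat) : ((1 - w) * csum (fun l => w ^ l) n = 1 - w ^ n)%C.
Proof.
  induction n as [ | n IH ]; simpl; [ ring | ].
  rewrite Cmult_plus_distr_l, IH. ring.
Qed.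

Definition unity_root (n : nat) : C := Cexp (Ci * (2 * PI / INR n)%R).

Lemma Cexp_pow (w : C) (n : nat) : (Cexp w ^ n = Cexp (INR n * w))%C.
Proof.
  induction n as [ | n IH ].
  - simpl. replace (RtoC 0 * w)%C with (RtoC 0) by ring. now rewrite Cexp_0.
  - change (Cexp w ^ S n)%C with (Cexp w * Cexp w ^ n)%C.
    rewrite IH, <- Cexp_plus, S_INR, RtoC_plus. f_equal. ring.
Qed.

Lemma Cpow_add (w : C) (n m : nat) : (w ^ (n + m) = w ^ n * w ^ m)%C.
Proof. induction n as [ | n IH ]; simpl; [ ring | rewrite IH; ring ]. Qed.

Lemma Cpow_Cpow (w : C) (n m : nat) : ((w ^ n) ^ m = w ^ (n * m))%C.
Proof.
  induction m as [ | m IH ]; [ now rewrite Nat.mul_0_r | ].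
  rewrite Nat.mul_succ_r, Nat.add_comm, Cpow_add, <- IH. reflexivity.
Qed.

Lemma Cpow_1_l (n : nat) : (1 ^ n = 1)%C.
Proof. induction n as [ | n IH ]; simpl; [ reflexivity | rewrite IH; ring ]. Qed.

Lemma Cmod_unity_root (n : nat) : Cmod (unity_root n) = 1.
Proof.
  unfold unity_root. rewrite Cmod_Cexp. simpl.
  replace (0 * (2 * PI / INR n) - 1 * 0) with 0 by ring. apply exp_0.
Qed.

Lemma unity_root_pow_n (n : nat) : (0 < n)%nat -> (unity_root n ^ n = 1)%C.
Proof.
  intros Hn. unfold unity_root. rewrite Cexp_pow.
  assert (HN : INR n <> 0) by (apply not_0_INR; lia).
  replace (INR n * (Ci * (2 * PI / INR n)%R))%C with (Ci * (0 + 2 * INR 1 * PI)%R)%C.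
  - rewrite Cexp_Ci_RtoC, (cos_period 0 1), (sin_period 0 1), cos_0, sin_0. reflexivity.
  - change (INR 1) with 1. rewrite RtoC_div by exact HN. rewrite !RtoC_plus, !RtoC_mult. field. now apply RtoC_neq_0.
Qed.

Lemma unity_root_pow_neq_1 (n j : nat) :
  (0 < j < 2 * n)%nat -> j <> n -> (unity_root n ^ j <> 1)%C.
Proof.
  intros Hj Hjn E. unfold unity_root in E. rewrite Cexp_pow in E.
  assert (HN : 0 < INR n) by (apply lt_0_INR; lia).
  set (s := RtoC (INR j / INR n)).
  assert (Hs : Csin (PI * s) = 0%C).
  { assert (E2 : (Cexp (Ci * (PI * s)) * Cexp (Ci * (PI * s)) = 1)%C).
    { rewrite <- Cexp_plus, <- E. f_equal. unfold s.
      rewrite (RtoC_div (INR j)), (RtoC_div (2 * PI)), RtoC_mult by (apply Rgt_not_eq; exact HN). field. apply RtoC_neq_0. lra. }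
    unfold Csin. rewrite Cexp_opp.
    replace (Cexp (Ci * (PI * s)) - / Cexp (Ci * (PI * s)))%C
      with ((Cexp (Ci * (PI * s)) * Cexp (Ci * (PI * s)) - 1) / Cexp (Ci * (PI * s)))%C
      by (field; apply Cexp_neq_0).
    rewrite E2. unfold Cdiv. ring. }
  destruct (Csin_eq_0 _ Hs) as [k Hk]. unfold s in Hk. apply RtoC_inj in Hk.
  assert (Hk2 : INR j = IZR k * INR n) by (rewrite <- Hk; field; apply Rgt_not_eq; exact HN).
  rewrite !INR_IZR_INZ, <- mult_IZR in Hk2. apply eq_IZR in Hk2.
  assert (Hk0 : (0 < k)%Z) by nia. assert (Hk1 : (k < 2)%Z) by nia.
  assert (k = 1%Z) by lia. subst k. lia.
Qed.

Lemma unity_root_power_sum (n j : nat) :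
  (0 < j < 2 * n)%nat -> j <> n -> csum (fun l => (unity_root n ^ l) ^ j)%C n = 0%C.
Proof.
  intros Hj Hjn. set (w := (unity_root n ^ j)%C).
  rewrite (csum_ext _ (fun l => w ^ l)%C).
  2:{ intros l. unfold w. rewrite !Cpow_Cpow. f_equal. lia. }
  assert (Hw : (1 - w)%C <> 0%C).
  { intros E. apply (unity_root_pow_neq_1 n j Hj Hjn). fold w.
    replace w with (1 - (1 - w))%C by ring. rewrite E. ring. }
  assert (Hn : (w ^ n = 1)%C).
  { unfold w. rewrite Cpow_Cpow, Nat.mul_comm, <- Cpow_Cpow, unity_root_pow_n by lia.
    apply Cpow_1_l. }
  generalize (csum_geometric w n). rewrite Hn. intros E.
  replace (csum (fun l => w ^ l)%C n) with ((1 - w) * csum (fun l => w ^ l) n / (1 - w))%C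
    by (field; exact Hw).
  rewrite E. field. exact Hw.
Qed.

Lemma csum_ceval_vanish (n : nat) (x : nat -> C) (r : C) (p : list C) (e : nat) :
  (forall j, (e <= j < e + length p)%nat -> csum (fun l => x l ^ j)%C n = 0%C) ->
  csum (fun l => x l ^ e * ceval p (r * x l))%C n = 0%C.
Proof.
  revert e. induction p as [ | a p IH ]; intros e H.
  - simpl. rewrite (csum_ext _ (fun l => 0 * 0)%C) by (intros; ring).
    rewrite csum_mult. ring.
  - rewrite (csum_ext _ (fun l => a * x l ^ e + r * (x l ^ (S e) * ceval p (r * x l)))%C)
      by (intros; simpl; ring).
    rewrite csum_plus, !csum_mult, IH, H; [ ring | simpl; lia | ].
    intros j Hj. apply H. simpl. lia.
Qed.

Lemma csum_ceval_coefficient (n : nat) (x : nat -> C) (r : C) (k : nat) (p : list C) (e : nat) :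
  (k < length p)%nat ->
  (forall j, (e <= j < e + length p)%nat -> j <> (e + k)%nat ->
     csum (fun l => x l ^ j)%C n = 0%C) ->
  csum (fun l => x l ^ e * ceval p (r * x l))%C n
  = (r ^ k * nth k p 0 * csum (fun l => x l ^ (e + k)) n)%C.
Proof.
  revert p e. induction k as [ | k IH ]; intros [ | a p ] e Hk H; simpl in Hk; try lia.
  - rewrite (csum_ext _ (fun l => a * x l ^ e + r * (x l ^ (S e) * ceval p (r * x l)))%C)
      by (intros; simpl; ring).
    rewrite csum_plus, !csum_mult, csum_ceval_vanish.
    + rewrite Nat.add_0_r. simpl. ring.
    + intros j Hj. apply H; simpl; lia.
  - rewrite (csum_ext _ (fun l => a * x l ^ e + r * (x l ^ (S e) * ceval p (r * x l)))%C)
      by (intros; simpl; ring).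
    rewrite csum_plus, !csum_mult, IH.
    + rewrite (H e) by (simpl; lia). simpl nth.
      replace (S e + k)%nat with (e + S k)%nat by lia.
      change (r ^ S k)%C with (r * r ^ k)%C. ring.
    + lia.
    + intros j Hj1 Hj2. apply H; simpl; lia.
Qed.

(** Cauchy's estimate, with the average over a circle replaced by the average
    over sufficiently many roots of unity, which is exact for polynomials. *)
Lemma cauchy_estimate (p : list C) (r M : R) (k : nat) :
  0 < r -> (forall m, Cmod m <= r -> Cmod (ceval p m) <= M) ->
  Cmod (nth k p 0%C) * r ^ k <= M.
Proof.
  intros Hr HM.
  assert (HM0 : 0 <= M).
  { apply Rle_trans with (1 := Cmod_ge_0 (ceval p 0)), HM. rewrite Cmod_0. lra. }
  destruct (Nat.lt_ge_cases k (length p)) as [Hk | Hk].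
  2:{ rewrite nth_overflow, Cmod_0 by exact Hk. lra. }
  set (n := length p). assert (Hn : 0 < INR n) by (apply lt_0_INR; unfold n; lia).
  (* The exponents n - k + i with i < n lie strictly between 0 and 2 n, where
     the only multiple of n is n itself: the average singles out i = k. *)
  assert (E : csum (fun l => (unity_root n ^ l) ^ (n - k) * ceval p (r * unity_root n ^ l))%C n
              = (r ^ k * nth k p 0 * INR n)%C).
  { rewrite (csum_ceval_coefficient n (fun l => unity_root n ^ l)%C r k p (n - k)) by
      (try exact Hk; intros j Hj1 Hj2; apply unity_root_power_sum; unfold n in *; lia).
    f_equal. rewrite <- csum_one. apply csum_ext. intros l.
    replace (n - k + k)%nat with n by (unfold n; lia).
    rewrite Cpow_Cpow, Nat.mul_comm, <- Cpow_Cpow, unity_root_pow_n by (unfold n; lia).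
    apply Cpow_1_l. }
  assert (U : forall l, Cmod (unity_root n ^ l)%C = 1).
  { intros l. rewrite Cmod_pow, Cmod_unity_root. apply pow1. }
  assert (B : Cmod (r ^ k * nth k p 0 * INR n)%C <= INR n * M).
  { rewrite <- E. apply Cmod_csum_le. intros l. rewrite Cmod_mult, Cmod_pow, U, pow1, Rmult_1_l.
    apply HM. rewrite Cmod_mult, U, Cmod_R, Rabs_pos_eq; lra. }
  rewrite !Cmod_mult, Cmod_pow, !Cmod_R, (Rabs_pos_eq (INR n)), (Rabs_pos_eq r) in B by lra.
  apply Rmult_le_reg_r with (INR n); [ exact Hn | ]. lra.
Qed.

Lemma ceval_half_disc_bound (r : R) (p : list C) (B : R) (m : C) :
  0 < r -> (forall k, Cmod (nth k p 0%C) * r ^ k <= B) -> Cmod m <= r / 2 ->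
  Cmod (ceval p m) <= 2 * B.
Proof.
  intros Hr. revert B. induction p as [ | a p IH ]; intros B HB Hm; simpl ceval.
  - rewrite Cmod_0. generalize (HB 0%nat) (Cmod_ge_0 (nth 0 nil 0%C)). simpl. lra.
  - assert (H0 : Cmod a <= B) by (generalize (HB 0%nat); simpl; lra).
    assert (H1 : Cmod (ceval p m) <= 2 * (B / r)).
    { apply IH; [ | exact Hm ]. intros k. generalize (HB (S k)). simpl. intros Hk.
      apply Rmult_le_reg_r with r; [ exact Hr | ].
      replace (B / r * r) with B by (field; lra). lra. }
    eapply Rle_trans; [ apply Cmod_triangle | ]. rewrite Cmod_mult.
    assert (Cmod m * Cmod (ceval p m) <= r / 2 * (2 * (B / r)))
      by (apply Rmult_le_compat; try apply Cmod_ge_0; assumption).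
    replace (r / 2 * (2 * (B / r))) with B in H by (field; lra). lra.
Qed.

(** Uniform limits of polynomials are what is needed here of the holomorphic
    functions of the parameter: this class is closed under the constructions
    that produce the reciprocal Gamma function and the series below, and
    Cauchy's estimate passes to it. *)
Definition Hol (r : R) (f : C -> C) : Prop :=
  forall eps, 0 < eps -> exists p, forall m, Cmod m <= r -> Cmod (f m - ceval p m)%C <= eps.

Lemma Hol_uniform_limit (r : R) (f : C -> C) :
  (forall eps, 0 < eps -> exists g, Hol r g /\ forall m, Cmod m <= r -> Cmod (f m - g m)%C <= eps) ->
  Hol r f.
Proof.
  intros H eps He. destruct (H (eps / 2)) as [g [Hg Hfg]]; [ lra | ].
  destruct (Hg (eps / 2)) as [p Hp]; [ lra | ]. exists p. intros m Hm.
  replace (f m - ceval p m)%C with ((f m - g m) + (g m - ceval p m))%C by ring.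
  generalize (Cmod_triangle (f m - g m)%C (g m - ceval p m)%C) (Hfg m Hm) (Hp m Hm). lra.
Qed.

Lemma Hol_ext (r : R) (f g : C -> C) :
  (forall m, Cmod m <= r -> f m = g m) -> Hol r f -> Hol r g.
Proof.
  intros E H eps He. destruct (H eps He) as [p Hp]. exists p. intros m Hm.
  rewrite <- (E m Hm). now apply Hp.
Qed.

Lemma Hol_ceval (r : R) (p : list C) : Hol r (ceval p).
Proof.
  intros eps He. exists p. intros m _.
  replace (ceval p m - ceval p m)%C with (RtoC 0) by ring. rewrite Cmod_0. lra.
Qed.

Lemma Hol_const (r : R) (c : C) : Hol r (fun _ => c).
Proof. apply Hol_ext with (ceval (cons c nil)); [ intros; simpl; ring | apply Hol_ceval ]. Qed.

Lemma Hol_id (r : R) : Hol r (fun m => m).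
Proof.
  apply Hol_ext with (ceval (cons (RtoC 0) (cons (RtoC 1) nil))); [ intros; simpl; ring | apply Hol_ceval ].
Qed.

Lemma Hol_plus (r : R) (f g : C -> C) : Hol r f -> Hol r g -> Hol r (fun m => f m + g m)%C.
Proof.
  intros Hf Hg eps He. destruct (Hf (eps / 2)) as [p Hp]; [ lra | ].
  destruct (Hg (eps / 2)) as [q Hq]; [ lra | ]. exists (padd p q). intros m Hm.
  rewrite ceval_padd.
  replace (f m + g m - (ceval p m + ceval q m))%C
    with ((f m - ceval p m) + (g m - ceval q m))%C by ring.
  generalize (Cmod_triangle (f m - ceval p m)%C (g m - ceval q m)%C) (Hp m Hm) (Hq m Hm). lra.
Qed.

Lemma ceval_bounded (r : R) (p : list C) :
  0 <= r -> exists M, forall m, Cmod m <= r -> Cmod (ceval p m) <= M.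
Proof.
  intros Hr. induction p as [ | a p [M HM] ]; simpl.
  - exists 0. intros m _. rewrite Cmod_0. lra.
  - exists (Cmod a + r * M). intros m Hm. eapply Rle_trans; [ apply Cmod_triangle | ].
    rewrite Cmod_mult. apply Rplus_le_compat_l, Rmult_le_compat; try apply Cmod_ge_0; auto.
Qed.

Lemma Hol_bounded (r : R) (f : C -> C) :
  0 <= r -> Hol r f -> exists M, 0 <= M /\ forall m, Cmod m <= r -> Cmod (f m) <= M.
Proof.
  intros Hr Hf. destruct (Hf 1 Rlt_0_1) as [p Hp]. destruct (ceval_bounded r p Hr) as [M HM].
  exists (1 + M). split.
  - generalize (HM (RtoC 0)) (Cmod_ge_0 (ceval p 0)). rewrite Cmod_0. lra.
  - intros m Hm. generalize (Cmod_triangle_inv (f m) (ceval p m)) (Hp m Hm) (HM m Hm). lra.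
Qed.

Lemma Hol_mult (r : R) (f g : C -> C) :
  0 <= r -> Hol r f -> Hol r g -> Hol r (fun m => f m * g m)%C.
Proof.
  intros Hr Hf Hg. destruct (Hol_bounded r f Hr Hf) as [M [HM0 HM]].
  apply Hol_uniform_limit. intros eps He.
  destruct (Hg (eps / (2 * (M + 1)))) as [q Hq]; [ apply Rdiv_lt_0_compat; lra | ].
  destruct (ceval_bounded r q Hr) as [Q HQ].
  assert (HQ0 : 0 <= Q) by (generalize (HQ (RtoC 0)) (Cmod_ge_0 (ceval q 0)); rewrite Cmod_0; lra).
  destruct (Hf (eps / (2 * (Q + 1)))) as [p Hp]; [ apply Rdiv_lt_0_compat; lra | ].
  exists (ceval (pmul p q)). split; [ apply Hol_ceval | ]. intros m Hm. rewrite ceval_pmul.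
  replace (f m * g m - ceval p m * ceval q m)%C
    with (f m * (g m - ceval q m) + (f m - ceval p m) * ceval q m)%C by ring.
  eapply Rle_trans; [ apply Cmod_triangle | ]. rewrite !Cmod_mult.
  assert (Cmod (f m) * Cmod (g m - ceval q m)%C <= (M + 1) * (eps / (2 * (M + 1)))).
  { apply Rmult_le_compat; try apply Cmod_ge_0; [ generalize (HM m Hm); lra | now apply Hq ]. }
  assert (Cmod (f m - ceval p m)%C * Cmod (ceval q m) <= (eps / (2 * (Q + 1))) * (Q + 1)).
  { apply Rmult_le_compat; try apply Cmod_ge_0; [ now apply Hp | generalize (HQ m Hm); lra ]. }
  replace ((M + 1) * (eps / (2 * (M + 1)))) with (eps / 2) in H by (field; lra).
  replace ((eps / (2 * (Q + 1))) * (Q + 1)) with (eps / 2) in H0 by (field; lra). lra.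
Qed.

Lemma Hol_opp (r : R) (f : C -> C) : 0 <= r -> Hol r f -> Hol r (fun m => - f m)%C.
Proof.
  intros Hr Hf. apply Hol_ext with (fun m => - (1) * f m)%C; [ intros; ring | ].
  apply Hol_mult; [ exact Hr | apply Hol_const | exact Hf ].
Qed.

Lemma Hol_comp_opp (r : R) (f : C -> C) : Hol r f -> Hol r (fun m => f (- m)%C).
Proof.
  intros Hf eps He. destruct (Hf eps He) as [p Hp]. exists (popp p). intros m Hm.
  rewrite ceval_popp. apply Hp. now rewrite Cmod_opp.
Qed.

Lemma Hol_pow (r : R) (f : C -> C) (n : nat) :
  0 <= r -> Hol r f -> Hol r (fun m => f m ^ n)%C.
Proof.
  intros Hr Hf. induction n as [ | n IH ]; simpl; [ apply Hol_const | now apply Hol_mult ].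
Qed.

Lemma Hol_affine (r : R) (a b : C) : 0 <= r -> Hol r (fun m => a + b * m)%C.
Proof.
  intros Hr. apply Hol_plus; [ apply Hol_const | ].
  apply Hol_mult; [ exact Hr | apply Hol_const | apply Hol_id ].
Qed.

Lemma Hol_csum (r : R) (f : nat -> C -> C) (n : nat) :
  (forall k, Hol r (f k)) -> Hol r (fun m => csum (fun k => f k m) n).
Proof.
  intros H. induction n as [ | n IH ]; simpl; [ apply Hol_const | now apply Hol_plus ].
Qed.

Lemma Cmod_pow_minus_le (a b : C) (R0 : R) (n : nat) :
  1 <= R0 -> Cmod a <= R0 -> Cmod b <= R0 ->
  Cmod (a ^ n - b ^ n)%C <= INR n * R0 ^ n * Cmod (a - b)%C.
Proof.
  intros HR Ha Hb. induction n as [ | n IH ].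
  - simpl. replace (1 - 1)%C with (RtoC 0) by ring. rewrite Cmod_0. lra.
  - change (a ^ S n)%C with (a * a ^ n)%C. change (b ^ S n)%C with (b * b ^ n)%C.
    replace (a * a ^ n - b * b ^ n)%C with (a * (a ^ n - b ^ n) + (a - b) * b ^ n)%C by ring.
    eapply Rle_trans; [ apply Cmod_triangle | ]. rewrite !Cmod_mult, Cmod_pow, S_INR. simpl pow.
    assert (Cmod a * Cmod (a ^ n - b ^ n)%C <= R0 * (INR n * R0 ^ n * Cmod (a - b)%C))
      by (apply Rmult_le_compat; try apply Cmod_ge_0; assumption).
    assert (Cmod (a - b)%C * Cmod b ^ n <= Cmod (a - b)%C * (R0 * R0 ^ n)).
    { apply Rmult_le_compat_l; [ apply Cmod_ge_0 | ].
      apply Rle_trans with (R0 ^ n); [ apply pow_incr; split; [ apply Cmod_ge_0 | exact Hb ] | ].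
      assert (0 <= R0 ^ n) by (apply pow_le; lra). nra. }
    nra.
Qed.

(** The approximating polynomials are (1 + m t / n)^n. *)
Lemma Hol_Cexp (r : R) (t : C) : 0 <= r -> Hol r (fun m => Cexp (m * t)).
Proof.
  intros Hr. apply Hol_uniform_limit. intros eps He.
  set (L := r * Cmod t). assert (HL : 0 <= L) by (apply Rmult_le_pos; [ exact Hr | apply Cmod_ge_0 ]).
  set (K := 4 * L ^ 2 * exp L * exp L).
  assert (HK : 0 <= K) by (unfold K; generalize (pow2_ge_0 (2 * L * exp L)); lra).
  destruct (archimed_cor1 (eps / (K + 1))) as [n [Hn Hn0]]; [ apply Rdiv_lt_0_compat; lra | ].
  assert (HN : 1 <= INR n) by (apply (le_INR 1); lia).
  exists (fun m => (1 + t / INR n * m) ^ n)%C. split; [ apply Hol_pow, Hol_affine; exact Hr | ].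
  intros m Hm. set (w := (m * t / INR n)%C).
  replace (m * t)%C with (INR n * w)%C by (unfold w; field; apply RtoC_neq_0; lra).
  replace (1 + t / INR n * m)%C with (1 + w)%C by (unfold w; field; apply RtoC_neq_0; lra).
  rewrite <- Cexp_pow.
  assert (Hw : Cmod w <= L / INR n).
  { unfold w. rewrite Cmod_div by (apply RtoC_neq_0; lra).
    rewrite Cmod_mult, (Cmod_R (INR n)), (Rabs_pos_eq (INR n)) by lra.
    apply Rmult_le_compat_r; [ left; apply Rinv_0_lt_compat; lra | ].
    apply Rmult_le_compat_r; [ apply Cmod_ge_0 | exact Hm ]. }
  assert (HLn : 0 <= L / INR n) by (apply Rle_trans with (2 := Hw), Cmod_ge_0).
  assert (HLn1 : L / INR n <= L).
  { apply Rmult_le_reg_r with (INR n); [ lra | ]. unfold Rdiv. rewrite Rmult_assoc, Rinv_l by lra. nra. }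
  eapply Rle_trans; [ apply (Cmod_pow_minus_le _ _ (exp (L / INR n))) | ].
  - rewrite <- exp_0. now apply exp_le.
  - eapply Rle_trans; [ apply Cmod_Cexp_le | now apply exp_le ].
  - eapply Rle_trans; [ apply Cmod_triangle | ]. rewrite Cmod_1.
    eapply Rle_trans; [ | apply exp_ineq1_le ]. lra.
  - replace (Cexp w - (1 + w))%C with (Cexp w - 1 - w)%C by ring.
    replace (exp (L / INR n) ^ n) with (exp L).
    2:{ rewrite <- (exp_ln (exp (L / INR n) ^ n)) by (apply pow_lt, exp_pos).
        rewrite ln_pow, ln_exp by apply exp_pos. f_equal. field. lra. }
    apply Rle_trans with (INR n * exp L * (4 * (L / INR n) ^ 2 * exp L)).
    { apply Rmult_le_compat_l; [ apply Rmult_le_pos; [ lra | left; apply exp_pos ] | ].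
      eapply Rle_trans; [ apply Cexp_minus_affine_bound | ].
      apply Rmult_le_compat; [ generalize (pow2_ge_0 (Cmod w)); lra | left; apply exp_pos | | ].
      - apply Rmult_le_compat_l; [ lra | ]. apply pow_incr. split; [ apply Cmod_ge_0 | exact Hw ].
      - apply exp_le. lra. }
    replace (INR n * exp L * (4 * (L / INR n) ^ 2 * exp L)) with (K * / INR n)
      by (unfold K; field; lra).
    apply Rle_trans with (K * (eps / (K + 1))); [ apply Rmult_le_compat_l; lra | ].
    replace (K * (eps / (K + 1))) with (eps - eps / (K + 1)) by (field; lra).
    assert (0 < eps / (K + 1)) by (apply Rdiv_lt_0_compat; lra). lra.
Qed.

Lemma Rle_of_le_eps (x y K : R) : (forall eps, 0 < eps -> x <= y + K * eps) -> x <= y.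
Proof.
  intros H. apply Rnot_lt_le. intros Hlt.
  assert (HK : 0 < Rabs K + 1) by (generalize (Rabs_pos K); lra).
  assert (Hp : 0 < (x - y) / (2 * (Rabs K + 1))) by (apply Rdiv_lt_0_compat; lra).
  specialize (H _ Hp).
  assert (K * ((x - y) / (2 * (Rabs K + 1))) <= (Rabs K + 1) * ((x - y) / (2 * (Rabs K + 1)))).
  { apply Rmult_le_compat_r; [ lra | ]. generalize (Rle_abs K); lra. }
  replace ((Rabs K + 1) * ((x - y) / (2 * (Rabs K + 1)))) with ((x - y) / 2) in H0 by (field; lra).
  lra.
Qed.

(** The first two Taylor coefficients of an approximating polynomial are
    controlled by its maximum alone, so the difference quotients at 0 converge
    at a rate depending only on the bound [M]. *)
Lemma Hol_difference_quotient (r M : R) (f : C -> C) :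
  0 < r -> Hol r f -> (forall m, Cmod m <= r -> Cmod (f m) <= M) -> f 0%C = 0%C ->
  (forall m : C, m <> 0%C -> Cmod m <= r / 2 -> Cmod (f m / m)%C <= 2 * M / r) /\
  exists g0 : C,
    forall m : C, m <> 0%C -> Cmod m <= r / 2 -> Cmod (f m / m - g0)%C <= 2 * M / r ^ 2 * Cmod m.
Proof.
  intros Hr Hf HM Hf0.
  assert (Hr2 : 0 < r ^ 2) by now apply pow_lt.
  assert (A : forall eps, 0 < eps -> exists a1 : C, forall m : C, m <> 0%C -> Cmod m <= r / 2 ->
    Cmod (f m / m)%C <= 2 * (M + eps) / r + 2 * eps / Cmod m /\
    Cmod (f m / m - a1)%C <= 2 * (M + eps) / r ^ 2 * Cmod m + 2 * eps / Cmod m).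
  { intros eps He. destruct (Hf eps He) as [p Hp].
    assert (HpM : forall m, Cmod m <= r -> Cmod (ceval p m) <= M + eps).
    { intros m Hm. generalize (Cmod_triangle_inv (ceval p m) (f m)) (Hp m Hm) (HM m Hm).
      rewrite Cmod_sub_sym. lra. }
    assert (Hc := fun k => cauchy_estimate p r (M + eps) k Hr HpM).
    set (p1 := List.tl p). set (p2 := List.tl p1).
    assert (E1 : forall m, ceval p m = (nth 0 p 0 + m * ceval p1 m)%C)
      by (intros m; unfold p1; destruct p; simpl; ring).
    assert (E2 : forall m, ceval p1 m = (nth 0 p1 0 + m * ceval p2 m)%C)
      by (intros m; unfold p2; destruct p1; simpl; ring).
    assert (N1 : forall k, nth k p1 0%C = nth (S k) p 0%C)
      by (intros k; unfold p1; destruct p; simpl; [ now destruct k | reflexivity ]).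
    assert (N2 : forall k, nth k p2 0%C = nth (S (S k)) p 0%C)
      by (intros k; rewrite <- N1; unfold p2; destruct p1; simpl; [ now destruct k | reflexivity ]).
    assert (B1 : forall m, Cmod m <= r / 2 -> Cmod (ceval p1 m) <= 2 * ((M + eps) / r)).
    { intros m Hm. apply ceval_half_disc_bound with r; try assumption. intros k. rewrite N1.
      apply Rmult_le_reg_r with r; [ exact Hr | ].
      replace ((M + eps) / r * r) with (M + eps) by (field; lra).
      generalize (Hc (S k)). simpl. lra. }
    assert (B2 : forall m, Cmod m <= r / 2 -> Cmod (ceval p2 m) <= 2 * ((M + eps) / r ^ 2)).
    { intros m Hm. apply ceval_half_disc_bound with r; try assumption. intros k. rewrite N2.
      apply Rmult_le_reg_r with (r ^ 2); [ exact Hr2 | ].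
      replace ((M + eps) / r ^ 2 * r ^ 2) with (M + eps) by (field; lra).
      generalize (Hc (S (S k))). simpl. lra. }
    exists (nth 0 p1 0%C). intros m Hm0 Hm.
    assert (Hm1 : 0 < Cmod m) by now apply Cmod_gt_0.
    assert (B0 : Cmod (nth 0 p 0%C) <= eps).
    { generalize (Hp 0%C). rewrite Hf0, E1, Cmod_0.
      replace (0 - (nth 0 p 0 + 0 * ceval p1 0))%C with (- nth 0 p 0%C)%C by ring.
      rewrite Cmod_opp. intros H; apply H; lra. }
    assert (D : Cmod (f m / m - ceval p1 m)%C <= 2 * eps / Cmod m).
    { replace (f m / m - ceval p1 m)%C with (((f m - ceval p m) + nth 0 p 0) / m)%C
        by (rewrite E1; field; exact Hm0).
      rewrite Cmod_div by exact Hm0. apply Rmult_le_compat_r; [ left; now apply Rinv_0_lt_compat | ].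
      eapply Rle_trans; [ apply Cmod_triangle | ]. assert (Cmod m <= r) by lra.
      generalize (Hp m H). lra. }
    split.
    - generalize (Cmod_triangle_inv (f m / m)%C (ceval p1 m)) (B1 m Hm). lra.
    - replace (f m / m - nth 0 p1 0)%C with ((f m / m - ceval p1 m) + m * ceval p2 m)%C
        by (rewrite E2; ring).
      eapply Rle_trans; [ apply Cmod_triangle | ]. rewrite Cmod_mult.
      assert (Cmod m * Cmod (ceval p2 m) <= Cmod m * (2 * ((M + eps) / r ^ 2)))
        by (apply Rmult_le_compat_l; [ lra | now apply B2 ]). lra. }
  assert (Lip : forall m m' : C, m <> 0%C -> m' <> 0%C -> Cmod m <= r / 2 -> Cmod m' <= r / 2 ->
    Cmod (f m / m - f m' / m')%C <= 2 * M / r ^ 2 * (Cmod m + Cmod m')).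
  { intros m m' Hm0 Hm0' Hm Hm'.
    apply Rle_of_le_eps with (2 / r ^ 2 * (Cmod m + Cmod m') + 2 / Cmod m + 2 / Cmod m').
    intros eps He. destruct (A eps He) as [a1 Ha].
    destruct (Ha m Hm0 Hm) as [_ H1]. destruct (Ha m' Hm0' Hm') as [_ H2].
    rewrite Cmod_sub_sym in H2.
    generalize (Cmod_triangle (f m / m - a1)%C (a1 - f m' / m')%C).
    replace (f m / m - a1 + (a1 - f m' / m'))%C with (f m / m - f m' / m')%C by ring.
    unfold Rdiv in *. nra. }
  split.
  - intros m Hm0 Hm. assert (Hm1 : 0 < Cmod m) by now apply Cmod_gt_0.
    apply Rle_of_le_eps with (2 / r + 2 / Cmod m). intros eps He.
    destruct (A eps He) as [a1 Ha]. destruct (Ha m Hm0 Hm) as [H1 _]. unfold Rdiv in *. lra.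
  - assert (Hcau : exists g0 : C, filterlim (fun m => f m / m)%C (locally' (RtoC 0)) (locally g0)).
    { apply (filterlim_locally_cauchy (U := C_CompleteNormedModule : CompleteSpace) (F := locally' (RtoC 0)) _).
      intros eps. set (K := 2 * M / r ^ 2).
      assert (HK : 0 < Rabs K + 1) by (generalize (Rabs_pos K); lra).
      set (d := Rmin (r / 2) (eps / (4 * (Rabs K + 1)))).
      assert (Hd : 0 < d).
      { apply Rmin_pos; [ lra | ]. apply Rdiv_lt_0_compat; [ apply cond_pos | lra ]. }
      exists (fun m : C => m <> 0%C /\ Cmod m <= d). split.
      - apply locally'_0_intro with d; auto.
      - intros u v [Hu0 Hu] [Hv0 Hv]. apply C_NormedModule_mixin_compat1.
        change (Cmod (f v / v - f u / u)%C < eps).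
        assert (Hd1 : d <= r / 2) by apply Rmin_l.
        assert (Hd2 : d <= eps / (4 * (Rabs K + 1))) by apply Rmin_r.
        eapply Rle_lt_trans; [ apply Lip; try assumption; lra | ]. fold K.
        apply Rle_lt_trans with ((Rabs K + 1) * (2 * (eps / (4 * (Rabs K + 1))))).
        + apply Rle_trans with ((Rabs K + 1) * (Cmod v + Cmod u)).
          * apply Rmult_le_compat_r; [ generalize (Cmod_ge_0 u) (Cmod_ge_0 v); lra | ].
            generalize (Rle_abs K); lra.
          * apply Rmult_le_compat_l; lra.
        + replace ((Rabs K + 1) * (2 * (eps / (4 * (Rabs K + 1))))) with (eps / 2) by (field; lra).
          generalize (cond_pos eps); lra. }
    destruct Hcau as [g0 Hg0]. apply filterlim_ctends in Hg0.
    exists g0. intros m Hm0 Hm.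
    apply Rle_of_le_eps with (2 * M / r ^ 2 + 1). intros eps He.
    assert (Hne : locally' (RtoC 0) (fun m' : C => m' <> RtoC 0 /\ Cmod m' <= Rmin (r / 2) eps)).
    { apply locally'_0_intro with (Rmin (r / 2) eps); [ apply Rmin_pos; lra | auto ]. }
    destruct (filter_ex _ (filter_and _ _ Hne (Hg0 eps He))) as [m' [[H0 H1] H2]].
    assert (HM0 : 0 <= 2 * M / r ^ 2).
    { apply Rmult_le_pos; [ | left; now apply Rinv_0_lt_compat ].
      generalize (Cmod_ge_0 (f 0%C)) (HM 0%C). rewrite Cmod_0. lra. }
    assert (Cmod m' <= r / 2) by (eapply Rle_trans; [ exact H1 | apply Rmin_l ]).
    assert (Cmod m' <= eps) by (eapply Rle_trans; [ exact H1 | apply Rmin_r ]).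
    generalize (Cmod_triangle (f m / m - f m' / m')%C (f m' / m' - g0)%C).
    replace (f m / m - f m' / m' + (f m' / m' - g0))%C with (f m / m - g0)%C by ring.
    generalize (Lip m m' Hm0 H0 Hm H). nra.
Qed.

(** * The reciprocal Gamma function *)

Lemma Rcpow_pos_neq_0 (x : R) (s : C) : Rcpow x s <> 0%C.
Proof. apply Cexp_neq_0. Qed.

Lemma Rcpow_plus (x : R) (s t : C) : Rcpow x (s + t) = (Rcpow x s * Rcpow x t)%C.
Proof. unfold Rcpow. rewrite <- Cexp_plus. f_equal. ring. Qed.

Lemma Rcpow_opp (x : R) (s : C) : (Rcpow x (- s) = / Rcpow x s)%C.
Proof. unfold Rcpow. rewrite <- Cexp_opp. f_equal. ring. Qed.

Lemma Rcpow_1 (x : R) : 0 < x -> Rcpow x 1 = RtoC x.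
Proof. intros Hx. unfold Rcpow. rewrite Cmult_1_l, Cexp_RtoC, exp_ln by exact Hx. reflexivity. Qed.

Lemma INR_fact_neq_0_C (n : nat) : RtoC (INR (fact n)) <> 0%C.
Proof. apply RtoC_neq_0, INR_fact_neq_0. Qed.

(** The reciprocal of Euler's approximant to Gamma: being entire in [s], it
    converges to 1 / Gamma at the poles as well. *)
Definition egam (n : nat) (s : C) : C :=
  (Cpoch s (S n) * Rcpow (INR n) (- s) / INR (fact n))%C.

Definition invG (s : C) : C := Clim eventually (fun n => egam n s).

Lemma ln_step_bounds (n : nat) :
  (1 <= n)%nat -> / INR (S n) <= ln (INR (S n)) - ln (INR n) <= / INR n.
Proof.
  intros Hn. assert (H1 : 1 <= INR n) by (apply (le_INR 1); exact Hn).
  rewrite S_INR.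
  assert (L : forall x, 0 < x -> ln x <= x - 1).
  { intros x Hx. rewrite <- (exp_ln x Hx) at 2. generalize (exp_ineq1_le (ln x)). lra. }
  split.
  - generalize (L (INR n / (INR n + 1)) ltac:(apply Rdiv_lt_0_compat; lra)).
    rewrite ln_div by lra.
    replace (INR n / (INR n + 1) - 1) with (- / (INR n + 1)) by (field; lra). lra.
  - generalize (L ((INR n + 1) / INR n) ltac:(apply Rdiv_lt_0_compat; lra)).
    rewrite ln_div by lra.
    replace ((INR n + 1) / INR n - 1) with (/ INR n) by (field; lra). lra.
Qed.

Definition egam_ratio (n : nat) (s : C) : C :=
  ((1 + s * / INR (S n)) * Cexp (- s * (ln (INR (S n)) - ln (INR n))%R))%C.

Lemma egam_succ (n : nat) (s : C) : egam (S n) s = (egam n s * egam_ratio n s)%C.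
Proof.
  unfold egam, egam_ratio, Rcpow.
  replace (- s * ln (INR (S n)))%C
    with (- s * ln (INR n) + - s * (ln (INR (S n)) - ln (INR n))%R)%C
    by (rewrite RtoC_minus; ring).
  rewrite Cexp_plus. change (Cpoch s (S (S n))) with (Cpoch s (S n) * (s + INR (S n)))%C.
  change (fact (S n)) with ((S n) * fact n)%nat. rewrite mult_INR, RtoC_mult.
  field. repeat split; try apply INR_fact_neq_0_C; apply RtoC_neq_0, not_0_INR; lia.
Qed.

(** The two factors 1 + s / (n + 1) and e^(- s ln (1 + 1/n)) cancel to first
    order. The bound K / n^2 is written as a difference so that it telescopes. *)
Lemma egam_ratio_bound (rho : R) :
  0 <= rho -> exists K, 0 <= K /\ forall (s : C) (n : nat), Cmod s <= rho -> (1 <= n)%nat ->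
  Cmod (egam_ratio n s - 1)%C <= K * (/ INR n - / INR (S n)).
Proof.
  intros Hrho.
  exists (2 * ((1 + rho) * (16 * rho ^ 2 * exp rho) + 2 * rho + 2 * rho ^ 2)).
  assert (Hexp := exp_pos rho).
  assert (H16 : 0 <= 16 * rho ^ 2 * exp rho) by (apply Rmult_le_pos; nra).
  split; [ nra | ].
  intros s n Hs Hn.
  assert (H1 : 1 <= INR n) by (apply (le_INR 1); exact Hn).
  destruct (ln_step_bounds n Hn) as [D1 D2]. unfold egam_ratio.
  set (d := ln (INR (S n)) - ln (INR n)) in *. set (u := / INR (S n)) in *.
  assert (HS : INR (S n) = INR n + 1) by apply S_INR.
  assert (Hu : 0 < u) by (apply Rinv_0_lt_compat; lra).
  assert (Hu1 : u <= 1) by (rewrite <- Rinv_1; apply Rinv_le_contravar; lra).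
  assert (Hv : / INR n <= 1) by (rewrite <- Rinv_1; apply Rinv_le_contravar; lra).
  assert (Hv2 : / INR n <= 2 * u).
  { unfold u. rewrite HS. apply Rmult_le_reg_r with (INR n * (INR n + 1)); [ nra | ].
    field_simplify; lra. }
  assert (Hvu : / INR n - u = / INR n * u) by (unfold u; rewrite HS; field; lra).
  assert (Huv : u * u <= / INR n - u).
  { rewrite Hvu. apply Rmult_le_compat_r; lra. }
  rewrite <- RtoC_inv by lra. fold u.
  replace ((1 + s * u) * Cexp (- s * d) - 1)%C
    with ((1 + s * u) * (Cexp (- s * d) - 1 - - s * d) + (s * (u - d)%R - s * s * (u * d)%R))%C
    by (rewrite RtoC_minus, RtoC_mult; ring).
  assert (Hsd : Cmod (- s * d)%C <= rho * (2 * u)).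
  { rewrite Cmod_mult, Cmod_opp, Cmod_R, Rabs_pos_eq by lra.
    apply Rmult_le_compat; try apply Cmod_ge_0; lra. }
  assert (Hsd1 : Cmod (- s * d)%C <= rho).
  { rewrite Cmod_mult, Cmod_opp, Cmod_R, Rabs_pos_eq by lra.
    generalize (Cmod_ge_0 s). nra. }
  eapply Rle_trans; [ apply Cmod_triangle | ].
  assert (B1 : Cmod ((1 + s * u) * (Cexp (- s * d) - 1 - - s * d))%C
               <= (1 + rho) * (16 * rho ^ 2 * exp rho * (u * u))).
  { rewrite Cmod_mult. apply Rmult_le_compat; try apply Cmod_ge_0.
    - eapply Rle_trans; [ apply Cmod_triangle | ].
      rewrite Cmod_1, Cmod_mult, Cmod_R, Rabs_pos_eq by lra. generalize (Cmod_ge_0 s). nra.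
    - eapply Rle_trans; [ apply Cexp_minus_affine_bound | ].
      replace (16 * rho ^ 2 * exp rho * (u * u)) with (4 * (rho * (2 * u)) ^ 2 * exp rho) by ring.
      apply Rmult_le_compat; [ generalize (pow2_ge_0 (Cmod (- s * d)%C)); lra | left; apply exp_pos | | now apply exp_le ].
      apply Rmult_le_compat_l; [ lra | ]. apply pow_incr. split; [ apply Cmod_ge_0 | exact Hsd ]. }
  assert (B2 : Cmod (s * (u - d)%R - s * s * (u * d)%R)%C
               <= rho * (/ INR n - u) + rho ^ 2 * (2 * (u * u))).
  { eapply Rle_trans; [ apply Cmod_minus_le | ]. rewrite !Cmod_mult, !Cmod_R.
    rewrite (Rabs_left1 (u - d)), (Rabs_pos_eq (u * d)) by nra.
    apply Rplus_le_compat.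
    - apply Rmult_le_compat; try apply Cmod_ge_0; lra.
    - simpl. rewrite Rmult_1_r.
      apply Rmult_le_compat; [ | nra | | nra ].
      + generalize (Cmod_ge_0 s). nra.
      + apply Rmult_le_compat; try apply Cmod_ge_0; lra. }
  eapply Rle_trans; [ apply Rplus_le_compat; [ exact B1 | exact B2 ] | ].
  assert (C1 : (1 + rho) * (16 * rho ^ 2 * exp rho * (u * u))
          <= (1 + rho) * (16 * rho ^ 2 * exp rho) * (/ INR n - u)).
  { rewrite <- Rmult_assoc. apply Rmult_le_compat_l; [ nra | exact Huv ]. }
  assert (C2 : 0 <= / INR n - u) by (generalize (Rle_0_sqr u); unfold Rsqr; lra).
  assert (C3 : rho ^ 2 * (2 * (u * u)) <= rho ^ 2 * (2 * (/ INR n - u))) by nra.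
  assert (C4 : 0 <= (1 + rho) * (16 * rho ^ 2 * exp rho) * (/ INR n - u)) by (apply Rmult_le_pos; nra).
  assert (C5 : 0 <= rho * (/ INR n - u)) by nra.
  assert (C6 : 0 <= rho ^ 2 * (/ INR n - u)) by nra.
  nra.
Qed.

Lemma Rinv_INR_decr (n m : nat) : (1 <= n <= m)%nat -> / INR m <= / INR n.
Proof.
  intros H. apply Rinv_le_contravar; [ apply lt_0_INR; lia | apply le_INR; lia ].
Qed.

(** The constant does not depend on where the product starts, so the approximants
    are controlled from below by their limit. *)
Lemma egam_growth (rho : R) :
  0 <= rho -> exists K, 0 <= K /\ forall (s : C) (N n : nat), Cmod s <= rho ->
  (1 <= N <= n)%nat ->
  Cmod (egam n s) <= K * Cmod (egam N s) /\
  Cmod (egam n s - egam N s)%C <= K * Cmod (egam N s) * (/ INR N - / INR n).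
Proof.
  intros Hrho. destruct (egam_ratio_bound rho Hrho) as [K0 [HK0 HK]].
  exists (exp K0 * (1 + K0)). assert (He : 1 <= exp K0) by (rewrite <- exp_0; now apply exp_le).
  split; [ nra | ].
  intros s N n Hs [HN Hn]. assert (HgN := Cmod_ge_0 (egam N s)).
  assert (HN1 : / INR N <= 1) by (generalize (Rinv_INR_decr 1 N ltac:(lia)); simpl; lra).
  assert (Hinv : forall p, (N <= p)%nat -> 0 < / INR p <= / INR N)
    by (intros p Hp; split; [ apply Rinv_0_lt_compat, lt_0_INR; lia | apply Rinv_INR_decr; lia ]).
  assert (P : Cmod (egam n s) <= exp (K0 * (/ INR N - / INR n)) * Cmod (egam N s) /\
    Cmod (egam n s - egam N s)%C <= K0 * (exp K0 * Cmod (egam N s)) * (/ INR N - / INR n)).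
  { induction Hn as [ | p Hp [IH1 IH2] ].
    - rewrite Rminus_diag, Rmult_0_r, exp_0.
      replace (egam N s - egam N s)%C with (RtoC 0) by ring. rewrite Cmod_0. lra.
    - assert (Hr : Cmod (egam_ratio p s - 1)%C <= K0 * (/ INR p - / INR (S p))) by (apply HK; [ exact Hs | lia ]).
      assert (Hd2 := Hinv p Hp). split.
      + rewrite egam_succ, Cmod_mult.
        replace (K0 * (/ INR N - / INR (S p)))
          with (K0 * (/ INR N - / INR p) + K0 * (/ INR p - / INR (S p))) by ring.
        rewrite exp_plus, Rmult_assoc, (Rmult_comm (exp (K0 * (/ INR p - _)))), <- Rmult_assoc.
        apply Rmult_le_compat; try apply Cmod_ge_0; [ exact IH1 | ].
        eapply Rle_trans; [ | apply exp_ineq1_le ].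
        generalize (Cmod_triangle_inv (egam_ratio p s) 1). rewrite Cmod_1. lra.
      + replace (egam (S p) s - egam N s)%C
          with ((egam_ratio p s - 1) * egam p s + (egam p s - egam N s))%C
          by (rewrite egam_succ; ring).
        eapply Rle_trans; [ apply Cmod_triangle | ]. rewrite Cmod_mult.
        replace (K0 * (exp K0 * Cmod (egam N s)) * (/ INR N - / INR (S p)))
          with (K0 * (/ INR p - / INR (S p)) * (exp K0 * Cmod (egam N s))
                + K0 * (exp K0 * Cmod (egam N s)) * (/ INR N - / INR p)) by ring.
        apply Rplus_le_compat; [ | exact IH2 ].
        apply Rmult_le_compat; try apply Cmod_ge_0; [ exact Hr | ].
        eapply Rle_trans; [ exact IH1 | ]. apply Rmult_le_compat_r; [ exact HgN | ].
        apply exp_le. nra. }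
  destruct P as [P1 P2]. assert (Hd := Hinv n Hn). split.
  - eapply Rle_trans; [ exact P1 | ]. apply Rmult_le_compat_r; [ exact HgN | ].
    apply Rle_trans with (exp K0); [ apply exp_le; nra | nra ].
  - eapply Rle_trans; [ exact P2 | ]. apply Rmult_le_compat_r; [ lra | ].
    rewrite <- Rmult_assoc. apply Rmult_le_compat_r; [ exact HgN | ]. nra.
Qed.

Lemma egam_1_bound (rho : R) (s : C) :
  0 <= rho -> Cmod s <= rho -> Cmod (egam 1 s) <= rho * (rho + 1).
Proof.
  intros Hrho Hs. replace (egam 1 s) with (s * (s + 1))%C.
  - rewrite Cmod_mult. apply Rmult_le_compat; try apply Cmod_ge_0; [ exact Hs | ].
    eapply Rle_trans; [ apply Cmod_triangle | ]. rewrite Cmod_1. lra.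
  - unfold egam, Rcpow. simpl. rewrite ln_1.
    replace (- s * 0)%C with (RtoC 0) by ring. rewrite Cexp_0. field.
Qed.

Lemma eventually_ge (n0 : nat) : eventually (fun n => (n0 <= n)%nat).
Proof. exists n0. auto. Qed.

Lemma filterlim_K_div_INR (K : R) : filterlim (fun n => K * / INR n) eventually (locally 0).
Proof.
  replace (locally 0) with (locally (K * 0)) by (f_equal; ring).
  apply (filterlim_comp _ _ _ (fun n => / INR n) (fun y => K * y) eventually (locally 0)).
  - assert (H : is_lim_seq (fun n => / INR n) 0).
    { change (is_lim_seq (fun n => / INR n) (Rbar_inv p_infty)).
      apply is_lim_seq_inv; [ apply is_lim_seq_INR | discriminate ]. }
    exact H.
  - apply (continuous_scal_r K (fun y : R => y) 0), continuous_id.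
Qed.

Lemma egam_rate (rho : R) :
  0 <= rho -> exists K, 0 <= K /\ forall s, Cmod s <= rho ->
  (forall n, (1 <= n)%nat -> Cmod (egam n s - invG s)%C <= K * / INR n) /\
  ctends eventually (fun n => egam n s) (invG s).
Proof.
  intros Hrho. destruct (egam_growth rho Hrho) as [K0 [HK0 HK]].
  set (B := rho * (rho + 1)). assert (HB : 0 <= B) by (unfold B; nra).
  set (K := K0 * (K0 * B)).
  assert (HKpos : 0 <= K) by (unfold K; apply Rmult_le_pos; [ | apply Rmult_le_pos ]; assumption).
  exists K. split; [ exact HKpos | ]. intros s Hs.
  assert (D : forall N n, (1 <= N <= n)%nat -> Cmod (egam n s - egam N s)%C <= K * / INR N).
  { intros N n Hn. destruct (HK s N n Hs Hn) as [_ H].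
    assert (HN : Cmod (egam N s) <= K0 * B).
    { destruct (HK s 1%nat N Hs ltac:(lia)) as [H1 _]. eapply Rle_trans; [ exact H1 | ].
      apply Rmult_le_compat_l; [ exact HK0 | now apply egam_1_bound ]. }
    assert (Hp0 : 0 < / INR n) by (apply Rinv_0_lt_compat, lt_0_INR; lia).
    assert (Hp1 := Rinv_INR_decr N n Hn).
    eapply Rle_trans; [ exact H | ]. unfold K.
    apply Rmult_le_compat; [ apply Rmult_le_pos; [ exact HK0 | apply Cmod_ge_0 ] | lra | | lra ].
    now apply Rmult_le_compat_l. }
  assert (L : exists l, filterlim (fun n => egam n s) eventually (locally l)).
  { apply (filterlim_locally_cauchy (U := C_CompleteNormedModule : CompleteSpace) (F := eventually) _).
    intros eps.
    assert (Hp : 0 < eps / (2 * K + 1)) by (apply Rdiv_lt_0_compat; [ apply cond_pos | lra ]).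
    destruct (archimed_cor1 _ Hp) as [N [HN HN0]].
    exists (fun n => (N <= n)%nat). split; [ apply eventually_ge | ].
    intros u v Hu Hv. apply C_NormedModule_mixin_compat1.
    change (Cmod (egam v s - egam u s)%C < eps).
    replace (egam v s - egam u s)%C with ((egam v s - egam N s) - (egam u s - egam N s))%C by ring.
    eapply Rle_lt_trans; [ apply Cmod_minus_le | ].
    apply Rle_lt_trans with ((2 * K) * / INR N).
    - generalize (D N u ltac:(lia)) (D N v ltac:(lia)). lra.
    - apply Rle_lt_trans with ((2 * K) * (eps / (2 * K + 1))).
      + apply Rmult_le_compat_l; lra.
      + replace (2 * K * (eps / (2 * K + 1))) with (eps - eps / (2 * K + 1)) by (field; lra). lra. }
  destruct L as [l Hl]. apply filterlim_ctends in Hl.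
  assert (E : invG s = l) by (apply Clim_eq; [ exact Hl ]).
  rewrite E. split; [ | exact Hl ]. intros N HN.
  rewrite Cmod_sub_sym.
  apply (ctends_bound (F := eventually) (fun n => egam n s - egam N s)%C).
  - exists N. intros n Hn. apply D. lia.
  - apply ctends_minus; [ exact Hl | apply ctends_const ].
Qed.

Lemma egam_tends (s : C) : ctends eventually (fun n => egam n s) (invG s).
Proof.
  destruct (egam_rate (Cmod s) (Cmod_ge_0 s)) as [K [_ HK]]. apply HK. lra.
Qed.

(** Read as a lower bound for [egam], this bounds 1 / Gamma (s + N) from above. *)
Lemma invG_le_egam (rho : R) :
  0 <= rho -> exists K, 0 <= K /\ forall (s : C) (N : nat), Cmod s <= rho -> (1 <= N)%nat ->
  Cmod (invG s) <= K * Cmod (egam N s).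
Proof.
  intros Hrho. destruct (egam_growth rho Hrho) as [K [HK0 HK]]. exists K. split; [ exact HK0 | ].
  intros s N Hs HN. apply (ctends_bound (F := eventually) (fun n => egam n s)).
  - exists N. intros n Hn. apply HK; [ exact Hs | lia ].
  - apply egam_tends.
Qed.

Lemma egam_bounded (rho : R) :
  0 <= rho -> exists K, 0 <= K /\ forall (s : C) (N : nat), Cmod s <= rho -> (1 <= N)%nat ->
  Cmod (egam N s) <= K.
Proof.
  intros Hrho. destruct (egam_growth rho Hrho) as [K [HK0 HK]].
  exists (K * (rho * (rho + 1))). split; [ apply Rmult_le_pos; nra | ].
  intros s N Hs HN. destruct (HK s 1%nat N Hs ltac:(lia)) as [H1 _].
  eapply Rle_trans; [ exact H1 | ].
  apply Rmult_le_compat_l; [ exact HK0 | now apply egam_1_bound ].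
Qed.

Lemma invG_bounded (rho : R) :
  0 <= rho -> exists K, 0 <= K /\ forall s, Cmod s <= rho -> Cmod (invG s) <= K.
Proof.
  intros Hrho. destruct (egam_bounded rho Hrho) as [K [HK0 HK]]. exists K. split; [ exact HK0 | ].
  intros s Hs. apply (ctends_bound (F := eventually) (fun n => egam n s)).
  - exists 1%nat. intros n Hn. now apply HK.
  - apply egam_tends.
Qed.

Lemma Cpoch_succ_l (s : C) (n : nat) : Cpoch s (S n) = (s * Cpoch (s + 1) n)%C.
Proof.
  induction n as [ | n IH ].
  - simpl. ring.
  - change (Cpoch s (S (S n))) with (Cpoch s (S n) * (s + INR (S n)))%C.
    change (Cpoch (s + 1) (S n)) with (Cpoch (s + 1) n * (s + 1 + INR n))%C.
    rewrite IH, S_INR, RtoC_plus. ring.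
Qed.

Lemma invG_rec (s : C) : invG s = (s * invG (s + 1))%C.
Proof.
  symmetry. apply (ctends_unique (F := eventually) (fun n => s * egam n (s + 1))%C).
  - apply ctends_mult; [ apply ctends_const | apply egam_tends ].
  - apply ctends_ext_loc with (fun n => egam n s * (1 + (s + 1) * RtoC (1 * / INR n)))%C.
    + exists 1%nat. intros n Hn.
      assert (HN : 0 < INR n) by (apply lt_0_INR; lia).
      unfold egam.
      replace (s * (Cpoch (s + 1) (S n) * Rcpow (INR n) (- (s + 1)) / INR (fact n)))%C
        with ((s * Cpoch (s + 1) (S n)) * Rcpow (INR n) (- (s + 1)) / INR (fact n))%C
        by (unfold Cdiv; ring).
      rewrite <- Cpoch_succ_l.
      change (Cpoch s (S (S n))) with (Cpoch s (S n) * (s + INR (S n)))%C.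
      replace (- (s + 1))%C with (- s + - (1))%C by ring.
      rewrite Rcpow_plus, (Rcpow_opp (INR n) 1), Rcpow_1 by exact HN.
      rewrite S_INR, RtoC_plus, RtoC_mult, RtoC_inv by lra. field.
      split; [ apply RtoC_neq_0; lra | apply INR_fact_neq_0_C ].
    + replace (invG s) with (invG s * (1 + (s + 1) * RtoC 0))%C by ring.
      apply ctends_mult; [ apply egam_tends | ].
      apply ctends_plus; [ apply ctends_const | ].
      apply ctends_mult; [ apply ctends_const | ].
      apply ctends_RtoC; [ apply filterlim_K_div_INR ].
Qed.

Lemma invG_shift (s : C) (n : nat) : invG s = (Cpoch s n * invG (s + INR n))%C.
Proof.
  induction n as [ | n IH ].
  - simpl. replace (s + 0)%C with s by ring. ring.
  - rewrite IH, (invG_rec (s + INR n)). change (Cpoch s (S n)) with (Cpoch s n * (s + INR n))%C.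
    rewrite S_INR, RtoC_plus, <- Cplus_assoc. ring.
Qed.

Lemma invG_neg_shift (s : C) (n : nat) :
  invG (- s - INR n) = (- ((- (1)) ^ n * Cpoch s (S n) * invG (1 - s)))%C.
Proof.
  induction n as [ | n IH ].
  - simpl. replace (- s - 0)%C with (- s)%C by ring. rewrite invG_rec.
    replace (- s + 1)%C with (1 - s)%C by ring. ring.
  - rewrite invG_rec. replace (- s - INR (S n) + 1)%C with (- s - INR n)%C
      by (rewrite S_INR, RtoC_plus; ring).
    rewrite IH. change (Cpoch s (S (S n))) with (Cpoch s (S n) * (s + INR (S n)))%C.
    change ((- (1)) ^ S n)%C with (- (1) * (- (1)) ^ n)%C. ring.
Qed.

Lemma CGamma_invG (s : C) : invG s <> 0%C -> CGamma s = (/ invG s)%C.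
Proof.
  intros Hs. apply Clim_eq.
  pose proof (egam_tends s) as H.
  apply ctends_ext_loc with (fun n => / egam n s)%C;
    [ | apply ctends_inv; [ exact Hs | exact H ] ].
  generalize (ctends_neq0 (F := eventually) _ _ Hs H). apply filter_imp. intros n Hn.
  assert (Hn0 : egam n s <> 0%C).
  { apply Cmod_gt_0 in Hs. apply Cmod_gt_0. lra. }
  assert (Hp : Cpoch s (S n) <> 0%C).
  { intros E. apply Hn0. unfold egam. rewrite E. unfold Cdiv. ring. }
  unfold egam. rewrite Rcpow_opp. field.
  repeat split; first [ exact Hp | apply Rcpow_pos_neq_0 | apply INR_fact_neq_0_C ].
Qed.

Lemma Hol_Cpoch (r : R) (a b : C) (n : nat) : 0 <= r -> Hol r (fun m => Cpoch (a + b * m) n).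
Proof.
  intros Hr. induction n as [ | n IH ]; [ apply (Hol_const r (RtoC 1)) | ]. simpl.
  apply Hol_mult; [ exact Hr | exact IH | ].
  apply Hol_plus; [ now apply Hol_affine | apply Hol_const ].
Qed.

Lemma Hol_Rcpow (r : R) (x : R) (a b : C) : 0 <= r -> Hol r (fun m => Rcpow x (a + b * m)).
Proof.
  intros Hr. apply Hol_ext with (fun m => Rcpow x a * Cexp (m * (b * ln x)))%C.
  - intros m _. rewrite Rcpow_plus. f_equal. unfold Rcpow. f_equal. ring.
  - apply Hol_mult; [ exact Hr | apply Hol_const | now apply Hol_Cexp ].
Qed.

Lemma Hol_egam (r : R) (a b : C) (n : nat) : 0 <= r -> Hol r (fun m => egam n (a + b * m)).
Proof.
  intros Hr. unfold egam. apply Hol_mult; [ exact Hr | | apply Hol_const ].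
  apply Hol_mult; [ exact Hr | now apply Hol_Cpoch | ].
  apply Hol_ext with (fun m => Rcpow (INR n) (- a + - b * m)); [ | now apply Hol_Rcpow ].
  intros m _. f_equal. ring.
Qed.

Lemma Hol_invG (r : R) (a b : C) : 0 <= r -> Hol r (fun m => invG (a + b * m)).
Proof.
  intros Hr. apply Hol_uniform_limit. intros eps He.
  set (rho := Cmod a + Cmod b * r).
  assert (Hrho : 0 <= rho).
  { unfold rho. generalize (Cmod_ge_0 a) (Rmult_le_pos _ _ (Cmod_ge_0 b) Hr). lra. }
  destruct (egam_rate rho Hrho) as [K [HK0 HK]].
  assert (Hp : 0 < eps / (K + 1)) by (apply Rdiv_lt_0_compat; lra).
  destruct (archimed_cor1 _ Hp) as [n [Hn Hn0]].
  exists (fun m => egam n (a + b * m)). split; [ now apply Hol_egam | ]. intros m Hm.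
  assert (Hs : Cmod (a + b * m)%C <= rho).
  { eapply Rle_trans; [ apply Cmod_triangle | ]. rewrite Cmod_mult. unfold rho.
    apply Rplus_le_compat_l, Rmult_le_compat_l; [ apply Cmod_ge_0 | exact Hm ]. }
  rewrite Cmod_sub_sym. destruct (HK _ Hs) as [H _].
  eapply Rle_trans; [ apply H; lia | ].
  apply Rle_trans with (K * (eps / (K + 1))); [ apply Rmult_le_compat_l; lra | ].
  replace (K * (eps / (K + 1))) with (eps - eps / (K + 1)) by (field; lra). lra.
Qed.

(** * The reflection formula *)

Definition cint (f : R -> C) (b : R) : C :=
  (RInt (fun t => Re (f t)) 0 b, RInt (fun t => Im (f t)) 0 b).

Lemma cint_0 (f : R -> C) : cint f 0 = 0%C.
Proof. unfold cint. rewrite !RInt_point. reflexivity. Qed.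

Lemma is_derive_continuity_pt (f : R -> R) (x l : R) : is_derive f x l -> continuity_pt f x.
Proof.
  intros H. apply derivable_continuous_pt. exists l. now apply is_derive_Reals.
Qed.

Lemma is_derive_RInt_of_derivable (f df : R -> R) (x : R) :
  (forall t, is_derive f t (df t)) -> is_derive (fun b => RInt f 0 b) x (f x).
Proof.
  intros H.
  assert (Hc : forall t, continuous f t)
    by (intros t; apply (ex_derive_continuous (V := R_NormedModule)); exists (df t); apply H).
  apply (is_derive_RInt (V := R_NormedModule) f (fun b => RInt f 0 b) 0 x).
  - apply filter_forall. intros b. apply (RInt_correct (V := R_CompleteNormedModule)).
    apply (ex_RInt_continuous (V := R_CompleteNormedModule)). intros; apply Hc.
  - apply Hc.
Qed.

Lemma cderive_cint (f df : R -> C) (x : R) :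
  (forall t, cderive f t (df t)) -> cderive (cint f) x (f x).
Proof.
  intros H. apply cderive_Re_Im.
  - apply (is_derive_RInt_of_derivable (fun t => Re (f t)) (fun t => Re (df t))).
    intros t. now apply cderive_Re.
  - apply (is_derive_RInt_of_derivable (fun t => Im (f t)) (fun t => Im (df t))).
    intros t. now apply cderive_Im.
Qed.

Lemma Cmod_increment_le_real (f df : R -> C) (g dg : R -> R) (a b : R) :
  a <= b ->
  (forall t, cderive f t (df t)) -> (forall t, is_derive g t (dg t)) ->
  (forall t, a <= t <= b -> Cmod (df t) <= dg t) ->
  Cmod (f b - f a)%C <= 2 * (g b - g a).
Proof.
  intros Hab Hf Hg Hle.
  assert (P : forall (k dk : R -> R), (forall t, is_derive k t (dk t)) ->
    (forall t, a <= t <= b -> Rabs (dk t) <= dg t) -> Rabs (k b - k a) <= g b - g a).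
  { assert (Q : forall (k dk : R -> R), (forall t, is_derive k t (dk t)) ->
      (forall t, a <= t <= b -> dk t <= dg t) -> k b - k a <= g b - g a).
    { intros k dk Hk Hkg.
      destruct (MVT_gen (fun t => g t - k t) a b (fun t => dg t - dk t)) as [c [Hc E]].
      - intros t _. apply (is_derive_minus (V := R_NormedModule) g k t (dg t) (dk t)); [ apply Hg | apply Hk ].
      - intros t _. apply (is_derive_continuity_pt _ t (dg t - dk t)).
        apply (is_derive_minus (V := R_NormedModule) g k t (dg t) (dk t)); [ apply Hg | apply Hk ].
      - rewrite Rmin_left, Rmax_right in Hc by exact Hab.
        generalize (Hkg c Hc). nra. }
    intros k dk Hk Hkg. apply Rabs_le. split.
    - generalize (Q (fun t => - k t) (fun t => - dk t)
        (fun t => is_derive_opp (V := R_NormedModule) k t (dk t) (Hk t))).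
      intros H. assert (forall t, a <= t <= b -> - dk t <= dg t); [ | specialize (H H0); lra ].
      intros t Ht. generalize (Hkg t Ht) (Rle_abs (- dk t)). rewrite Rabs_Ropp. lra.
    - apply (Q k dk Hk). intros t Ht. generalize (Hkg t Ht) (Rle_abs (dk t)). lra. }
  eapply Rle_trans; [ apply Cmod_le_Re_Im | ].
  assert (H1 := P (fun t => Re (f t)) (fun t => Re (df t)) (fun t => cderive_Re _ _ _ (Hf t))
    (fun t Ht => Rle_trans _ _ _ (re_le_Cmod _) (Hle t Ht))).
  assert (H2 := P (fun t => Im (f t)) (fun t => Im (df t)) (fun t => cderive_Im _ _ _ (Hf t))
    (fun t Ht => Rle_trans _ _ _ (Im_le_Cmod _) (Hle t Ht))).
  change (Re (f b - f a)%C) with (Re (f b) - Re (f a)).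
  change (Im (f b - f a)%C) with (Im (f b) - Im (f a)). lra.
Qed.

Lemma cderive_zero_const (f : R -> C) (a b : R) : (forall t, cderive f t 0%C) -> f b = f a.
Proof.
  intros H. apply Cmod_minus_eq_0. apply Rle_antisym; [ | apply Cmod_ge_0 ].
  replace 0 with (2 * 0 * Rabs (b - a)) by ring.
  apply (Cmod_increment_le f (fun _ => RtoC 0)). intros t _. split; [ apply H | ].
  rewrite Cmod_0. lra.
Qed.

Definition ccos2 (s : C) (t : R) : C :=
  ((Cexp (2 * Ci * s * t) + Cexp (- (2 * Ci * s) * t)) / 2)%C.

Definition csin2 (s : C) (t : R) : C :=
  ((Cexp (2 * Ci * s * t) - Cexp (- (2 * Ci * s) * t)) / (2 * Ci))%C.

Lemma cderive_value (f : R -> C) (t : R) (l l' : C) : l = l' -> cderive f t l -> cderive f t l'.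
Proof. now intros ->. Qed.

Lemma cderive_ccos2 (s : C) (t : R) : cderive (ccos2 s) t (- (2 * s * csin2 s t))%C.
Proof.
  eapply cderive_value; [ | eapply cderive_ext; [ | apply (cderive_cmult (/ 2)%C);
    apply cderive_plus; [ apply (cderive_Cexp (2 * Ci * s)%C)
                        | apply (cderive_Cexp (- (2 * Ci * s))%C) ] ] ].
  - unfold csin2. set (e1 := Cexp _). set (e2 := Cexp _).
    replace (/ 2 * (2 * Ci * s * e1 + - (2 * Ci * s) * e2))%C with (Ci * s * (e1 - e2))%C by field.
    replace (- (2 * s * ((e1 - e2) / (2 * Ci))))%C with (- (1) * s * (e1 - e2) / Ci)%C
      by (field; apply Ci_neq_0).
    rewrite <- Ci_sq. field. apply Ci_neq_0.
  - intros y. unfold ccos2. field.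
Qed.

Lemma cderive_csin2 (s : C) (t : R) : cderive (csin2 s) t (2 * s * ccos2 s t)%C.
Proof.
  eapply cderive_value; [ | eapply cderive_ext; [ | apply (cderive_cmult (/ (2 * Ci))%C);
    apply cderive_minus; [ apply (cderive_Cexp (2 * Ci * s)%C)
                        | apply (cderive_Cexp (- (2 * Ci * s))%C) ] ] ].
  - unfold ccos2. field. apply Ci_neq_0.
  - intros y. unfold csin2. field. apply Ci_neq_0.
Qed.

Lemma csin2_0_r (s : C) : csin2 s 0 = 0%C.
Proof.
  unfold csin2. replace (2 * Ci * s * 0)%C with (RtoC 0) by ring.
  replace (- (2 * Ci * s) * 0)%C with (RtoC 0) by ring. rewrite Cexp_0. field. apply Ci_neq_0.
Qed.

Lemma ccos2_0_l (t : R) : ccos2 0 t = 1%C.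
Proof.
  unfold ccos2. replace (2 * Ci * 0 * t)%C with (RtoC 0) by ring.
  replace (- (2 * Ci * 0) * t)%C with (RtoC 0) by ring. rewrite Cexp_0. field.
Qed.

Definition cos_power_weight (n : nat) (s : C) (t : R) : C := (ccos2 s t * (cos t ^ n)%R)%C.

Definition cos_power_int (n : nat) (s : C) : C := cint (cos_power_weight n s) (PI / 2).

Lemma is_derive_cos_pow (n : nat) (t : R) :
  is_derive (fun t => cos t ^ n) t (- INR n * cos t ^ (pred n) * sin t).
Proof. auto_derive; [ exact I | ]. ring. Qed.

Lemma cderive_cos_power_weight (n : nat) (s : C) (t : R) :
  cderive (cos_power_weight n s) t
    (- (2 * s * csin2 s t) * (cos t ^ n)%R
     + ccos2 s t * (- INR n * cos t ^ (pred n) * sin t)%R)%C.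
Proof.
  apply (cderive_mult (ccos2 s) (fun t => RtoC (cos t ^ n))).
  - apply cderive_ccos2.
  - apply cderive_RtoC, is_derive_cos_pow.
Qed.

Lemma cderive_cos_power_int (n : nat) (s : C) (t : R) :
  cderive (cint (cos_power_weight n s)) t (cos_power_weight n s t).
Proof. eapply cderive_cint. intros u. apply cderive_cos_power_weight. Qed.

Lemma cos_power_int_rec (n : nat) (s : C) :
  ((INR (S (S n)) ^ 2 - 4 * s ^ 2) * cos_power_int (S (S n)) s
   = INR (S (S n)) * INR (S n) * cos_power_int n s)%C.
Proof.
  set (N := INR (S (S n))).
  assert (HN : INR (S n) = N - 1) by (unfold N; rewrite (S_INR (S n)); ring).
  (* Two integrations by parts, condensed into one antiderivative that vanishes
     at both ends of the quarter period. *)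
  set (Phi := fun t => (N * ccos2 s t * (sin t * cos t ^ S n)%R
                        + - (2 * s * csin2 s t) * (cos t ^ S (S n))%R)%C).
  set (f := fun t => (Phi t - ((N ^ 2 - 4 * s ^ 2) * cint (cos_power_weight (S (S n)) s) t
                      - N * INR (S n) * cint (cos_power_weight n s) t))%C).
  assert (E : f (PI / 2) = f 0).
  { apply cderive_zero_const. intros t. unfold f, Phi.
    eapply cderive_value; [ | apply cderive_minus; [ apply cderive_plus | apply cderive_minus ] ].
    2:{ apply (cderive_mult (fun t => N * ccos2 s t)%C (fun t => RtoC (sin t * cos t ^ S n))).
        - apply cderive_cmult, cderive_ccos2.
        - apply cderive_RtoC. auto_derive; [ exact I | reflexivity ]. }
    2:{ apply (cderive_mult (fun t => - (2 * s * csin2 s t))%C (fun t => RtoC (cos t ^ S (S n)))).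
        - apply cderive_opp, cderive_cmult, cderive_csin2.
        - apply cderive_RtoC, is_derive_cos_pow. }
    2:{ apply cderive_cmult, cderive_cos_power_int. }
    2:{ apply cderive_cmult, cderive_cos_power_int. }
    unfold cos_power_weight.
    replace (match n with | 0%nat => 1 | S _ => INR n + 1 end) with (N - 1) by (rewrite <- HN; reflexivity).
    change (pred (S (S n))) with (S n). change (pred (S n)) with n. fold N. rewrite HN.
    simpl pow. rewrite !RtoC_mult, !RtoC_plus, !RtoC_mult, !RtoC_opp, RtoC_minus.
    assert (Hs : (RtoC (sin t) * RtoC (sin t) = 1 - RtoC (cos t) * RtoC (cos t))%C).
    { rewrite <- !RtoC_mult, <- RtoC_minus. f_equal. generalize (sin2_cos2 t). unfold Rsqr. lra. }
    set (S0 := RtoC (sin t)) in *. set (C0 := RtoC (cos t)) in *. set (P := RtoC (cos t ^ n)).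
    set (u := ccos2 s t). set (v := csin2 s t). set (n' := RtoC N).
    transitivity (u * n' * (n' - 1) * P * (1 - C0 * C0 - S0 * S0))%C; [ ring | ].
    rewrite Hs. ring. }
  unfold f, Phi in E. rewrite !cint_0, cos_PI2, sin_0, csin2_0_r in E. simpl pow in E.
  unfold cos_power_int.
  match goal with |- ?l = ?r => replace l with (r - (0 - (l - r)))%C by ring end.
  replace (0 - ((N ^ 2 - 4 * s ^ 2) * cint (cos_power_weight (S (S n)) s) (PI / 2) -
       N * INR (S n) * cint (cos_power_weight n s) (PI / 2)))%C with (RtoC 0); [ ring | ].
  transitivity (0 - 0)%C; [ ring | ].
  match type of E with (?a - ?b = ?c - ?d)%C => assert (Ha : a = 0%C); [ | assert (Hc : c = 0%C) ] end.
  - rewrite !Rmult_0_l, !Rmult_0_r. ring.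
  - rewrite !Rmult_0_l. ring.
  - rewrite Ha, Hc in E. rewrite E. ring.
Qed.

Lemma cos_power_int_0_l (s : C) : (2 * s * cos_power_int 0 s = Csin (PI * s))%C.
Proof.
  assert (E : (2 * s * cint (cos_power_weight 0 s) (PI / 2) - csin2 s (PI / 2)
               = 2 * s * cint (cos_power_weight 0 s) 0 - csin2 s 0)%C).
  { apply (cderive_zero_const (fun t => 2 * s * cint (cos_power_weight 0 s) t - csin2 s t)%C).
    intros t. eapply cderive_value;
      [ | apply cderive_minus; [ apply cderive_cmult, cderive_cos_power_int | apply cderive_csin2 ] ].
    unfold cos_power_weight. simpl. ring. }
  rewrite cint_0, csin2_0_r in E.
  assert (E2 : csin2 s (PI / 2) = Csin (PI * s)).
  { unfold csin2, Csin. rewrite RtoC_div by lra. f_equal. f_equal; f_equal; field. }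
  rewrite <- E2. unfold cos_power_int.
  match goal with |- ?l = ?r => replace l with (r + (l - r))%C by ring end.
  rewrite E. ring.
Qed.

Lemma cos_power_int_0_0 : cos_power_int 0 0 = RtoC (PI / 2).
Proof.
  assert (E : (cint (cos_power_weight 0 0) (PI / 2) - (PI / 2)%R
               = cint (cos_power_weight 0 0) 0 - 0%R)%C).
  { apply (cderive_zero_const (fun t => cint (cos_power_weight 0 0) t - t)%C). intros t.
    eapply cderive_value; [ | apply cderive_minus; [ apply cderive_cos_power_int
      | apply (cderive_RtoC (fun t => t)), (@is_derive_id R_AbsRing) ] ].
    unfold cos_power_weight. rewrite ccos2_0_l. simpl. change (@one R_AbsRing) with 1. ring. }
  rewrite cint_0 in E. unfold cos_power_int.
  match goal with |- ?l = ?r => replace l with (r + (l - r))%C by ring end.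
  rewrite E. ring.
Qed.

Lemma t_cos_le_sin (t : R) : 0 <= t <= PI / 2 -> t * cos t <= sin t.
Proof.
  intros Ht. pose proof PI_RGT_0 as Hpi.
  destruct (MVT_gen (fun t => sin t - t * cos t) 0 t (fun t => t * sin t)) as [c [Hc E]].
  - intros x _. auto_derive; [ exact I | ring ].
  - intros x _. apply (is_derive_continuity_pt _ x (x * sin x)). auto_derive; [ exact I | ring ].
  - rewrite Rmin_left, Rmax_right in Hc by lra. rewrite sin_0 in E.
    assert (0 <= sin c) by (apply sin_ge_0; lra).
    assert (0 <= c * sin c * (t - 0)) by (apply Rmult_le_pos; [ apply Rmult_le_pos | ]; lra).
    lra.
Qed.

Lemma ccos2_minus_1_bound (s : C) :
  exists K, 0 <= K /\ forall t, 0 <= t <= PI / 2 -> Cmod (ccos2 s t - 1)%C <= K * t ^ 2.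
Proof.
  pose proof PI_RGT_0 as Hpi. pose proof (Cmod_ge_0 s) as Hs.
  exists (16 * Cmod s ^ 2 * exp (PI * Cmod s)). split.
  { apply Rmult_le_pos; [ nra | left; apply exp_pos ]. }
  intros t Ht.
  set (w := (2 * Ci * s * t)%C).
  replace (ccos2 s t - 1)%C with (((Cexp w - 1 - w) + (Cexp (- w) - 1 - - w)) / 2)%C.
  2:{ unfold ccos2. fold w. replace (- (2 * Ci * s) * t)%C with (- w)%C by (unfold w; ring). field. }
  assert (Hw : Cmod w = 2 * Cmod s * t).
  { unfold w. rewrite !Cmod_mult, Cmod_Ci, !Cmod_R, !Rabs_pos_eq by lra. ring. }
  rewrite Cmod_div by (apply RtoC_neq_0; lra). rewrite Cmod_R, Rabs_pos_eq by lra.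
  generalize (Cmod_triangle (Cexp w - 1 - w)%C (Cexp (- w) - 1 - - w)%C)
    (Cexp_minus_affine_bound w) (Cexp_minus_affine_bound (- w)).
  rewrite Cmod_opp, Hw. intros H1 H2 H3.
  assert (He : exp (2 * Cmod s * t) <= exp (PI * Cmod s)) by (apply exp_le; nra).
  assert (H4 : 4 * (2 * Cmod s * t) ^ 2 * exp (2 * Cmod s * t)
               <= 4 * (2 * Cmod s * t) ^ 2 * exp (PI * Cmod s))
    by (apply Rmult_le_compat_l; [ generalize (pow2_ge_0 (2 * Cmod s * t)); lra | exact He ]).
  replace (16 * Cmod s ^ 2 * exp (PI * Cmod s) * t ^ 2)
    with (4 * (2 * Cmod s * t) ^ 2 * exp (PI * Cmod s)) by ring.
  unfold Rdiv. lra.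
Qed.

(** The weight cos^n concentrates at 0: since t cos t <= sin t, an integration
    by parts bounds the second moment of the weight by its mass over n. *)
Lemma cos_power_int_concentration (s : C) :
  exists K, 0 <= K /\ forall n,
  Cmod (cos_power_int (S n) s - cos_power_int (S n) 0)%C
    <= K * / INR (S n) * Cmod (cos_power_int (S n) 0).
Proof.
  destruct (ccos2_minus_1_bound s) as [K [HK0 HK]]. exists (2 * K). split; [ lra | ]. intros n.
  pose proof PI_RGT_0 as Hpi.
  assert (HN : 0 < INR (S n)) by (apply lt_0_INR; lia).
  set (W := fun t => Re (cint (cos_power_weight (S n) 0) t)).
  assert (HW : forall t, is_derive W t (cos t ^ S n)).
  { intros t. replace (cos t ^ S n) with (Re (cos_power_weight (S n) 0 t)).
    - apply cderive_Re, cderive_cos_power_int.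
    - unfold cos_power_weight. rewrite ccos2_0_l, Cmult_1_l. reflexivity. }
  set (g := fun t => K * (/ INR (S n) * (W t - t * cos t ^ S n))).
  assert (Hg : forall t, is_derive g t (K * (t * sin t * cos t ^ n))).
  { intros t. unfold g. apply is_derive_scal.
    replace (t * sin t * cos t ^ n)
      with (/ INR (S n) * (cos t ^ S n - (1 * cos t ^ S n + t * (- INR (S n) * cos t ^ n * sin t))))
      by (field; lra).
    apply is_derive_scal. apply (is_derive_minus (V := R_NormedModule)); [ apply HW | ].
    apply (is_derive_mult (fun t => t) (fun t => cos t ^ S n));
      [ apply (@is_derive_id R_AbsRing) | apply (is_derive_cos_pow (S n)) | intros; apply Rmult_comm ]. }
  assert (H := Cmod_increment_le_real
    (fun t => cint (cos_power_weight (S n) s) t - cint (cos_power_weight (S n) 0) t)%C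
    (fun t => cos_power_weight (S n) s t - cos_power_weight (S n) 0 t)%C
    g (fun t => K * (t * sin t * cos t ^ n)) 0 (PI / 2) ltac:(lra)).
  cbv beta in H. rewrite !cint_0 in H. replace (0 - 0)%C with (RtoC 0) in H by ring.
  rewrite Cminus_0_r in H. fold (cos_power_int (S n) s) (cos_power_int (S n) 0) in H.
  eapply Rle_trans; [ apply H | ].
  - intros t. apply cderive_minus; apply cderive_cos_power_int.
  - exact Hg.
  - intros t Ht. unfold cos_power_weight. rewrite ccos2_0_l.
    replace (ccos2 s t * (cos t ^ S n)%R - 1 * (cos t ^ S n)%R)%C
      with ((ccos2 s t - 1) * (cos t ^ S n)%R)%C by ring.
    assert (Hc : 0 <= cos t) by (apply cos_ge_0; lra).
    assert (Hcn : 0 <= cos t ^ n) by now apply pow_le.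
    rewrite Cmod_mult, Cmod_R, Rabs_pos_eq by now apply pow_le.
    apply Rle_trans with (K * t ^ 2 * cos t ^ S n).
    { apply Rmult_le_compat_r; [ now apply pow_le | now apply HK ]. }
    replace (K * t ^ 2 * cos t ^ S n) with (K * (t * (t * cos t) * cos t ^ n)) by (simpl; ring).
    apply Rmult_le_compat_l; [ exact HK0 | ]. apply Rmult_le_compat_r; [ exact Hcn | ].
    apply Rmult_le_compat_l; [ lra | now apply t_cos_le_sin ].
  - unfold g, W. rewrite cint_0, cos_PI2. fold (cos_power_int (S n) 0).
    change (Re 0%C) with 0. simpl pow. rewrite Rmult_0_l, Rmult_0_r, Rmult_0_l, !Rminus_0_r, Rmult_0_r, Rmult_0_r, Rminus_0_r.
    assert (0 < / INR (S n)) by now apply Rinv_0_lt_compat.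
    generalize (Re_le_Cmod (cos_power_int (S n) 0)). intros Hr.
    replace (2 * K * / INR (S n) * Cmod (cos_power_int (S n) 0))
      with (2 * (K * (/ INR (S n) * Cmod (cos_power_int (S n) 0)))) by ring.
    apply Rmult_le_compat_l; [ lra | ]. apply Rmult_le_compat_l; [ exact HK0 | ].
    apply Rmult_le_compat_l; [ lra | exact Hr ].
Qed.

Definition sine_product (s : C) (m : nat) : C :=
  (Cpoch (1 + s) m * Cpoch (1 - s) m / (INR (fact m) * INR (fact m)))%C.

Lemma sine_product_succ (s : C) (m : nat) :
  sine_product s (S m) = (sine_product s m * ((INR (S m) ^ 2 - s ^ 2) / INR (S m) ^ 2))%C.
Proof.
  unfold sine_product.
  change (fact (S m)) with ((S m) * fact m)%nat. rewrite mult_INR, RtoC_mult.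
  change (Cpoch (1 + s) (S m)) with (Cpoch (1 + s) m * (1 + s + INR m))%C.
  change (Cpoch (1 - s) (S m)) with (Cpoch (1 - s) m * (1 - s + INR m))%C.
  assert (HS : RtoC (INR (S m)) <> 0%C) by (apply RtoC_neq_0, not_0_INR; lia).
  rewrite S_INR, RtoC_plus in *. field. split; [ exact HS | apply INR_fact_neq_0_C ].
Qed.

Lemma cos_power_int_even_neq_0 (m : nat) : cos_power_int (2 * m) 0 <> 0%C.
Proof.
  induction m as [ | m IH ].
  - simpl. rewrite cos_power_int_0_0. apply RtoC_neq_0. generalize PI_RGT_0. lra.
  - intros E. generalize (cos_power_int_rec (2 * m) 0).
    replace (2 * S m)%nat with (S (S (2 * m))) in E by lia. rewrite E, Cmult_0_r. intros H.
    apply eq_sym in H. revert H. repeat apply Cmult_neq_0; try exact IH;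
      apply RtoC_neq_0, not_0_INR; lia.
Qed.

Lemma sine_product_cos_power_int (s : C) (m : nat) :
  (PI * s * sine_product s m * cos_power_int (2 * m) s
   = Csin (PI * s) * cos_power_int (2 * m) 0)%C.
Proof.
  induction m as [ | m IH ].
  - simpl Nat.mul. unfold sine_product. simpl. rewrite cos_power_int_0_0, <- cos_power_int_0_l.
    rewrite RtoC_div by lra. field.
  - replace (2 * S m)%nat with (S (S (2 * m))) by lia.
    assert (HM : INR (S (S (2 * m))) = 2 * INR (S m)).
    { rewrite !S_INR, mult_INR. simpl. ring. }
    generalize (cos_power_int_rec (2 * m) s) (cos_power_int_rec (2 * m) 0).
    assert (HS : RtoC (INR (S m)) <> 0%C) by (apply RtoC_neq_0, not_0_INR; lia).
    rewrite sine_product_succ, HM, RtoC_mult. set (M := RtoC (INR (S m))) in *.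
    set (q := RtoC (INR (S (2 * m)))).
    set (X := cos_power_int (S (S (2 * m))) s). set (Y := cos_power_int (S (S (2 * m))) 0).
    intros H1 H2.
    replace (PI * s * (sine_product s m * ((M ^ 2 - s ^ 2) / M ^ 2)) * X)%C
      with (PI * s * sine_product s m * (((2 * M) ^ 2 - 4 * s ^ 2) * X) / (4 * M ^ 2))%C
      by (field; exact HS).
    replace (Csin (PI * s) * Y)%C
      with (Csin (PI * s) * (((2 * M) ^ 2 - 4 * 0 ^ 2) * Y) / (4 * M ^ 2))%C
      by (field; exact HS).
    rewrite H1, H2.
    replace (PI * s * sine_product s m * (2 * M * q * cos_power_int (2 * m) s))%C
      with (2 * M * q * (PI * s * sine_product s m * cos_power_int (2 * m) s))%C by ring.
    rewrite IH. field. exact HS.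
Qed.

(** The partial products of 1 / (Gamma s Gamma (1 - s)) are those of the sine
    product, and these are quotients of the integrals of cos (2 s t) cos^n t
    and of cos^n t, up to the factor sin (pi s) / pi. *)
Lemma invG_reflection (s : C) : (invG s * invG (1 - s) = Csin (PI * s) / PI)%C.
Proof.
  assert (Hpi : RtoC PI <> 0%C) by apply RtoC_neq_0, PI_neq0.
  set (ratio := fun m => (cos_power_int (2 * m) s / cos_power_int (2 * m) 0)%C).
  assert (Hratio : ctends eventually ratio 1).
  { destruct (cos_power_int_concentration s) as [K [HK0 HK]].
    apply ctends_squeeze with (fun m => K * / INR m); [ | apply filterlim_K_div_INR ].
    exists 1%nat. intros m Hm. unfold ratio.
    assert (H0 := cos_power_int_even_neq_0 m).
    replace (cos_power_int (2 * m) s / cos_power_int (2 * m) 0 - 1)%C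
      with ((cos_power_int (2 * m) s - cos_power_int (2 * m) 0) / cos_power_int (2 * m) 0)%C
      by (field; exact H0).
    rewrite Cmod_div by exact H0. apply Cmod_gt_0 in H0.
    apply Rmult_le_reg_r with (Cmod (cos_power_int (2 * m) 0)); [ exact H0 | ].
    unfold Rdiv. rewrite Rmult_assoc, Rinv_l, Rmult_1_r by lra.
    replace (2 * m)%nat with (S (2 * m - 1)) in * by lia.
    eapply Rle_trans; [ apply HK | ]. apply Rmult_le_compat_r; [ lra | ].
    apply Rmult_le_compat_l; [ exact HK0 | ]. apply Rinv_INR_decr. lia. }
  apply (ctends_unique (F := eventually) (fun m => egam m s * egam m (1 - s) * ratio m)%C); [ | ].
  - replace (invG s * invG (1 - s))%C with (invG s * invG (1 - s) * 1)%C by ring.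
    apply ctends_mult; [ | exact Hratio ].
    apply ctends_mult; [ apply egam_tends | apply egam_tends ].
  - apply ctends_ext_loc with (fun m => (1 + (1 - s) * RtoC (1 * / INR m)) * (Csin (PI * s) / PI))%C;
      [ | ].
    + exists 1%nat. intros m Hm. unfold ratio.
      assert (HM : 0 < INR m) by (apply lt_0_INR; lia).
      assert (H0 := cos_power_int_even_neq_0 m).
      replace (Csin (PI * s) / PI)%C
        with (PI * s * sine_product s m * cos_power_int (2 * m) s / cos_power_int (2 * m) 0 / PI)%C
        by (rewrite sine_product_cos_power_int; field; split; assumption).
      unfold egam, sine_product. rewrite Cpoch_succ_l, Rcpow_opp.
      replace (- (1 - s))%C with (s + - (1))%C by ring.
      rewrite Rcpow_plus, (Rcpow_opp _ 1), Rcpow_1 by exact HM.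
      change (Cpoch (1 - s) (S m)) with (Cpoch (1 - s) m * (1 - s + INR m))%C.
      replace (s + 1)%C with (1 + s)%C by ring.
      rewrite RtoC_mult, RtoC_inv by lra. field.
      repeat split; first [ exact Hpi | exact H0 | apply INR_fact_neq_0_C | apply Rcpow_pos_neq_0
                          | apply RtoC_neq_0; lra ].
    + set (L := (Csin (PI * s) / PI)%C).
      assert (EL : L = ((1 + (1 - s) * RtoC 0) * L)%C) by ring. rewrite EL at 1.
      apply ctends_mult; [ | apply ctends_const ].
      apply ctends_plus; [ apply ctends_const | ].
      apply ctends_mult; [ apply ctends_const | ].
      apply ctends_RtoC; [ apply filterlim_K_div_INR ].
Qed.

Lemma invG_neq_0 (s : C) : ~ is_integer s -> invG s <> 0%C.
Proof.
  intros Hs E. apply Hs, Csin_eq_0.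
  replace (Csin (PI * s)) with (Csin (PI * s) / PI * PI)%C
    by (field; apply RtoC_neq_0, PI_neq0).
  rewrite <- invG_reflection, E. ring.
Qed.

Lemma CGamma_eq (s : C) : ~ is_integer s -> CGamma s = (/ invG s)%C.
Proof. intros Hs. now apply CGamma_invG, invG_neq_0. Qed.

(** * Series dominated by an exponential series *)

Fixpoint exp_sum (D : R) (n : nat) : R :=
  match n with
  | O => 0
  | S n' => exp_sum D n' + D ^ n' / INR (fact n')
  end.

Lemma is_lim_seq_exp_sum (D : R) : is_lim_seq (exp_sum D) (exp D).
Proof.
  apply is_lim_seq_incr_1.
  apply is_lim_seq_ext with (fun n => sum_n (fun k => / INR (fact k) * D ^ k) n).
  - intros n. induction n as [ | n IH ].
    + rewrite sum_O. simpl. field.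
    + rewrite sum_Sn, IH. change (exp_sum D (S (S n))) with (exp_sum D (S n) + D ^ S n / INR (fact (S n))).
      unfold plus. simpl AbelianMonoid.plus. unfold Rdiv. rewrite (Rmult_comm (D ^ S n)). reflexivity.
  - generalize (is_exp_Reals D). intros Hs. apply is_pseries_R in Hs. exact Hs.
Qed.

Lemma filterlim_exp_tail (K D : R) :
  filterlim (fun n => K * (exp D - exp_sum D n)) eventually (locally 0).
Proof.
  assert (H := is_lim_seq_scal_l _ K _
    (is_lim_seq_minus' _ _ _ _ (is_lim_seq_const (exp D)) (is_lim_seq_exp_sum D))).
  rewrite Rminus_diag in H. simpl in H. rewrite Rmult_0_r in H. exact H.
Qed.

Lemma exp_sum_le_exp (D : R) (n : nat) : 0 <= D -> exp_sum D n <= exp D.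
Proof.
  intros HD. apply (is_lim_seq_incr_compare (exp_sum D) (exp D)); [ apply is_lim_seq_exp_sum | ].
  intros k. simpl. assert (0 <= D ^ k / INR (fact k)); [ | lra ].
  apply Rmult_le_pos; [ now apply pow_le | left; apply Rinv_0_lt_compat, INR_fact_lt_0 ].
Qed.

Definition fact_bounded (a : nat -> C) (K D : R) : Prop :=
  forall k, Cmod (a k) <= K * (D ^ k / INR (fact k)).

Lemma csum_increment_le (a : nat -> C) (K D : R) (n m : nat) :
  fact_bounded a K D -> (n <= m)%nat ->
  Cmod (csum a m - csum a n)%C <= K * (exp_sum D m - exp_sum D n).
Proof.
  intros H Hnm. induction Hnm as [ | m Hnm IH ].
  - replace (csum a n - csum a n)%C with (RtoC 0) by ring. rewrite Cmod_0. lra.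
  - simpl. replace (csum a m + a m - csum a n)%C with ((csum a m - csum a n) + a m)%C by ring.
    eapply Rle_trans; [ apply Cmod_triangle | ]. generalize (H m). lra.
Qed.

Lemma sum_n_csum (a : nat -> C) (n : nat) : sum_n a n = csum a (S n).
Proof.
  induction n as [ | n IH ].
  - rewrite sum_O. simpl. ring.
  - rewrite sum_Sn, IH. reflexivity.
Qed.

Lemma CSeries_tends (a : nat -> C) (K D : R) :
  0 <= K -> 0 <= D -> fact_bounded a K D -> ctends eventually (csum a) (CSeries a).
Proof.
  intros HK HD H.
  destruct (@ex_series_le C_AbsRing C_CompleteNormedModule a
    (fun k => K * (/ INR (fact k) * D ^ k))) as [l Hl].
  - intros k. change (Cmod (a k) <= K * (/ INR (fact k) * D ^ k)).
    rewrite (Rmult_comm (/ INR (fact k))). apply H.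
  - apply (ex_series_scal_l (V := R_NormedModule) K). exists (exp D). apply is_pseries_R, is_exp_Reals.
  - replace (CSeries a) with l.
    + assert (Hl' := filterlim_ctends _ _ Hl). intros eps He.
      destruct (Hl' eps He) as [N HN]. exists (S N). intros [ | n] Hn; [ lia | ].
      rewrite <- sum_n_csum. apply HN. lia.
    + symmetry. apply (@iota_filterlim_locally C_AbsRing C_CompleteNormedModule nat eventually);
        [ apply Proper_StrongProper, eventually_filter | exact Hl ].
Qed.

Lemma CSeries_tail_le (a : nat -> C) (K D : R) (n : nat) :
  0 <= K -> 0 <= D -> fact_bounded a K D ->
  Cmod (csum a n - CSeries a)%C <= K * (exp D - exp_sum D n).
Proof.
  intros HK HD H. rewrite Cmod_sub_sym.
  apply (ctends_bound (F := eventually) (fun m => csum a m - csum a n)%C).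
  - exists n. intros m Hm. eapply Rle_trans; [ apply (csum_increment_le a K D); assumption | ].
    apply Rmult_le_compat_l; [ exact HK | ]. generalize (exp_sum_le_exp D m HD). lra.
  - apply ctends_minus; [ now apply CSeries_tends with K D | ].
    apply ctends_const.
Qed.

Lemma Cmod_CSeries_le (a : nat -> C) (K D : R) :
  0 <= K -> 0 <= D -> fact_bounded a K D -> Cmod (CSeries a) <= K * exp D.
Proof.
  intros HK HD H. generalize (CSeries_tail_le a K D 0 HK HD H). simpl.
  rewrite Cmod_sub_sym, Cminus_0_r, Rminus_0_r. auto.
Qed.

Lemma Cmod_csum_le_exp (a : nat -> C) (K D : R) (n : nat) :
  0 <= K -> 0 <= D -> fact_bounded a K D -> Cmod (csum a n) <= K * exp D.
Proof.
  intros HK HD H. generalize (csum_increment_le a K D 0 n H ltac:(lia)). simpl.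
  rewrite Cminus_0_r, Rminus_0_r. intros H1. eapply Rle_trans; [ exact H1 | ].
  apply Rmult_le_compat_l; [ exact HK | now apply exp_sum_le_exp ].
Qed.

Lemma ctends_csum {T : Type} {F : (T -> Prop) -> Prop} {FF : Filter F} (a : T -> nat -> C) (b : nat -> C) (p : nat) :
  (forall k, ctends F (fun n => a n k) (b k)) ->
  ctends F (fun n => csum (a n) p) (csum b p).
Proof.
  intros H. induction p as [ | p IH ]; simpl.
  - now apply ctends_const.
  - now apply ctends_plus.
Qed.

Lemma tannery {T : Type} {F : (T -> Prop) -> Prop} {FF : Filter F} (a : T -> nat -> C) (b : nat -> C) (K D : R) :
  0 <= K -> 0 <= D ->
  F (fun n => fact_bounded (a n) K D) -> fact_bounded b K D ->
  (forall k, ctends F (fun n => a n k) (b k)) ->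
  ctends F (fun n => CSeries (a n)) (CSeries b).
Proof.
  intros HK HD Ha Hb H.
  apply (ctends_interchange (F := F) (G := eventually) (fun n p => csum (a n) p) _ (csum b) _
    (fun p => K * (exp D - exp_sum D p))).
  - exists 0%nat. intros p _. revert Ha. apply filter_imp. intros n Hn. now apply CSeries_tail_le.
  - apply filterlim_exp_tail.
  - exists 0%nat. intros p _. now apply ctends_csum.
  - now apply CSeries_tends with K D.
Qed.

Lemma Hol_CSeries (r : R) (a : C -> nat -> C) (K D : R) :
  0 <= K -> 0 <= D -> (forall m, Cmod m <= r -> fact_bounded (a m) K D) ->
  (forall k, Hol r (fun m => a m k)) -> Hol r (fun m => CSeries (a m)).
Proof.
  intros HK HD H HH. apply Hol_uniform_limit. intros eps He.
  destruct (proj1 (filterlim_locally _ _) (filterlim_exp_tail K D) (mkposreal _ He)) as [N HN].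
  exists (fun m => csum (a m) N). split; [ now apply Hol_csum | ]. intros m Hm.
  rewrite Cmod_sub_sym. eapply Rle_trans; [ apply (CSeries_tail_le (a m) K D); auto | ].
  specialize (HN N (Nat.le_refl N)).
  change (Rabs (K * (exp D - exp_sum D N) - 0) < eps) in HN. apply Rabs_def2 in HN. lra.
Qed.

Lemma CSeries_ext (a b : nat -> C) : (forall k, a k = b k) -> CSeries a = CSeries b.
Proof. intros H. f_equal. apply functional_extensionality, H. Qed.

Lemma fact_bounded_mult (c : C) (a : nat -> C) (K D : R) :
  fact_bounded a K D -> fact_bounded (fun k => c * a k)%C (Cmod c * K) D.
Proof.
  intros H k. rewrite Cmod_mult, Rmult_assoc. apply Rmult_le_compat_l; [ apply Cmod_ge_0 | apply H ].
Qed.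

Lemma CSeries_mult (c : C) (a : nat -> C) (K D : R) :
  0 <= K -> 0 <= D -> fact_bounded a K D ->
  CSeries (fun k => c * a k)%C = (c * CSeries a)%C.
Proof.
  intros HK HD H.
  apply (ctends_unique (F := eventually) (csum (fun k => c * a k)%C)); [ | ].
  - apply CSeries_tends with (Cmod c * K) D; [ | exact HD | now apply fact_bounded_mult ].
    apply Rmult_le_pos; [ apply Cmod_ge_0 | exact HK ].
  - apply ctends_ext with (fun n => c * csum a n)%C; [ intros n; symmetry; apply csum_mult | ].
    apply ctends_mult; [ apply ctends_const | now apply CSeries_tends with K D ].
Qed.

(** * Odd parts of confluent series *)

(** In the variable [t], the logarithm of the argument, the Whittaker and the
    Bessel functions below are differences of values at [- m] and [m] of a
    series of this shape, and a derivative in [t] only raises [j]. *)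
Definition cterm (q : nat -> C -> C) (j : nat) (m : C) (t : R) (k : nat) : C :=
  (q k m * (INR k + m) ^ j * Cexp ((INR k + m) * t) * invG (INR k + 1 + 2 * m) / INR (fact k))%C.

Definition cser (g : C -> C) (q : nat -> C -> C) (j : nat) (m : C) (t : R) : C :=
  (g m * CSeries (cterm q j m t))%C.

Definition odd_quot (g : C -> C) (q : nat -> C -> C) (j : nat) (t : R) (m : C) : C :=
  (PI / Csin (2 * PI * m) * (cser g q j (- m) t - cser g q j m t))%C.

Definition oddser (g : C -> C) (q : nat -> C -> C) (j : nat) (mu : C) (t : R) : C :=
  if Ceq_dec mu 0 then Clim (locally' (RtoC 0)) (odd_quot g q j t) else odd_quot g q j t mu.

(** The values of the parameter that matter for [mu]: the two points [mu] and
    [- mu], or, where a limit defines the functions, a disc around 0. *)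
Definition around (mu : C) (r : R) (m : C) : Prop :=
  (mu <> 0%C /\ (m = mu \/ m = (- mu)%C)) \/ (mu = 0%C /\ Cmod m <= r).

(** Keeps the arguments 1 + 2 m + i uniformly away from 0, which makes
    1 / Gamma (k + 1 + 2 m) decay like 1 / k! up to a geometric factor. *)
Definition gamma_regular (U : C -> Prop) : Prop :=
  exists rho delta : R, 0 <= rho /\ 0 < delta /\
  forall m : C, U m -> U (- m)%C /\ Cmod m <= rho /\
    forall i : nat, delta * (INR i + 1) <= Cmod (1 + 2 * m + INR i)%C.

(** The constants are kept explicit because they have to be common to all [N]. *)
Definition bounded_data (U : C -> Prop) (g : C -> C) (q : nat -> C -> C) (G Q : R) : Prop :=
  0 <= G /\ 0 <= Q /\
  forall m : C, U m -> Cmod (g m) <= G /\ forall k, Cmod (q k m) <= Q ^ k * INR (fact k).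

Lemma gamma_regular_around (mu : C) (r : R) :
  Rabs (2 * Re mu) < 1 -> 0 <= r <= / 4 ->
  gamma_regular (around mu r).
Proof.
  intros Hmu Hr. exists (Cmod mu + r), (Rmin (1 - Rabs (2 * Re mu)) (/ 2)).
  assert (Hc := Cmod_ge_0 mu).
  assert (H1 := Rmin_l (1 - Rabs (2 * Re mu)) (/ 2)).
  assert (H2 := Rmin_r (1 - Rabs (2 * Re mu)) (/ 2)).
  split; [ lra | split; [ apply Rmin_pos; lra | ] ].
  set (d := Rmin (1 - Rabs (2 * Re mu)) (/ 2)) in *.
  intros m Hm. split; [ | split ].
  - destruct Hm as [[Hm0 [-> | ->]] | [Hm0 Hm]].
    + left. auto.
    + left. split; [ exact Hm0 | ]. left. ring.
    + right. now rewrite Cmod_opp.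
  - destruct Hm as [[Hm0 [-> | ->]] | [Hm0 Hm]]; rewrite ?Cmod_opp; lra.
  - intros i. assert (Hi := pos_INR i).
    assert (P : Rabs (2 * Re m) <= 1 - d -> d * (INR i + 1) <= Cmod (1 + 2 * m + INR i)%C).
    { intros H. eapply Rle_trans; [ | apply Re_le_Cmod ].
      replace (Re (1 + 2 * m + INR i)%C) with (1 + 2 * Re m + INR i) by (cbn; unfold Re; ring).
      generalize (Rle_abs (- (2 * Re m))). rewrite Rabs_Ropp. nra. }
    apply P. destruct Hm as [[Hm0 [-> | ->]] | [Hm0 Hm]].
    + lra.
    + replace (2 * Re (- mu)%C) with (- (2 * Re mu)) by (cbn; unfold Re; ring).
      rewrite Rabs_Ropp. lra.
    + rewrite Rabs_mult, (Rabs_pos_eq 2) by lra. generalize (re_le_Cmod m). lra.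
Qed.

Lemma Cmod_Cpoch_ge (s : C) (delta : R) (k : nat) :
  0 < delta -> (forall i, delta * (INR i + 1) <= Cmod (s + INR i)%C) ->
  delta ^ k * INR (fact k) <= Cmod (Cpoch s k).
Proof.
  intros Hd H. induction k as [ | k IH ].
  - simpl. rewrite Cmod_1. lra.
  - change (Cpoch s (S k)) with (Cpoch s k * (s + INR k))%C.
    change (fact (S k)) with (S k * fact k)%nat. rewrite mult_INR, Cmod_mult, S_INR.
    replace (delta ^ S k * ((INR k + 1) * INR (fact k)))
      with ((delta ^ k * INR (fact k)) * (delta * (INR k + 1))) by (simpl; ring).
    apply Rmult_le_compat; [ | | exact IH | apply H ].
    + apply Rmult_le_pos; [ apply pow_le; lra | apply pos_INR ].
    + apply Rmult_le_pos; [ lra | generalize (pos_INR k); lra ].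
Qed.

Lemma gamma_regular_opp (U : C -> Prop) (m : C) : gamma_regular U -> U m -> U (- m)%C.
Proof. intros [rho [delta [_ [_ H]]]] Hm. now apply H. Qed.

Lemma invG_decay (U : C -> Prop) :
  gamma_regular U ->
  exists K L, 0 <= K /\ 0 <= L /\ forall m : C, U m ->
    fact_bounded (fun k => invG (INR k + 1 + 2 * m)) K L.
Proof.
  intros [rho [delta [Hrho [Hd HS]]]].
  destruct (invG_bounded (1 + 2 * rho)) as [K [HK0 HK]]; [ lra | ].
  exists K, (/ delta).
  split; [ exact HK0 | split; [ left; now apply Rinv_0_lt_compat | ] ]. intros m Hm k.
  destruct (HS m Hm) as [_ [Hm1 Hm2]].
  assert (Hs : Cmod (1 + 2 * m)%C <= 1 + 2 * rho).
  { eapply Rle_trans; [ apply Cmod_triangle | ]. rewrite Cmod_1, Cmod_mult, Cmod_R, Rabs_pos_eq; lra. }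
  assert (HP := Cmod_Cpoch_ge (1 + 2 * m)%C delta k Hd Hm2).
  assert (HQ : 0 < delta ^ k * INR (fact k))
    by (apply Rmult_lt_0_compat; [ now apply pow_lt | apply INR_fact_lt_0 ]).
  generalize (HK _ Hs). rewrite (invG_shift (1 + 2 * m) k), Cmod_mult.
  replace (1 + 2 * m + INR k)%C with (INR k + 1 + 2 * m)%C by ring. intros H.
  rewrite pow_inv. apply Rmult_le_reg_r with (delta ^ k * INR (fact k)); [ exact HQ | ].
  replace (K * (/ delta ^ k / INR (fact k)) * (delta ^ k * INR (fact k))) with K
    by (field; split; first [ apply INR_fact_neq_0 | apply pow_nonzero; lra ]).
  eapply Rle_trans; [ | exact H ]. rewrite Rmult_comm. apply Rmult_le_compat_r; [ apply Cmod_ge_0 | exact HP ].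
Qed.

Lemma INR_succ_le_pow2 (k : nat) : INR k + 1 <= 2 ^ k.
Proof.
  induction k as [ | k IH ]; [ simpl; lra | ]. rewrite S_INR. simpl.
  generalize (pos_INR k). lra.
Qed.

Lemma cterm_bounded (U : C -> Prop) (Q tau : R) (j : nat) :
  gamma_regular U -> 0 <= Q -> 0 <= tau ->
  exists K D, 0 <= K /\ 0 <= D /\
  forall (q : nat -> C -> C) (m : C) (t : R), U m ->
    (forall k, Cmod (q k m) <= Q ^ k * INR (fact k)) -> Rabs t <= tau ->
    fact_bounded (cterm q j m t) K D.
Proof.
  intros HS HQ Htau. destruct (invG_decay U HS) as [K0 [L [HK0 [HL HK]]]].
  destruct HS as [rho [delta [Hrho [_ HS]]]].
  assert (H2j : 0 < 2 ^ j) by (apply pow_lt; lra).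
  exists (K0 * (1 + rho) ^ j * exp (rho * tau)), (Q * L * 2 ^ j * exp tau).
  split; [ | split ].
  { apply Rmult_le_pos; [ apply Rmult_le_pos; [ exact HK0 | apply pow_le; lra ] | left; apply exp_pos ]. }
  { repeat apply Rmult_le_pos; try lra. left; apply exp_pos. }
  intros q m t Hm Hq Ht k. destruct (HS m Hm) as [_ [Hm1 _]]. specialize (HK m Hm k). specialize (Hq k).
  assert (Hk := pos_INR k).
  unfold cterm. rewrite Cmod_div by apply INR_fact_neq_0_C.
  rewrite !Cmod_mult, Cmod_pow, (Cmod_R (INR (fact k))), (Rabs_pos_eq (INR (fact k))) by apply pos_INR.
  assert (Hf := INR_fact_lt_0 k).
  assert (Hkm : Cmod (INR k + m)%C <= INR k + rho).
  { eapply Rle_trans; [ apply Cmod_triangle | ]. rewrite Cmod_R, Rabs_pos_eq; lra. }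
  assert (B1 : Cmod (INR k + m)%C ^ j <= (1 + rho) ^ j * (2 ^ j) ^ k).
  { rewrite <- pow_mult, (Nat.mul_comm j k), pow_mult, <- Rpow_mult_distr.
    apply pow_incr. split; [ apply Cmod_ge_0 | ]. generalize (INR_succ_le_pow2 k). nra. }
  assert (B2 : Cmod (Cexp ((INR k + m) * t)) <= exp tau ^ k * exp (rho * tau)).
  { eapply Rle_trans; [ apply Cmod_Cexp_le | ].
    replace (exp tau ^ k * exp (rho * tau)) with (exp ((INR k + rho) * tau)).
    - apply exp_le. rewrite Cmod_mult, Cmod_R.
      apply Rmult_le_compat; [ apply Cmod_ge_0 | apply Rabs_pos | exact Hkm | exact Ht ].
    - rewrite Rmult_plus_distr_r, exp_plus. f_equal.
      rewrite <- (exp_ln (exp tau ^ k)) by (apply pow_lt, exp_pos).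
      rewrite ln_pow, ln_exp by apply exp_pos. reflexivity. }
  rewrite !Rpow_mult_distr. unfold Rdiv. rewrite <- !Rmult_assoc.
  apply Rmult_le_compat_r; [ left; now apply Rinv_0_lt_compat | ].
  replace (K0 * (1 + rho) ^ j * exp (rho * tau) * Q ^ k * L ^ k * (2 ^ j) ^ k * exp tau ^ k)
    with ((Q ^ k * INR (fact k)) * ((1 + rho) ^ j * (2 ^ j) ^ k) * (exp tau ^ k * exp (rho * tau))
          * (K0 * (L ^ k / INR (fact k))))
    by (field; apply INR_fact_neq_0).
  repeat apply Rmult_le_compat; try apply Cmod_ge_0; try assumption;
    repeat apply Rmult_le_pos; try apply Cmod_ge_0; try (apply pow_le, Cmod_ge_0).
Qed.

Lemma cser_bounded (U : C -> Prop) (G Q tau : R) (j : nat) :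
  gamma_regular U -> 0 <= G -> 0 <= Q -> 0 <= tau ->
  exists M, 0 <= M /\ forall g q, bounded_data U g q G Q -> forall (m : C) (t : R),
    U m -> Rabs t <= tau -> Cmod (cser g q j m t) <= M.
Proof.
  intros HS HG HQ Htau. destruct (cterm_bounded U Q tau j HS HQ Htau) as [K [D [HK [HD H]]]].
  exists (G * (K * exp D)). split.
  { apply Rmult_le_pos; [ exact HG | apply Rmult_le_pos; [ exact HK | left; apply exp_pos ] ]. }
  intros g q [_ [_ Hd]] m t Hm Ht. destruct (Hd m Hm) as [Hg Hq].
  unfold cser. rewrite Cmod_mult. apply Rmult_le_compat; try apply Cmod_ge_0; [ exact Hg | ].
  apply Cmod_CSeries_le; auto.
Qed.

Lemma cderive_cterm (q : nat -> C -> C) (j : nat) (m : C) (t : R) (k : nat) :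
  cderive (fun t => cterm q j m t k) t (cterm q (S j) m t k).
Proof.
  eapply cderive_value; [ | eapply cderive_ext; [ |
    apply (cderive_cmult (q k m * (INR k + m) ^ j * invG (INR k + 1 + 2 * m) / INR (fact k))%C),
    (cderive_Cexp (INR k + m)%C) ] ].
  - unfold cterm. change ((INR k + m) ^ S j)%C with ((INR k + m) * (INR k + m) ^ j)%C.
    set (p := ((INR k + m) ^ j)%C). unfold Cdiv. ring.
  - intros y. unfold cterm, Cdiv. set (p := ((INR k + m) ^ j)%C). ring.
Qed.

Lemma cderive_csum (f df : R -> nat -> C) (t : R) (n : nat) :
  (forall k, cderive (fun t => f t k) t (df t k)) ->
  cderive (fun t => csum (f t) n) t (csum (df t) n).
Proof.
  intros H. induction n as [ | n IH ]; simpl; [ apply cderive_const | now apply cderive_plus ].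
Qed.

Lemma cderive_cser (U : C -> Prop) (G Q : R) (g : C -> C) (q : nat -> C -> C)
  (j : nat) (m : C) (t : R) :
  gamma_regular U -> bounded_data U g q G Q -> U m ->
  cderive (cser g q j m) t (cser g q (S j) m t).
Proof.
  intros HS [HG [HQ Hd]] Hm. destruct (Hd m Hm) as [_ Hq]. apply cderive_cmult.
  assert (Htau : 0 <= Rabs t + 1) by (generalize (Rabs_pos t); lra).
  assert (Hty : forall y, Rabs (y - t) <= 1 -> Rabs y <= Rabs t + 1).
  { intros y Hy. generalize (Rabs_triang (y - t) t). replace (y - t + t) with y by ring. lra. }
  assert (B := fun j => cterm_bounded U Q (Rabs t + 1) j HS HQ Htau).
  assert (Ht : forall j y, Rabs (y - t) <= 1 ->
    ctends eventually (csum (cterm q j m y)) (CSeries (cterm q j m y))).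
  { intros i y Hy. destruct (B i) as [K [D [HK [HD H]]]].
    apply CSeries_tends with K D; auto. }
  destruct (B (S (S j))) as [K [D [HK [HD H]]]].
  apply (cderive_limit (F := eventually) (fun n y => csum (cterm q j m y) n)
    (fun n y => csum (cterm q (S j) m y) n)
    (fun n y => csum (cterm q (S (S j)) m y) n) _ t (K * exp D)).
  - exists 0%nat. intros n _ y Hy. split; [ | split ].
    + apply cderive_csum. intros k. apply cderive_cterm.
    + apply cderive_csum. intros k. apply cderive_cterm.
    + apply Cmod_csum_le_exp; auto.
  - intros y Hy. now apply Ht.
  - apply Ht. replace (t - t) with 0 by ring. rewrite Rabs_R0. lra.
Qed.

Lemma Hol_cser (U : C -> Prop) (G Q r : R) (g : C -> C) (q : nat -> C -> C)
  (j : nat) (t : R) :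
  gamma_regular U -> bounded_data U g q G Q -> 0 <= r ->
  (forall m, Cmod m <= r -> U m) -> Hol r g -> (forall k, Hol r (q k)) ->
  Hol r (fun m => cser g q j m t).
Proof.
  intros HS [HG [HQ Hd]] Hr HSr Hg Hq. apply Hol_mult; [ exact Hr | exact Hg | ].
  destruct (cterm_bounded U Q (Rabs t) j HS HQ (Rabs_pos t)) as [K [D [HK [HD H]]]].
  apply (Hol_CSeries r (fun m => cterm q j m t) K D HK HD).
  - intros m Hm. apply H; [ now apply HSr | apply Hd; now apply HSr | lra ].
  - intros k. unfold cterm. unfold Cdiv.
    apply Hol_mult; [ exact Hr | | apply Hol_const ].
    apply Hol_mult; [ exact Hr | | now apply Hol_invG ].
    apply Hol_mult; [ exact Hr | | ].
    + apply Hol_mult; [ exact Hr | apply Hq | apply Hol_pow; [ exact Hr | ] ].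
      apply Hol_plus; [ apply Hol_const | apply Hol_id ].
    + apply Hol_ext with (fun m => Cexp (INR k * t) * Cexp (m * t))%C.
      * intros m _. rewrite <- Cexp_plus. f_equal. ring.
      * apply Hol_mult; [ exact Hr | apply Hol_const | now apply Hol_Cexp ].
Qed.

Lemma cser_tends {T : Type} {F : (T -> Prop) -> Prop} {FF : Filter F} (U : C -> Prop) (G Q : R)
  (gn : T -> C -> C) (qn : T -> nat -> C -> C) (g : C -> C) (q : nat -> C -> C)
  (j : nat) (m : C) (t : R) :
  gamma_regular U ->
  F (fun n => bounded_data U (gn n) (qn n) G Q) -> bounded_data U g q G Q -> U m ->
  ctends F (fun n => gn n m) (g m) -> (forall k, ctends F (fun n => qn n k m) (q k m)) ->
  ctends F (fun n => cser (gn n) (qn n) j m t) (cser g q j m t).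
Proof.
  intros HS Hn [HG [HQ Hd]] Hm Hg Hq. apply ctends_mult; [ exact Hg | ].
  destruct (cterm_bounded U Q (Rabs t) j HS HQ (Rabs_pos t)) as [K [D [HK [HD H]]]].
  apply (tannery (F := F) (fun n => cterm (qn n) j m t) (cterm q j m t) K D HK HD).
  - revert Hn. apply filter_imp. intros n [_ [_ Hn]]. apply H; [ exact Hm | now apply Hn | lra ].
  - apply H; [ exact Hm | now apply Hd | lra ].
  - intros k. unfold cterm, Cdiv.
    repeat (apply ctends_mult; [ | apply ctends_const ]). apply Hq.
Qed.

(** What the limit at [mu = 0] requires beyond bounds. *)
Definition regular (mu : C) (r : R) (g : C -> C) (q : nat -> C -> C) (G Q : R) : Prop :=
  bounded_data (around mu r) g q G Q /\
  (mu = 0%C -> Hol r g /\ forall k, Hol r (q k)).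

Lemma oddser_0 (g : C -> C) (q : nat -> C -> C) (j : nat) (t : R) :
  oddser g q j 0 t = Clim (locally' (RtoC 0)) (odd_quot g q j t).
Proof. unfold oddser. destruct (Ceq_dec 0 0) as [_ | n]; [ reflexivity | now destruct n ]. Qed.

Lemma oddser_neq_0 (g : C -> C) (q : nat -> C -> C) (j : nat) (mu : C) (t : R) :
  mu <> 0%C -> oddser g q j mu t = odd_quot g q j t mu.
Proof. intros H. unfold oddser. destruct (Ceq_dec mu 0) as [e | _]; [ contradiction | reflexivity ]. Qed.

(** Difference quotient at 0 of an odd function of [m]; it carries the limit
    [m -> 0] of [odd_quot]. *)
Definition increment_quot (g : C -> C) (q : nat -> C -> C) (j : nat) (t : R) (m : C) : C :=
  ((cser g q j (- m) t - cser g q j m t) / m)%C.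

Lemma odd_quot_increment_quot (g : C -> C) (q : nat -> C -> C) (j : nat) (t : R) (m : C) :
  m <> 0%C -> odd_quot g q j t m = (PI * m / Csin (2 * PI * m) * increment_quot g q j t m)%C.
Proof.
  intros Hm. unfold odd_quot, increment_quot, Cdiv.
  replace (PI * m * / Csin (2 * PI * m) * ((cser g q j (- m) t - cser g q j m t) * / m))%C
    with ((m * / m) * (PI * / Csin (2 * PI * m) * (cser g q j (- m) t - cser g q j m t)))%C by ring.
  rewrite Cinv_r by exact Hm. ring.
Qed.

(** [M] is chosen before [g] and [q]: the rate of convergence as [m] tends to 0
    is the same for all data with the same bounds. *)
Lemma increment_quot_bounds (r G Q tau : R) (j : nat) :
  0 < r -> gamma_regular (around 0 r) -> 0 <= G -> 0 <= Q -> 0 <= tau ->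
  exists M, 0 <= M /\ forall g q, regular 0 r g q G Q -> forall t, Rabs t <= tau ->
  (forall m : C, m <> 0%C -> Cmod m <= r / 2 ->
     Cmod (increment_quot g q j t m) <= M /\
     Cmod (increment_quot g q j t m - 2 * oddser g q j 0 t)%C <= M * Cmod m) /\
  ctends (locally' (RtoC 0)) (odd_quot g q j t) (oddser g q j 0 t).
Proof.
  intros Hr HS HG HQ Htau.
  destruct (cser_bounded _ G Q tau j HS HG HQ Htau) as [M [HM HMb]].
  set (M1 := 2 * (2 * M) / r). set (M2 := 2 * (2 * M) / r ^ 2).
  assert (Hr2 : 0 < r ^ 2) by now apply pow_lt.
  assert (HM1 : 0 <= M1) by (apply Rmult_le_pos; [ lra | left; now apply Rinv_0_lt_compat ]).
  assert (HM2 : 0 <= M2) by (apply Rmult_le_pos; [ lra | left; now apply Rinv_0_lt_compat ]).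
  exists (M1 + M2). split; [ lra | ]. intros g q [Hb Hh] t Ht.
  destruct (Hh eq_refl) as [Hg Hq].
  assert (Hin : forall m, Cmod m <= r -> around 0 r m) by (intros m Hm; now right).
  set (E := fun m => (cser g q j (- m) t - cser g q j m t)%C).
  assert (HE : Hol r E).
  { assert (HC : Hol r (fun m => cser g q j m t)) by (apply (Hol_cser (around 0 r) G Q); auto; lra).
    apply (Hol_plus r _ (fun m => - cser g q j m t)%C).
    - apply (Hol_comp_opp r (fun m => cser g q j m t)), HC.
    - apply Hol_opp; [ lra | exact HC ]. }
  assert (HEM : forall m, Cmod m <= r -> Cmod (E m) <= 2 * M).
  { intros m Hm. unfold E. eapply Rle_trans; [ apply Cmod_minus_le | ].
    assert (H1 := HMb g q Hb m t (Hin m Hm) Ht).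
    assert (H2 : Cmod (- m)%C <= r) by now rewrite Cmod_opp.
    assert (H3 := HMb g q Hb (- m)%C t (Hin _ H2) Ht). lra. }
  assert (HE0 : E 0%C = 0%C) by (unfold E; replace (- 0)%C with (RtoC 0) by ring; ring).
  destruct (Hol_difference_quotient r (2 * M) E Hr HE HEM HE0) as [H1 [g0 H2]].
  assert (HT : ctends (locally' (RtoC 0)) (increment_quot g q j t) g0).
  { apply ctends_squeeze with (fun m => M2 * Cmod m);
      [ | apply filterlim_Cmod_0 ].
    apply locally'_0_intro with (r / 2); [ lra | ]. exact H2. }
  assert (HT2 : ctends (locally' (RtoC 0)) (odd_quot g q j t) (/ 2 * g0)%C).
  { apply ctends_ext_loc with (fun m => PI * m / Csin (2 * PI * m) * increment_quot g q j t m)%C.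
    - apply locally'_0_intro with 1; [ lra | ]. intros m Hm _. symmetry.
      now apply odd_quot_increment_quot.
    - apply ctends_mult; [ apply ctends_pi_div_sin | exact HT ]. }
  assert (EO : oddser g q j 0 t = (/ 2 * g0)%C)
    by (rewrite oddser_0; apply Clim_eq; [ exact HT2 ]).
  split; [ | rewrite EO; exact HT2 ].
  intros m Hm0 Hm. split.
  - eapply Rle_trans; [ apply (H1 m Hm0 Hm) | ]. fold M1. lra.
  - rewrite EO. replace (2 * (/ 2 * g0))%C with g0 by field.
    eapply Rle_trans; [ apply (H2 m Hm0 Hm) | ]. fold M2. generalize (Cmod_ge_0 m). nra.
Qed.

Lemma oddser_limit_0 (r G Q : R) (g : C -> C) (q : nat -> C -> C) (j : nat) (t : R) :
  0 < r -> gamma_regular (around 0 r) -> regular 0 r g q G Q ->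
  ctends (locally' (RtoC 0)) (odd_quot g q j t) (oddser g q j 0 t).
Proof.
  intros Hr HS Hreg. pose proof Hreg as [[HG [HQ _]] _].
  destruct (increment_quot_bounds r G Q (Rabs t) j Hr HS HG HQ (Rabs_pos t)) as [M [_ H]].
  apply (H g q Hreg t). lra.
Qed.

Lemma around_self (mu : C) (r : R) : mu <> 0%C -> around mu r mu /\ around mu r (- mu)%C.
Proof. intros H. split; left; auto. Qed.

Lemma cderive_odd_quot (U : C -> Prop) (G Q : R) (g : C -> C) (q : nat -> C -> C)
  (j : nat) (m : C) (t : R) :
  gamma_regular U -> bounded_data U g q G Q -> U m ->
  cderive (fun t => odd_quot g q j t m) t (odd_quot g q (S j) t m).
Proof.
  intros HS Hb Hm. apply cderive_cmult. apply cderive_minus.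
  - apply (cderive_cser U G Q); auto. now apply gamma_regular_opp.
  - now apply (cderive_cser U G Q).
Qed.

Lemma cderive_oddser (mu : C) (r G Q : R) (g : C -> C) (q : nat -> C -> C)
  (j : nat) (t : R) :
  0 < r -> gamma_regular (around mu r) -> regular mu r g q G Q ->
  cderive (oddser g q j mu) t (oddser g q (S j) mu t).
Proof.
  intros Hr HS Hreg. destruct (Ceq_dec mu 0) as [-> | Hmu].
  - pose proof Hreg as [Hb _]. pose proof Hb as [HG [HQ _]].
    assert (Htau : 0 <= Rabs t + 1) by (generalize (Rabs_pos t); lra).
    destruct (increment_quot_bounds r G Q (Rabs t + 1) (S (S j)) Hr HS HG HQ Htau)
      as [M [HM H]].
    apply (cderive_limit (F := (locally' (RtoC 0))) (fun m y => odd_quot g q j y m)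
      (fun m y => odd_quot g q (S j) y m)
      (fun m y => odd_quot g q (S (S j)) y m) _ t ((Cmod (/ 2)%C + 1) * M)).
    + assert (H0 : locally' (RtoC 0) (fun m : C => m <> RtoC 0 /\ Cmod m <= r / 2))
        by (apply locally'_0_intro with (r / 2); [ lra | auto ]).
      generalize (filter_and _ _ H0 (ctends_bounded _ _ ctends_pi_div_sin)).
      apply filter_imp. intros m [[Hm0 Hm] Hk] y Hy.
      assert (Hin : around 0 r m) by (right; split; [ reflexivity | lra ]).
      split; [ | split ]; try now apply (cderive_odd_quot (around 0 r) G Q).
      rewrite odd_quot_increment_quot, Cmod_mult by exact Hm0.
      apply Rmult_le_compat; try apply Cmod_ge_0; [ exact Hk | ].
      apply (H g q Hreg y); [ | exact Hm0 | exact Hm ].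
      generalize (Rabs_triang (y - t) t). replace (y - t + t) with y by ring. lra.
    + intros y _. now apply (oddser_limit_0 r G Q).
    + now apply (oddser_limit_0 r G Q).
  - rewrite oddser_neq_0 by exact Hmu.
    apply cderive_ext with (fun t => odd_quot g q j t mu);
      [ intros y; symmetry; now apply oddser_neq_0 | ].
    apply (cderive_odd_quot (around mu r) G Q); [ exact HS | apply Hreg | now apply around_self ].
Qed.

(** At [mu = 0] the limits in [n] and in [m] are exchanged by means of the
    common rate of [increment_quot_bounds]; elsewhere this is termwise
    convergence of dominated series. *)
Lemma oddser_tends {T : Type} {F : (T -> Prop) -> Prop} {FF : Filter F} (mu : C) (r G Q : R)
  (gn : T -> C -> C) (qn : T -> nat -> C -> C) (g : C -> C) (q : nat -> C -> C) (j : nat) (t : R) :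
  0 < r -> gamma_regular (around mu r) ->
  F (fun n => regular mu r (gn n) (qn n) G Q) -> regular mu r g q G Q ->
  (forall m, around mu r m -> ctends F (fun n => gn n m) (g m)) ->
  (forall m k, around mu r m -> ctends F (fun n => qn n k m) (q k m)) ->
  ctends F (fun n => oddser (gn n) (qn n) j mu t) (oddser g q j mu t).
Proof.
  intros Hr HS Hn Hreg Hg Hq.
  assert (Hn' : F (fun n => bounded_data (around mu r) (gn n) (qn n) G Q))
    by (revert Hn; apply filter_imp; now intros n [H _]).
  assert (HC : forall m, around mu r m ->
    ctends F (fun n => cser (gn n) (qn n) j m t) (cser g q j m t)).
  { intros m Hm. apply (cser_tends (F := F) (around mu r) G Q); auto. apply Hreg. }
  destruct (Ceq_dec mu 0) as [E | Hmu].
  - subst mu. pose proof Hreg as [[HG [HQ _]] _].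
    destruct (increment_quot_bounds r G Q (Rabs t) j Hr HS HG HQ (Rabs_pos t)) as [M [HM H]].
    assert (H2 : ctends F (fun n => 2 * oddser (gn n) (qn n) j 0 t)%C (2 * oddser g q j 0 t)%C).
    { apply (ctends_interchange (F := F) (G := (locally' (RtoC 0))) (fun n m => increment_quot (gn n) (qn n) j t m) _
        (fun m => increment_quot g q j t m) _ (fun m => M * Cmod m)).
      - apply locally'_0_intro with (r / 2); [ lra | ]. intros m Hm0 Hm. revert Hn. apply filter_imp.
        intros n Hn. apply (H _ _ Hn t); [ lra | exact Hm0 | exact Hm ].
      - apply filterlim_Cmod_0.
      - apply locally'_0_intro with r; [ lra | ]. intros m Hm0 Hm.
        apply ctends_div; [ exact Hm0 | | apply ctends_const ].
        apply ctends_minus; [ | ]; apply HC; right; split; try reflexivity; try exact Hm.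
        now rewrite Cmod_opp.
      - apply ctends_squeeze with (fun m => M * Cmod m);
          [ | apply filterlim_Cmod_0 ].
        apply locally'_0_intro with (r / 2); [ lra | ]. intros m Hm0 Hm.
        apply (H _ _ Hreg t); [ lra | exact Hm0 | exact Hm ]. }
    assert (H3 := ctends_mult (F := F) _ _ _ _ (ctends_const (F := F) (/ 2)%C) H2).
    replace (/ 2 * (2 * oddser g q j 0 t))%C with (oddser g q j 0 t) in H3 by field.
    revert H3. apply ctends_ext; [ intros n; field ].
  - rewrite oddser_neq_0 by exact Hmu.
    apply ctends_ext with (fun n => odd_quot (gn n) (qn n) j t mu);
      [ intros n; symmetry; now apply oddser_neq_0 | ].
    apply ctends_mult; [ apply ctends_const | ].
    destruct (around_self mu r Hmu). apply ctends_minus; auto.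
Qed.

(** * Whittaker and Bessel functions as odd parts *)

Lemma not_integer_small (w : C) : w <> 0%C -> Rabs (Re w) < 1 -> ~ is_integer w.
Proof.
  intros Hw H [k Hk]. apply Hw. rewrite Hk in H |- *. simpl in H.
  rewrite Rabs_Zabs in H. apply (lt_IZR _ 1) in H. assert (k = 0%Z) by lia. now subst k.
Qed.

Lemma is_integer_opp (w : C) : is_integer (- w)%C -> is_integer w.
Proof.
  intros [k Hk]. exists (- k)%Z. rewrite opp_IZR, RtoC_opp, <- Hk. ring.
Qed.

Lemma is_integer_plus (w : C) (k : Z) : is_integer (w + IZR k)%C -> is_integer w.
Proof.
  intros [l Hl]. exists (l - k)%Z. rewrite minus_IZR, RtoC_minus, <- Hl. ring.
Qed.

Lemma invG_neq_0_nearby (a b : C) :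
  invG a <> 0%C -> exists r, 0 < r /\ forall m, Cmod m <= r -> invG (a + b * m) <> 0%C.
Proof.
  intros Ha. set (f := fun m => (invG (a + b * m) + - invG a)%C).
  assert (Hf : Hol 1 f) by (apply Hol_plus; [ apply Hol_invG; lra | apply Hol_const ]).
  destruct (Hol_bounded 1 f ltac:(lra) Hf) as [M [HM0 HM]].
  assert (Hf0 : f 0%C = 0%C) by (unfold f; replace (a + b * 0)%C with a by ring; ring).
  destruct (Hol_difference_quotient 1 M f ltac:(lra) Hf HM Hf0) as [H _].
  apply Cmod_gt_0 in Ha.
  assert (Hp : 0 < Cmod (invG a) / (4 * M + 1)) by (apply Rdiv_lt_0_compat; lra).
  exists (Rmin (1 / 2) (Cmod (invG a) / (4 * M + 1))). split; [ apply Rmin_pos; lra | ].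
  intros m Hm E.
  assert (Hm1 : Cmod m <= 1 / 2) by (eapply Rle_trans; [ exact Hm | apply Rmin_l ]).
  assert (Hm2 : Cmod m <= Cmod (invG a) / (4 * M + 1)) by (eapply Rle_trans; [ exact Hm | apply Rmin_r ]).
  destruct (Ceq_dec m 0) as [-> | Hm0].
  { replace (a + b * 0)%C with a in E by ring. rewrite E, Cmod_0 in Ha. lra. }
  specialize (H m Hm0 Hm1). unfold f in H. rewrite E in H.
  replace ((0 + - invG a) / m)%C with (- (invG a / m))%C in H by (unfold Cdiv; ring).
  rewrite Cmod_opp, Cmod_div in H by exact Hm0. apply Cmod_gt_0 in Hm0.
  assert (H1 : Cmod (invG a) <= 2 * M * Cmod m).
  { apply Rmult_le_reg_r with (/ Cmod m); [ now apply Rinv_0_lt_compat | ].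
    rewrite Rmult_assoc, Rinv_r by lra. unfold Rdiv in H. rewrite Rinv_1 in H. lra. }
  assert (H2 : Cmod m * (4 * M + 1) <= Cmod (invG a)).
  { apply Rmult_le_reg_r with (/ (4 * M + 1)); [ apply Rinv_0_lt_compat; lra | ].
    rewrite Rmult_assoc, Rinv_r by lra. unfold Rdiv in Hm2. lra. }
  nra.
Qed.

Definition whit_g (a : C) (m : C) : C := invG (- a - m).
Definition whit_q (a : C) (k : nat) (m : C) : C := Cpoch (- a + m) k.

Lemma Cmod_Cpoch_le (s : C) (M : R) (k : nat) :
  Cmod s <= M -> Cmod (Cpoch s k) <= (M + 1) ^ k * INR (fact k).
Proof.
  intros Hs. assert (HM : 0 <= M) by (generalize (Cmod_ge_0 s); lra).
  induction k as [ | k IH ].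
  - simpl. rewrite Cmod_1. lra.
  - change (Cpoch s (S k)) with (Cpoch s k * (s + INR k))%C.
    change (fact (S k)) with (S k * fact k)%nat. rewrite mult_INR, Cmod_mult, S_INR.
    replace ((M + 1) ^ S k * ((INR k + 1) * INR (fact k)))
      with (((M + 1) ^ k * INR (fact k)) * ((M + 1) * (INR k + 1))) by (simpl; ring).
    apply Rmult_le_compat; try apply Cmod_ge_0; [ exact IH | ].
    eapply Rle_trans; [ apply Cmod_triangle | ]. rewrite Cmod_R, Rabs_pos_eq by apply pos_INR.
    generalize (pos_INR k). nra.
Qed.

Lemma around_bound (mu : C) (r : R) (m : C) : 0 <= r -> around mu r m -> Cmod m <= Cmod mu + r.
Proof.
  intros Hr. assert (H := Cmod_ge_0 mu). intros [[_ [-> | ->]] | [_ Hm]]; rewrite ?Cmod_opp; lra.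
Qed.

Lemma regular_whit (mu a : C) (r : R) :
  0 <= r -> exists G Q, regular mu r (whit_g a) (whit_q a) G Q.
Proof.
  intros Hr. set (rho := Cmod a + (Cmod mu + r)).
  assert (Hrho : 0 <= rho) by (unfold rho; generalize (Cmod_ge_0 a) (Cmod_ge_0 mu); lra).
  destruct (invG_bounded rho Hrho) as [G [HG0 HG]].
  exists G, (rho + 1). split; [ split; [ exact HG0 | split; [ lra | ] ] | ].
  - intros m Hm. apply around_bound in Hm; [ | exact Hr ]. split.
    + apply HG. replace (- a - m)%C with (- (a + m))%C by ring. rewrite Cmod_opp.
      generalize (Cmod_triangle a m). unfold rho. lra.
    + intros k. apply Cmod_Cpoch_le. eapply Rle_trans; [ apply Cmod_triangle | ].
      rewrite Cmod_opp. unfold rho. lra.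
  - intros _. split.
    + apply Hol_ext with (fun m => invG (- a + - (1) * m)); [ intros m _; unfold whit_g; f_equal; ring | ].
      now apply Hol_invG.
    + intros k. apply Hol_ext with (fun m => Cpoch (- a + 1 * m) k);
        [ intros m _; unfold whit_q; f_equal; ring | ]. now apply Hol_Cpoch.
Qed.

Lemma cterm_regular_bounded (mu : C) (r G Q : R) (g : C -> C) (q : nat -> C -> C)
  (j : nat) (m : C) (t : R) :
  gamma_regular (around mu r) -> regular mu r g q G Q -> around mu r m ->
  exists K D, 0 <= K /\ 0 <= D /\ fact_bounded (cterm q j m t) K D.
Proof.
  intros HS [[_ [HQ Hb]] _] Hm.
  destruct (cterm_bounded _ Q (Rabs t) j HS HQ (Rabs_pos t)) as [K [D [HK [HD H]]]].
  exists K, D. repeat split; try assumption. apply H; [ exact Hm | now apply Hb | lra ].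
Qed.

Lemma Cexp_ln_scale (x : R) (k : nat) (m : C) :
  0 < x -> Cexp ((INR k + m) * ln x) = (RtoC (x ^ k) * Rcpow x m)%C.
Proof.
  intros Hx. unfold Rcpow. rewrite Cmult_plus_distr_r, Cexp_plus. f_equal.
  rewrite <- Cexp_pow, Cexp_RtoC, exp_ln by exact Hx. now rewrite RtoC_pow.
Qed.

(** Each half of the defining formula of the Whittaker function is one of the
    two series, since Gamma (- 2 m) Gamma (1 + 2 m) = - pi / sin (2 pi m). *)
Lemma whittaker_half (mu a m : C) (r x : R) :
  0 <= r -> gamma_regular (around mu r) -> around mu r m ->
  0 < x -> ~ is_integer (2 * m)%C -> invG (- a - m) <> 0%C ->
  (CGamma (- (2 * m)) * Rcpow x m / CGamma (- a - m) * hypergeom1F1 (- a + m) (2 * m + 1) x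
   = - (PI / Csin (2 * PI * m)) * cser (whit_g a) (whit_q a) 0 m (ln x))%C.
Proof.
  intros Hr HS Hm Hx H2m Ha.
  assert (N1 : invG (- (2 * m)) <> 0%C) by (apply invG_neq_0; intros H; now apply H2m, is_integer_opp).
  assert (N2 : invG (2 * m + 1) <> 0%C).
  { apply invG_neq_0. intros H. apply H2m. now apply (is_integer_plus (2 * m) 1). }
  assert (Hpi : RtoC PI <> 0%C) by apply RtoC_neq_0, PI_neq0.
  assert (R : (invG (- (2 * m)) * invG (2 * m + 1) = - (Csin (2 * PI * m) / PI))%C).
  { generalize (invG_reflection (- (2 * m))).
    replace (1 - - (2 * m))%C with (2 * m + 1)%C by ring. intros ->.
    replace (PI * - (2 * m))%C with (- (2 * PI * m))%C by ring. rewrite Csin_opp.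
    unfold Cdiv. ring. }
  assert (Hs : Csin (2 * PI * m) <> 0%C).
  { intros E. apply (Cmult_neq_0 _ _ N1 N2). rewrite R, E. unfold Cdiv. ring. }
  rewrite !CGamma_invG by assumption.
  assert (Hyp : hypergeom1F1 (- a + m) (2 * m + 1) x
    = (/ (invG (2 * m + 1) * Rcpow x m) * CSeries (cterm (whit_q a) 0 m (ln x)))%C).
  { destruct (regular_whit mu a r Hr) as [G [Q Hreg]].
    destruct (cterm_regular_bounded mu r G Q _ _ 0 m (ln x) HS Hreg Hm) as [K [D [HK [HD Hb]]]].
    rewrite <- (CSeries_mult _ _ K D HK HD Hb).
    apply CSeries_ext. intros k. unfold cterm, whit_q.
    rewrite Cexp_ln_scale by exact Hx. rewrite (invG_shift (2 * m + 1) k).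
    assert (Hsh := invG_shift (2 * m + 1) k).
    replace (INR k + 1 + 2 * m)%C with (2 * m + 1 + INR k)%C by ring.
    assert (P1 : Cpoch (2 * m + 1) k <> 0%C).
    { intros E. apply N2. rewrite Hsh, E. ring. }
    assert (P2 : invG (2 * m + 1 + INR k) <> 0%C).
    { intros E. apply N2. rewrite Hsh, E. ring. }
    simpl Cpow. field.
    repeat split; first [ exact P1 | exact P2 | apply INR_fact_neq_0_C | apply Rcpow_pos_neq_0 ]. }
  rewrite Hyp. unfold cser, whit_g.
  replace (PI / Csin (2 * PI * m))%C with (- / (invG (- (2 * m)) * invG (2 * m + 1)))%C.
  - field. repeat split; first [ exact N1 | exact N2 | exact Ha | apply Rcpow_pos_neq_0 ].
  - rewrite R. field. split; assumption.
Qed.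

Lemma Re_2_Rabs_lt (m : C) : Cmod m <= / 4 -> Rabs (2 * Re m) < 1.
Proof.
  intros Hm. rewrite Rabs_mult, (Rabs_pos_eq 2) by lra. generalize (re_le_Cmod m). lra.
Qed.

Lemma double_not_integer (m : C) : m <> 0%C -> Rabs (2 * Re m) < 1 -> ~ is_integer (2 * m)%C.
Proof.
  intros Hm H. apply not_integer_small.
  - apply Cmult_neq_0; [ apply RtoC_neq_0; lra | exact Hm ].
  - replace (Re (2 * m)%C) with (2 * Re m) by (cbn; unfold Re; ring). exact H.
Qed.

Lemma Re_2_opp (m : C) : Rabs (2 * Re (- m)%C) = Rabs (2 * Re m).
Proof. replace (2 * Re (- m)%C) with (- (2 * Re m)) by (cbn; unfold Re; ring). apply Rabs_Ropp. Qed.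

Lemma whittaker_formula (mu a m : C) (r x : R) :
  0 <= r -> gamma_regular (around mu r) -> around mu r m -> m <> 0%C ->
  0 < x -> Rabs (2 * Re m) < 1 -> invG (- a - m) <> 0%C -> invG (- a + m) <> 0%C ->
  (CGamma (- (2 * m)) * Rcpow x m / CGamma (1 / 2 - (a + 1 / 2) - m)
        * hypergeom1F1 (1 / 2 - (a + 1 / 2) + m) (2 * m + 1) x
      + CGamma (2 * m) * Rcpow x (- m) / CGamma (1 / 2 - (a + 1 / 2) + m)
        * hypergeom1F1 (1 / 2 - (a + 1 / 2) - m) (- (2 * m) + 1) x)%C
  = odd_quot (whit_g a) (whit_q a) 0 (ln x) m.
Proof.
  intros Hr HS Hm Hm0 Hx Hre H1 H2.
  assert (Hm' : around mu r (- m)%C) by now apply gamma_regular_opp.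
  replace (1 / 2 - (a + 1 / 2))%C with (- a)%C by field.
  rewrite (whittaker_half mu a m r x) by
    (try assumption; now apply double_not_integer).
  assert (Hm0' : (- m)%C <> 0%C).
  { intros E. apply Hm0. replace m with (- - m)%C by ring. rewrite E. ring. }
  generalize (whittaker_half mu a (- m) r x Hr HS Hm' Hx).
  replace (- (2 * - m))%C with (2 * m)%C by ring.
  replace (2 * - m)%C with (- (2 * m))%C by ring.
  replace (- a - - m)%C with (- a + m)%C by ring.
  replace (- a + - m)%C with (- a - m)%C by ring.
  replace (2 * PI * - m)%C with (- (2 * PI * m))%C by ring.
  intros H. rewrite H; [ | | exact H2 ].
  - rewrite Csin_opp. unfold odd_quot.
    assert (Hs : Csin (2 * PI * m) <> 0%C).
    { intros E. apply (double_not_integer m Hm0 Hre). apply Csin_eq_0.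
      replace (PI * (2 * m))%C with (2 * PI * m)%C by ring. exact E. }
    field. exact Hs.
  - replace (- (2 * m))%C with (2 * - m)%C by ring.
    apply double_not_integer; [ exact Hm0' | now rewrite Re_2_opp ].
Qed.

Lemma WhittakerW_oddser (a mu : C) (r x : R) :
  0 < r <= / 4 -> gamma_regular (around mu r) -> Rabs (2 * Re mu) < 1 ->
  0 < x -> invG (- a - mu) <> 0%C -> invG (- a + mu) <> 0%C ->
  WhittakerW (a + 1 / 2) mu x
  = (sqrt x * exp (- x / 2) * oddser (whit_g a) (whit_q a) 0 mu (ln x))%C.
Proof.
  intros Hr HS Hre Hx H1 H2. unfold WhittakerW.
  destruct (Ceq_dec mu 0) as [-> | Hmu].
  - apply Clim_eq.
    destruct (regular_whit 0 a r ltac:(lra)) as [G [Q Hreg]].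
    apply ctends_ext_loc with
      (fun m => sqrt x * exp (- x / 2) * odd_quot (whit_g a) (whit_q a) 0 (ln x) m)%C.
    + replace (- a - 0)%C with (- a)%C in H1 by ring.
      destruct (invG_neq_0_nearby (- a) 1 H1) as [r1 [Hr1 N1]].
      apply locally'_0_intro with (Rmin r r1); [ apply Rmin_pos; lra | ]. intros m Hm0 Hm.
      assert (Hm1 : Cmod m <= r) by (eapply Rle_trans; [ exact Hm | apply Rmin_l ]).
      assert (Hm2 : Cmod m <= r1) by (eapply Rle_trans; [ exact Hm | apply Rmin_r ]).
      symmetry. f_equal. apply (whittaker_formula 0 a m r x); try assumption; try lra.
      * right. auto.
      * apply Re_2_Rabs_lt. lra.
      * replace (- a - m)%C with (- a + 1 * - m)%C by ring. apply N1. now rewrite Cmod_opp.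
      * replace (- a + m)%C with (- a + 1 * m)%C by ring. now apply N1.
    + apply ctends_mult; [ apply ctends_const | ].
      apply (oddser_limit_0 r G Q); try assumption. lra.
  - rewrite oddser_neq_0 by exact Hmu. f_equal.
    apply (whittaker_formula mu a mu r x); try assumption; try lra.
    now apply around_self.
Qed.

Lemma CSeries_plus (a b : nat -> C) (K D K' D' : R) :
  0 <= K -> 0 <= D -> fact_bounded a K D -> 0 <= K' -> 0 <= D' -> fact_bounded b K' D' ->
  CSeries (fun k => a k + b k)%C = (CSeries a + CSeries b)%C.
Proof.
  intros HK HD Ha HK' HD' Hb.
  apply (ctends_unique (F := eventually) (csum (fun k => a k + b k)%C)); [ | ].
  - apply CSeries_tends with (K + K') (Rmax D D'); [ lra | eapply Rle_trans; [ exact HD | apply Rmax_l ] | ].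
    intros k. eapply Rle_trans; [ apply Cmod_triangle | ]. rewrite Rmult_plus_distr_r.
    assert (Hf : 0 <= / INR (fact k)) by (left; apply Rinv_0_lt_compat, INR_fact_lt_0).
    apply Rplus_le_compat; (eapply Rle_trans; [ apply Ha || apply Hb | ]);
      apply Rmult_le_compat_l; try assumption; apply Rmult_le_compat_r; try assumption;
      apply pow_incr; split; try assumption; [ apply Rmax_l | apply Rmax_r ].
  - apply ctends_ext with (fun n => csum a n + csum b n)%C;
      [ intros n; symmetry; apply csum_plus | ].
    apply ctends_plus; [ now apply CSeries_tends with K D | now apply CSeries_tends with K' D' ].
Qed.

(** Termwise form of the recurrence that expresses the Whittaker function with
    first index lowered by one through the function and its derivative. *)
Lemma cser_lowering (mu a m : C) (r t : R) :
  0 <= r -> gamma_regular (around mu r) -> around mu r m ->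
  ((a * a - m * m) * cser (whit_g (a - 1)) (whit_q (a - 1)) 0 m t
   = cser (whit_g a) (whit_q a) 1 m t - a * cser (whit_g a) (whit_q a) 0 m t)%C.
Proof.
  intros Hr HS Hm. destruct (regular_whit mu a r Hr) as [G [Q Hreg]].
  destruct (cterm_regular_bounded mu r G Q _ _ 0 m t HS Hreg Hm) as [K [D [HK [HD Hb]]]].
  destruct (cterm_regular_bounded mu r G Q _ _ 1 m t HS Hreg Hm) as [K1 [D1 [HK1 [HD1 Hb1]]]].
  destruct (regular_whit mu (a - 1) r Hr) as [G2 [Q2 Hreg2]].
  destruct (cterm_regular_bounded mu r G2 Q2 _ _ 0 m t HS Hreg2 Hm) as [K2 [D2 [HK2 [HD2 Hb2]]]].
  assert (E : ((- a + m) * CSeries (cterm (whit_q (a - 1)) 0 m t)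
    = CSeries (cterm (whit_q a) 1 m t) + - a * CSeries (cterm (whit_q a) 0 m t))%C).
  { rewrite <- (CSeries_mult (- a + m) _ K2 D2 HK2 HD2 Hb2), <- (CSeries_mult (- a) _ K D HK HD Hb).
    rewrite <- (CSeries_plus _ _ K1 D1 (Cmod (- a) * K) D).
    - apply CSeries_ext. intros k. unfold cterm, whit_q. simpl Cpow.
      replace (- (a - 1) + m)%C with (- a + m + 1)%C by ring.
      replace ((- a + m) * (Cpoch (- a + m + 1) k * 1 * Cexp ((INR k + m) * t) *
          invG (INR k + 1 + 2 * m) / INR (fact k)))%C
        with (((- a + m) * Cpoch (- a + m + 1) k) * (Cexp ((INR k + m) * t) *
          invG (INR k + 1 + 2 * m) / INR (fact k)))%C by (unfold Cdiv; ring).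
      rewrite <- Cpoch_succ_l. simpl Cpoch. unfold Cdiv. ring.
    - exact HK1.
    - exact HD1.
    - exact Hb1.
    - apply Rmult_le_pos; [ apply Cmod_ge_0 | exact HK ].
    - exact HD.
    - now apply fact_bounded_mult. }
  unfold cser, whit_g. rewrite (invG_rec (- a - m)).
  replace (- a - m + 1)%C with (- (a - 1) - m)%C by ring.
  replace ((a * a - m * m) * (invG (- (a - 1) - m) * CSeries (cterm (whit_q (a - 1)) 0 m t)))%C
    with ((- a - m) * invG (- (a - 1) - m) * ((- a + m) * CSeries (cterm (whit_q (a - 1)) 0 m t)))%C
    by ring.
  rewrite E. ring.
Qed.

Lemma oddser_lowering (mu a : C) (r t : R) :
  0 < r -> gamma_regular (around mu r) ->
  ((a * a - mu * mu) * oddser (whit_g (a - 1)) (whit_q (a - 1)) 0 mu t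
   = oddser (whit_g a) (whit_q a) 1 mu t - a * oddser (whit_g a) (whit_q a) 0 mu t)%C.
Proof.
  intros Hr HS.
  assert (L : forall m, around mu r m ->
    ((a * a - m * m) * odd_quot (whit_g (a - 1)) (whit_q (a - 1)) 0 t m
     = odd_quot (whit_g a) (whit_q a) 1 t m - a * odd_quot (whit_g a) (whit_q a) 0 t m)%C).
  { intros m Hm. assert (Hm' : around mu r (- m)%C) by now apply gamma_regular_opp.
    generalize (cser_lowering mu a m r t ltac:(lra) HS Hm)
      (cser_lowering mu a (- m) r t ltac:(lra) HS Hm').
    replace (- m * - m)%C with (m * m)%C by ring. intros E1 E2. unfold odd_quot.
    transitivity (PI / Csin (2 * PI * m) *
      ((a * a - m * m) * cser (whit_g (a - 1)) (whit_q (a - 1)) 0 (- m) t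
       - (a * a - m * m) * cser (whit_g (a - 1)) (whit_q (a - 1)) 0 m t))%C; [ ring | ].
    rewrite E1, E2. ring. }
  destruct (Ceq_dec mu 0) as [E | Hmu].
  - subst mu.
    destruct (regular_whit 0 a r ltac:(lra)) as [G [Q Hreg]].
    destruct (regular_whit 0 (a - 1) r ltac:(lra)) as [G2 [Q2 Hreg2]].
    apply (ctends_unique (F := (locally' (RtoC 0)))
      (fun m => (a * a - m * m) * odd_quot (whit_g (a - 1)) (whit_q (a - 1)) 0 t m)%C); [ | ].
    + apply ctends_mult; [ | now apply (oddser_limit_0 r G2 Q2) ].
      apply ctends_minus; [ now apply ctends_const | ].
      apply ctends_mult; [ apply ctends_id_0 | apply ctends_id_0 ].
    + apply ctends_ext_loc with
        (fun m => odd_quot (whit_g a) (whit_q a) 1 t m - a * odd_quot (whit_g a) (whit_q a) 0 t m)%C.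
      * apply locally'_0_intro with r; [ exact Hr | ]. intros m _ Hm. symmetry. apply L. right. auto.
      * apply ctends_minus; [ now apply (oddser_limit_0 r G Q) | ].
        apply ctends_mult; [ now apply ctends_const | now apply (oddser_limit_0 r G Q) ].
  - rewrite !oddser_neq_0 by exact Hmu. apply L. now apply around_self.
Qed.

Definition besI_g (_ : C) : C := 1.
Definition besI_q (_ : nat) (_ : C) : C := 1.
(** By the reflection formula this is - sin (pi (c + m)) / pi; the product shows
    at once that it is the limit of the prefactors [plus_g] below. *)
Definition besJ_g (c : C) (m : C) : C := (- (invG (c + m) * invG (1 - (c + m))))%C.
Definition besJ_q (k : nat) (_ : C) : C := ((- (1)) ^ k)%C.

Lemma INR_fact_ge_1 (k : nat) : 1 <= INR (fact k).
Proof. apply (le_INR 1). generalize (lt_O_fact k). lia. Qed.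

Lemma regular_besI (mu : C) (r : R) : regular mu r besI_g besI_q 1 1.
Proof.
  split; [ split; [ lra | split; [ lra | ] ] | ].
  - intros m _. unfold besI_g, besI_q. rewrite Cmod_1. split; [ lra | ]. intros k.
    rewrite pow1, Rmult_1_l. apply INR_fact_ge_1.
  - intros _. split; [ apply (Hol_const r (RtoC 1)) | intros k; apply (Hol_const r (RtoC 1)) ].
Qed.

Lemma Cmod_besJ_q (k : nat) (m : C) : Cmod (besJ_q k m) = 1.
Proof. unfold besJ_q. rewrite Cmod_pow, Cmod_m1. apply pow1. Qed.

Lemma Hol_besJ_g (c : C) (r : R) : 0 <= r -> Hol r (besJ_g c).
Proof.
  intros Hr. apply Hol_opp; [ exact Hr | ].
  apply (Hol_mult r (fun m => invG (c + m)) (fun m => invG (1 - (c + m)))); [ exact Hr | | ].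
  - apply Hol_ext with (fun m => invG (c + 1 * m)); [ intros m _; f_equal; ring | now apply Hol_invG ].
  - apply Hol_ext with (fun m => invG ((1 - c) + - (1) * m));
      [ intros m _; f_equal; ring | now apply Hol_invG ].
Qed.

Lemma regular_besJ (mu c : C) (r : R) :
  0 <= r -> exists G, regular mu r (besJ_g c) besJ_q G 1.
Proof.
  intros Hr. set (rho := 1 + Cmod c + (Cmod mu + r)).
  assert (Hrho : 0 <= rho) by (unfold rho; generalize (Cmod_ge_0 c) (Cmod_ge_0 mu); lra).
  destruct (invG_bounded rho Hrho) as [K [HK0 HK]].
  exists (K * K). split; [ split; [ nra | split; [ lra | ] ] | ].
  - intros m Hm. apply around_bound in Hm; [ | exact Hr ]. split.
    + unfold besJ_g. rewrite Cmod_opp, Cmod_mult.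
      assert (Hs : Cmod (c + m)%C <= Cmod c + (Cmod mu + r))
        by (eapply Rle_trans; [ apply Cmod_triangle | lra ]).
      apply Rmult_le_compat; try apply Cmod_ge_0; apply HK; unfold rho; [ lra | ].
      eapply Rle_trans; [ apply Cmod_minus_le | ]. rewrite Cmod_1. lra.
    + intros k. rewrite Cmod_besJ_q, pow1, Rmult_1_l. apply INR_fact_ge_1.
  - intros _. split; [ now apply Hol_besJ_g | intros k; apply Hol_const ].
Qed.

Lemma Rcpow_half_double_sqrt (x : R) (k : nat) (m : C) :
  0 < x -> Rcpow (2 * sqrt x / 2) (2 * INR k + 2 * m) = Cexp ((INR k + m) * ln x).
Proof.
  intros Hx. unfold Rcpow. replace (2 * sqrt x / 2) with (sqrt x) by field.
  assert (E : ln x = 2 * ln (sqrt x)).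
  { rewrite <- (sqrt_sqrt x) at 1 by lra. rewrite ln_mult by now apply sqrt_lt_R0. ring. }
  rewrite E, RtoC_mult. f_equal. ring.
Qed.

Lemma invG_order_neq_0 (m : C) (k : nat) :
  m <> 0%C -> Rabs (2 * Re m) < 1 -> invG (INR k + 1 + 2 * m) <> 0%C.
Proof.
  intros Hm Hre. apply invG_neq_0. intros H. apply (double_not_integer m Hm Hre).
  apply (is_integer_plus _ (Z.of_nat k + 1)). rewrite plus_IZR, <- INR_IZR_INZ, RtoC_plus.
  replace (2 * m + (INR k + 1))%C with (INR k + 1 + 2 * m)%C by ring. exact H.
Qed.

Lemma BesselI_series (m : C) (x : R) :
  m <> 0%C -> Rabs (2 * Re m) < 1 -> 0 < x ->
  BesselI (2 * m) (2 * sqrt x) = CSeries (cterm besI_q 0 m (ln x)).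
Proof.
  intros Hm Hre Hx. apply CSeries_ext. intros k. unfold cterm, besI_q.
  rewrite Rcpow_half_double_sqrt by exact Hx.
  assert (N := invG_order_neq_0 m k Hm Hre).
  replace (INR k + 2 * m + 1)%C with (INR k + 1 + 2 * m)%C by ring.
  rewrite CGamma_invG by exact N. simpl Cpow. field.
  split; first [ exact N | apply INR_fact_neq_0_C ].
Qed.

Lemma BesselJ_series (m : C) (x : R) :
  m <> 0%C -> Rabs (2 * Re m) < 1 -> 0 < x ->
  BesselJ (2 * m) (2 * sqrt x) = CSeries (cterm besJ_q 0 m (ln x)).
Proof.
  intros Hm Hre Hx. apply CSeries_ext. intros k. unfold cterm, besJ_q.
  rewrite Rcpow_half_double_sqrt by exact Hx.
  assert (N := invG_order_neq_0 m k Hm Hre).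
  replace (INR k + 2 * m + 1)%C with (INR k + 1 + 2 * m)%C by ring.
  rewrite CGamma_invG by exact N. set (p := ((- (1)) ^ k)%C). simpl Cpow. field.
  split; first [ exact N | apply INR_fact_neq_0_C ].
Qed.

Lemma Copp_neq_0 (m : C) : m <> 0%C -> (- m)%C <> 0%C.
Proof. intros Hm E. apply Hm. replace m with (- - m)%C by ring. rewrite E. ring. Qed.

Lemma Csin_2PI_neq_0 (m : C) : m <> 0%C -> Rabs (2 * Re m) < 1 -> Csin (2 * PI * m) <> 0%C.
Proof.
  intros Hm Hre E. apply (double_not_integer m Hm Hre), Csin_eq_0.
  replace (PI * (2 * m))%C with (2 * PI * m)%C by ring. exact E.
Qed.

Lemma limA_formula_odd_quot (c m : C) (x : R) :
  m <> 0%C -> Rabs (2 * Re m) < 1 -> 0 < x ->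
  limA_formula (c + m) (c - m) x = odd_quot (besJ_g c) besJ_q 0 (ln x) m.
Proof.
  intros Hm Hre Hx. unfold limA_formula.
  replace ((c + m - (c - m)) / 2)%C with m by field.
  replace (- (2 * m))%C with (2 * - m)%C by ring.
  assert (Hm' := Copp_neq_0 m Hm).
  assert (Hre' : Rabs (2 * Re (- m)%C) < 1) by now rewrite Re_2_opp.
  rewrite (BesselJ_series m x Hm Hre Hx), (BesselJ_series (- m) x Hm' Hre' Hx).
  assert (Hs := Csin_2PI_neq_0 m Hm Hre).
  assert (Hpi : RtoC PI <> 0%C) by apply RtoC_neq_0, PI_neq0.
  unfold odd_quot, cser, besJ_g. rewrite !invG_reflection.
  replace (c - m)%C with (c + - m)%C by ring. field. split; assumption.
Qed.

Lemma limA_oddser (z0 z0' : C) (r x : R) :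
  let mu := ((z0 - z0') / 2)%C in let c := ((z0 + z0') / 2)%C in
  0 < r <= / 4 -> gamma_regular (around mu r) -> Rabs (2 * Re mu) < 1 -> 0 < x ->
  limA z0 z0' x = oddser (besJ_g c) besJ_q 0 mu (ln x).
Proof.
  intros mu c Hr HS Hre Hx. unfold limA. fold mu. fold c.
  destruct (Ceq_dec mu 0) as [E | Hmu].
  - rewrite E in *. destruct (regular_besJ 0 c r ltac:(lra)) as [G Hreg].
    apply Clim_eq.
    apply ctends_ext_loc with (odd_quot (besJ_g c) besJ_q 0 (ln x)).
    + apply locally'_0_intro with (/ 4); [ lra | ]. intros m Hm0 Hm. symmetry.
      apply limA_formula_odd_quot; [ exact Hm0 | now apply Re_2_Rabs_lt | exact Hx ].
    + apply (oddser_limit_0 r G 1); try assumption. lra.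
  - rewrite oddser_neq_0, <- limA_formula_odd_quot by assumption.
    replace (c + mu)%C with z0 by (unfold mu, c; field).
    replace (c - mu)%C with z0' by (unfold mu, c; field). reflexivity.
Qed.

Lemma BesselK_formula_odd_quot (m : C) (x : R) :
  m <> 0%C -> Rabs (2 * Re m) < 1 -> 0 < x ->
  (PI / (2 * Csin (PI * (2 * m))) * (BesselI (- (2 * m)) (2 * sqrt x) - BesselI (2 * m) (2 * sqrt x)))%C
  = (/ 2 * odd_quot besI_g besI_q 0 (ln x) m)%C.
Proof.
  intros Hm Hre Hx.
  replace (- (2 * m))%C with (2 * - m)%C by ring.
  assert (Hm' := Copp_neq_0 m Hm).
  assert (Hre' : Rabs (2 * Re (- m)%C) < 1) by now rewrite Re_2_opp.
  rewrite (BesselI_series m x Hm Hre Hx), (BesselI_series (- m) x Hm' Hre' Hx).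
  assert (Hs := Csin_2PI_neq_0 m Hm Hre).
  replace (PI * (2 * m))%C with (2 * PI * m)%C by ring.
  unfold odd_quot, cser, besI_g. field. exact Hs.
Qed.

Lemma limB_oddser (z0 z0' : C) (r x : R) :
  let mu := ((z0 - z0') / 2)%C in
  0 < r <= / 4 -> gamma_regular (around mu r) -> Rabs (2 * Re mu) < 1 -> 0 < x ->
  limB z0 z0' x = (/ 2 * oddser besI_g besI_q 0 mu (ln x))%C.
Proof.
  intros mu Hr HS Hre Hx. unfold limB. fold mu. unfold BesselK.
  destruct (Ceq_dec (Csin (PI * (2 * mu))) 0) as [E | E]; destruct (Ceq_dec mu 0) as [E0 | Hmu].
  - rewrite E0 in *. replace (2 * 0)%C with (RtoC 0) by ring.
    apply Clim_eq.
    assert (H : ctends (locally' (RtoC 0)) (fun m => / 2 * odd_quot besI_g besI_q 0 (ln x) m)%C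
                  (/ 2 * oddser besI_g besI_q 0 0 (ln x))%C).
    { apply ctends_mult; [ apply ctends_const | ].
      apply (oddser_limit_0 r 1 1); [ lra | exact HS | apply regular_besI ]. }
    intros eps He. destruct (H eps He) as [d Hd].
    assert (Hdp := cond_pos d).
    apply locally'_0_intro with (Rmin (d / 2) (/ 4)); [ apply Rmin_pos; lra | ]. intros nu Hnu0 Hnu.
    assert (H1 : Cmod nu <= d / 2) by (eapply Rle_trans; [ exact Hnu | apply Rmin_l ]).
    assert (H2 : Cmod nu <= / 4) by (eapply Rle_trans; [ exact Hnu | apply Rmin_r ]).
    set (m := (nu / 2)%C). assert (Em : nu = (2 * m)%C) by (unfold m; field).
    assert (Hm0 : m <> 0%C) by (intros E1; apply Hnu0; rewrite Em, E1; ring).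
    assert (Hm : Cmod nu = 2 * Cmod m) by (rewrite Em, Cmod_mult, Cmod_R, Rabs_pos_eq; lra).
    assert (Hmp := Cmod_ge_0 m).
    rewrite Em. rewrite BesselK_formula_odd_quot; [ | exact Hm0 | apply Re_2_Rabs_lt; lra | exact Hx ].
    apply Hd; [ | exact Hm0 ]. apply C_NormedModule_mixin_compat1.
    change (Cmod (m - 0)%C < d). rewrite Cminus_0_r. lra.
  - exfalso. apply (Csin_2PI_neq_0 mu Hmu Hre).
    replace (2 * PI * mu)%C with (PI * (2 * mu))%C by ring. exact E.
  - exfalso. apply E. rewrite E0. replace (PI * (2 * 0))%C with (RtoC 0) by ring.
    unfold Csin. replace (Ci * 0)%C with (RtoC 0) by ring. rewrite Cexp_opp, Cexp_0.
    field. apply Ci_neq_0.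
  - rewrite oddser_neq_0 by exact Hmu. now apply BesselK_formula_odd_quot.
Qed.

Lemma cderive_comp_ln (f : R -> C) (x : R) (l : C) :
  0 < x -> cderive f (ln x) l -> cderive (fun y => f (ln y)) x (l / x)%C.
Proof.
  intros Hx Hf. apply cderive_value with ((/ x)%R * l)%C.
  - rewrite RtoC_inv by lra. unfold Cdiv. ring.
  - apply cderive_comp; [ exact Hf | now apply is_derive_ln ].
Qed.

Lemma locally_pos (x : R) : 0 < x -> locally x (fun y => 0 < y).
Proof. intros Hx. apply (open_gt 0). exact Hx. Qed.

Lemma limA_tilde_oddser (z0 z0' : C) (r x : R) :
  let mu := ((z0 - z0') / 2)%C in let c := ((z0 + z0') / 2)%C in
  0 < r <= / 4 -> gamma_regular (around mu r) -> Rabs (2 * Re mu) < 1 -> 0 < x ->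
  limA_tilde z0 z0' x = oddser (besJ_g c) besJ_q 1 mu (ln x).
Proof.
  intros mu c Hr HS Hre Hx. unfold limA_tilde.
  destruct (regular_besJ mu c r ltac:(lra)) as [G Hreg].
  rewrite (CDerive_eq _ x (oddser (besJ_g c) besJ_q 1 mu (ln x) / x)%C).
  - field. apply RtoC_neq_0. lra.
  - apply cderive_ext_loc with (fun y => oddser (besJ_g c) besJ_q 0 mu (ln y)).
    + generalize (locally_pos x Hx). apply filter_imp. intros y Hy. symmetry.
      now apply (limA_oddser z0 z0' r).
    + apply cderive_comp_ln; [ exact Hx | ].
      apply (cderive_oddser mu r G 1); try assumption. lra.
Qed.

Lemma limB_tilde_oddser (z0 z0' : C) (r x : R) :
  let mu := ((z0 - z0') / 2)%C in
  0 < r <= / 4 -> gamma_regular (around mu r) -> Rabs (2 * Re mu) < 1 -> 0 < x ->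
  limB_tilde z0 z0' x = (/ 2 * oddser besI_g besI_q 1 mu (ln x))%C.
Proof.
  intros mu Hr HS Hre Hx. unfold limB_tilde.
  rewrite (CDerive_eq _ x (/ 2 * (oddser besI_g besI_q 1 mu (ln x) / x))%C).
  - field. apply RtoC_neq_0. lra.
  - apply cderive_ext_loc with (fun y => / 2 * oddser besI_g besI_q 0 mu (ln y))%C.
    + generalize (locally_pos x Hx). apply filter_imp. intros y Hy. symmetry.
      now apply (limB_oddser z0 z0' r).
    + apply cderive_cmult, cderive_comp_ln; [ exact Hx | ].
      apply (cderive_oddser mu r 1 1); [ lra | exact HS | apply regular_besI ].
Qed.

(** * Rescaling and the limit of large parameters *)

Definition scaled_g (g : C -> C) (N : R) (kappa : C) (m : C) : C :=
  (g m * Rcpow N (- m) * kappa)%C.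

Definition scaled_q (q : nat -> C -> C) (N : R) (k : nat) (m : C) : C :=
  (q k m * RtoC ((/ N) ^ k))%C.

Lemma cser_scale (g : C -> C) (q : nat -> C -> C) (N : R) (kappa : C) (j : nat) (m : C) (t K D : R) :
  0 < N -> 0 <= K -> 0 <= D -> fact_bounded (cterm (scaled_q q N) j m t) K D ->
  (kappa * cser g q j m (t - ln N))%C = cser (scaled_g g N kappa) (scaled_q q N) j m t.
Proof.
  intros HN HK HD Hb.
  assert (E : CSeries (cterm q j m (t - ln N))
              = (Rcpow N (- m) * CSeries (cterm (scaled_q q N) j m t))%C).
  { rewrite <- (CSeries_mult _ _ K D HK HD Hb). apply CSeries_ext. intros k.
    unfold cterm, scaled_q.
    replace ((INR k + m) * (t - ln N)%R)%C
      with ((INR k + m) * t + (INR k * (- ln N)%R + - m * ln N))%C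
      by (rewrite RtoC_minus, RtoC_opp; ring).
    rewrite !Cexp_plus. rewrite <- (Cexp_pow (RtoC (- ln N))).
    rewrite Cexp_RtoC, exp_Ropp, exp_ln, RtoC_pow by exact HN.
    unfold Rcpow. set (p := ((INR k + m) ^ j)%C). unfold Cdiv. ring. }
  unfold cser, scaled_g. rewrite E. ring.
Qed.

Lemma oddser_scale (mu : C) (r G Q G' Q' : R) (g : C -> C) (q : nat -> C -> C)
  (N : R) (kappa : C) (j : nat) (t : R) :
  0 < r -> gamma_regular (around mu r) -> 0 < N -> regular mu r g q G Q ->
  regular mu r (scaled_g g N kappa) (scaled_q q N) G' Q' ->
  (kappa * oddser g q j mu (t - ln N))%C = oddser (scaled_g g N kappa) (scaled_q q N) j mu t.
Proof.
  intros Hr HS HN H H'.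
  assert (L : forall m, around mu r m ->
    (kappa * odd_quot g q j (t - ln N) m)%C = odd_quot (scaled_g g N kappa) (scaled_q q N) j t m).
  { intros m Hm. assert (Hm' : around mu r (- m)%C) by now apply gamma_regular_opp.
    destruct (cterm_regular_bounded mu r G' Q' _ _ j m t HS H' Hm) as [K [D [HK [HD Hb]]]].
    destruct (cterm_regular_bounded mu r G' Q' _ _ j (- m) t HS H' Hm') as [K' [D' [HK' [HD' Hb']]]].
    unfold odd_quot.
    rewrite <- (cser_scale g q N kappa j m t K D HN HK HD Hb),
      <- (cser_scale g q N kappa j (- m) t K' D' HN HK' HD' Hb'). ring. }
  destruct (Ceq_dec mu 0) as [E | Hmu].
  - subst mu.
    apply (ctends_unique (F := (locally' (RtoC 0))) (fun m => kappa * odd_quot g q j (t - ln N) m)%C);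
      [ | ].
    + apply ctends_mult; [ now apply ctends_const | now apply (oddser_limit_0 r G Q) ].
    + apply ctends_ext_loc with (odd_quot (scaled_g g N kappa) (scaled_q q N) j t).
      * apply locally'_0_intro with r; [ exact Hr | ]. intros m _ Hm. symmetry. apply L. right. auto.
      * now apply (oddser_limit_0 r G' Q').
  - rewrite !oddser_neq_0 by exact Hmu. apply L. now apply around_self.
Qed.

Lemma Hol_scaled_g (r : R) (g : C -> C) (N : R) (kappa : C) :
  0 <= r -> Hol r g -> Hol r (scaled_g g N kappa).
Proof.
  intros Hr Hg. apply Hol_mult; [ exact Hr | | apply Hol_const ].
  apply Hol_mult; [ exact Hr | exact Hg | ].
  apply Hol_ext with (fun m => Rcpow N (0 + - (1) * m)); [ intros m _; f_equal; ring | now apply Hol_Rcpow ].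
Qed.

Lemma Hol_scaled_q (r : R) (q : nat -> C -> C) (N : R) (k : nat) :
  0 <= r -> Hol r (q k) -> Hol r (scaled_q q N k).
Proof. intros Hr Hq. apply Hol_mult; [ exact Hr | exact Hq | apply Hol_const ]. Qed.

Lemma regular_scaled (mu : C) (r : R) (g : C -> C) (q : nat -> C -> C) (N : R) (kappa : C) :
  0 <= r -> 0 < N -> (exists G Q, regular mu r g q G Q) ->
  exists G Q, regular mu r (scaled_g g N kappa) (scaled_q q N) G Q.
Proof.
  intros Hr HN [G [Q [[HG [HQ Hb]] Hh]]].
  set (L := exp ((Cmod mu + r) * Rabs (ln N))).
  assert (HL : 0 < L) by apply exp_pos.
  assert (Hi : 0 < / N) by now apply Rinv_0_lt_compat.
  exists (G * L * Cmod kappa), (Q * / N). split; [ split; [ | split; [ nra | ] ] | ].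
  - apply Rmult_le_pos; [ nra | apply Cmod_ge_0 ].
  - intros m Hm. destruct (Hb m Hm) as [Hg Hq]. apply around_bound in Hm; [ | exact Hr ].
    unfold scaled_g, scaled_q. split.
    + rewrite !Cmod_mult. apply Rmult_le_compat_r; [ apply Cmod_ge_0 | ].
      apply Rmult_le_compat; try apply Cmod_ge_0; [ exact Hg | ].
      eapply Rle_trans; [ apply Cmod_Cexp_le | ]. apply exp_le.
      rewrite Cmod_mult, Cmod_opp, Cmod_R. apply Rmult_le_compat_r; [ apply Rabs_pos | exact Hm ].
    + intros k. rewrite Cmod_mult, Cmod_R, Rabs_pos_eq by (apply pow_le; lra).
      rewrite Rpow_mult_distr.
      replace (Q ^ k * (/ N) ^ k * INR (fact k)) with (Q ^ k * INR (fact k) * (/ N) ^ k) by ring.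
      apply Rmult_le_compat_r; [ apply pow_le; lra | apply Hq ].
  - intros E. destruct (Hh E) as [Hg Hq]. split; [ now apply Hol_scaled_g | ].
    intros k. now apply Hol_scaled_q.
Qed.

Lemma scaled_whit_q_bound (a m : C) (B N : R) (k : nat) :
  1 <= N -> 0 <= B -> Cmod a <= B + N -> Cmod m <= B ->
  Cmod (scaled_q (whit_q a) N k m) <= (2 * B + 2) ^ k * INR (fact k).
Proof.
  intros HN HB Ha Hm. unfold scaled_q, whit_q. rewrite Cmod_mult, Cmod_R.
  assert (Hi : 0 < / N) by (apply Rinv_0_lt_compat; lra).
  rewrite Rabs_pos_eq by (apply pow_le; lra).
  assert (H : Cmod (- a + m)%C <= 2 * B + N).
  { eapply Rle_trans; [ apply Cmod_triangle | ]. rewrite Cmod_opp. lra. }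
  apply Rle_trans with ((2 * B + N + 1) ^ k * INR (fact k) * (/ N) ^ k).
  - apply Rmult_le_compat_r; [ apply pow_le; lra | now apply Cmod_Cpoch_le ].
  - replace ((2 * B + N + 1) ^ k * INR (fact k) * (/ N) ^ k)
      with (((2 * B + N + 1) * / N) ^ k * INR (fact k)) by (rewrite Rpow_mult_distr; ring).
    apply Rmult_le_compat_r; [ apply pos_INR | ]. apply pow_incr. split.
    + apply Rmult_le_pos; lra.
    + apply Rmult_le_reg_r with N; [ lra | ]. rewrite Rmult_assoc, Rinv_l by lra. nra.
Qed.

Lemma ctends_div_INR (s : C) : ctends eventually (fun N => s * / INR N)%C 0.
Proof.
  apply ctends_ext_loc with (fun N => s * RtoC (1 * / INR N))%C; [ | ].
  - exists 1%nat. intros N HN. rewrite Rmult_1_l, RtoC_inv; [ reflexivity | ].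
    apply not_0_INR. lia.
  - replace (RtoC 0) with (s * RtoC 0)%C by ring.
    apply ctends_mult; [ now apply ctends_const | ].
    apply ctends_RtoC; [ apply filterlim_K_div_INR ].
Qed.

(** Each of the k factors s + sigma N + i, divided by N, tends to sigma. *)
Lemma Cpoch_large (s sigma : C) (k : nat) :
  ctends eventually (fun N => Cpoch (s + sigma * INR N) k * RtoC ((/ INR N) ^ k))%C (sigma ^ k)%C.
Proof.
  induction k as [ | k IH ].
  - simpl. apply ctends_ext with (fun _ => RtoC 1); [ intros; ring | now apply ctends_const ].
  - apply ctends_ext_loc with
      (fun N => (Cpoch (s + sigma * INR N) k * RtoC ((/ INR N) ^ k)) * ((s + INR k) * / INR N + sigma))%C.
    + exists 1%nat. intros N HN.
      assert (HN0 : INR N <> 0) by (apply not_0_INR; lia).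
      change (Cpoch (s + sigma * INR N) (S k))
        with (Cpoch (s + sigma * INR N) k * (s + sigma * INR N + INR k))%C.
      change ((/ INR N) ^ S k) with (/ INR N * (/ INR N) ^ k).
      rewrite RtoC_mult, RtoC_inv by exact HN0. field. now apply RtoC_neq_0.
    + change (sigma ^ S k)%C with (sigma * sigma ^ k)%C.
      replace (sigma * sigma ^ k)%C with (sigma ^ k * (0 + sigma))%C by ring.
      apply ctends_mult; [ exact IH | ].
      apply ctends_plus; [ apply ctends_div_INR | now apply ctends_const ].
Qed.

(** (N - 1)! N^s / Gamma (s + N). *)
Definition gamma_ratio (N : nat) (s : C) : C :=
  (invG (s + INR N) * (INR (fact N) * Rcpow (INR N) s / INR N))%C.

Lemma gamma_ratio_egam (N : nat) (s : C) :
  (1 <= N)%nat -> (egam N s * gamma_ratio N s = invG s * (1 + s * / INR N))%C.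
Proof.
  intros HN. assert (HN0 : RtoC (INR N) <> 0%C) by (apply RtoC_neq_0, not_0_INR; lia).
  rewrite (invG_shift s N). unfold egam, gamma_ratio. rewrite Rcpow_opp.
  change (Cpoch s (S N)) with (Cpoch s N * (s + INR N))%C. field.
  repeat split; first [ exact HN0 | apply INR_fact_neq_0_C | apply Rcpow_pos_neq_0 ].
Qed.

Lemma gamma_ratio_tends (s : C) :
  invG s <> 0%C -> ctends eventually (fun N => gamma_ratio N s) 1.
Proof.
  intros Hs.
  destruct (invG_le_egam (Cmod s) (Cmod_ge_0 s)) as [K [HK0 HK]].
  apply ctends_ext_loc with (fun N => invG s * (1 + s * / INR N) / egam N s)%C; [ | ].
  - exists 1%nat. intros N HN. rewrite <- gamma_ratio_egam by exact HN.
    assert (He : egam N s <> 0%C).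
    { intros E. generalize (HK s N ltac:(lra) HN). rewrite E, Cmod_0.
      apply Cmod_gt_0 in Hs. lra. }
    field. exact He.
  - apply ctends_value with (invG s * (1 + 0) / invG s)%C; [ field; exact Hs | ].
    apply ctends_div; [ exact Hs | | apply egam_tends ].
    apply ctends_mult; [ now apply ctends_const | ].
    apply ctends_plus; [ now apply ctends_const | apply ctends_div_INR ].
Qed.

Lemma gamma_ratio_bounded (rho : R) :
  0 <= rho -> exists K, 0 <= K /\ forall (s : C) (N : nat), Cmod s <= rho -> (1 <= N)%nat ->
  invG s <> 0%C -> Cmod (gamma_ratio N s) <= K.
Proof.
  intros Hrho. destruct (invG_le_egam rho Hrho) as [K [HK0 HK]].
  exists (K * (1 + rho)). split; [ apply Rmult_le_pos; lra | ]. intros s N Hs HN Hnz.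
  specialize (HK s N Hs HN).
  assert (HN1 : 1 <= INR N) by (apply (le_INR 1); exact HN).
  assert (He : 0 < Cmod (egam N s)).
  { destruct (Rle_lt_or_eq_dec 0 _ (Cmod_ge_0 (egam N s))) as [H | H]; [ exact H | ].
    rewrite <- H in HK. apply Cmod_gt_0 in Hnz. lra. }
  apply Rmult_le_reg_l with (Cmod (egam N s)); [ exact He | ].
  rewrite <- Cmod_mult, gamma_ratio_egam, Cmod_mult by exact HN.
  replace (Cmod (egam N s) * (K * (1 + rho))) with ((K * Cmod (egam N s)) * (1 + rho)) by ring.
  apply Rmult_le_compat; try apply Cmod_ge_0; [ exact HK | ].
  eapply Rle_trans; [ apply Cmod_triangle | ]. rewrite Cmod_1, Cmod_mult, Cmod_inv by (apply RtoC_neq_0; lra).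
  rewrite Cmod_R, Rabs_pos_eq by lra.
  assert (Hi : / INR N <= 1) by (rewrite <- Rinv_1; apply Rinv_le_contravar; lra).
  assert (Hi0 : 0 < / INR N) by (apply Rinv_0_lt_compat; lra).
  generalize (Cmod_ge_0 s). nra.
Qed.

(** The sign (- 1)^N produced by N applications of the functional equation is 1
    for even [N]. *)
Lemma invG_neg_even (s : C) (N : nat) :
  (1 <= N)%nat -> Nat.Even N ->
  invG (- s - INR N) = (- (egam N s * invG (1 - s)) * (INR (fact N) * Rcpow (INR N) s))%C.
Proof.
  intros HN [M ->]. rewrite invG_neg_shift. unfold egam. rewrite Rcpow_opp.
  replace ((- (1)) ^ (2 * M))%C with (RtoC 1).
  - field. split; first [ apply INR_fact_neq_0_C | apply Rcpow_pos_neq_0 ].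
  - rewrite <- Cpow_Cpow. replace ((- (1)) ^ 2)%C with (RtoC 1) by (simpl; ring).
    symmetry. apply Cpow_1_l.
Qed.

Definition even_infinity : (nat -> Prop) -> Prop := within Nat.Even eventually.

Global Instance even_infinity_filter : Filter even_infinity.
Proof. apply within_filter, eventually_filter. Qed.

Lemma ctends_even (f : nat -> C) (l : C) : ctends eventually f l -> ctends even_infinity f l.
Proof. apply ctends_filter_le. apply filter_le_within. Qed.

Lemma even_infinity_intro (P : nat -> Prop) :
  (forall N, (1 <= N)%nat -> Nat.Even N -> P N) -> even_infinity P.
Proof. intros H. exists 1%nat. intros N HN HE. now apply H. Qed.

(** The size of phi (xi / N) as [N] grows; that of psi (eta / N) is N divided by
    it. *)
Definition gamma_scale (c : C) (N : nat) : C := (INR (fact N) * Rcpow (INR N) c)%C.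

Lemma gamma_scale_neq_0 (c : C) (N : nat) : gamma_scale c N <> 0%C.
Proof. apply Cmult_neq_0; [ apply INR_fact_neq_0_C | apply Rcpow_pos_neq_0 ]. Qed.

Definition plus_g (c : C) (N : nat) : C -> C :=
  scaled_g (whit_g (c + INR N)) (INR N) (/ gamma_scale c N)%C.
Definition plus_q (c : C) (N : nat) : nat -> C -> C :=
  scaled_q (whit_q (c + INR N)) (INR N).
Definition minus_g (c : C) (N : nat) : C -> C :=
  scaled_g (whit_g (- (c + INR N))) (INR N) (gamma_scale c N / INR N)%C.
Definition minus_q (c : C) (N : nat) : nat -> C -> C :=
  scaled_q (whit_q (- (c + INR N))) (INR N).

Lemma plus_g_eq (c m : C) (N : nat) :
  (1 <= N)%nat -> Nat.Even N -> plus_g c N m = (- (egam N (c + m) * invG (1 - (c + m))))%C.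
Proof.
  intros HN HE. unfold plus_g, scaled_g, whit_g, gamma_scale.
  replace (- (c + INR N) - m)%C with (- (c + m) - INR N)%C by ring.
  rewrite invG_neg_even, Rcpow_plus, Rcpow_opp by assumption. field.
  repeat split; first [ apply INR_fact_neq_0_C | apply Rcpow_pos_neq_0 ].
Qed.

Lemma minus_g_eq (c m : C) (N : nat) :
  (1 <= N)%nat -> minus_g c N m = gamma_ratio N (c - m).
Proof.
  intros HN. unfold minus_g, scaled_g, whit_g, gamma_scale, gamma_ratio.
  replace (- - (c + INR N) - m)%C with (c - m + INR N)%C by ring.
  unfold Cminus. rewrite Rcpow_plus. unfold Cdiv. ring.
Qed.

Lemma regular_weaken (mu : C) (r : R) (g : C -> C) (q : nat -> C -> C) (G Q G' Q' : R) :
  G <= G' -> Q <= Q' -> regular mu r g q G Q -> regular mu r g q G' Q'.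
Proof.
  intros HGG HQQ [[HG [HQ Hb]] Hh]. split; [ | exact Hh ].
  split; [ lra | split; [ lra | ] ]. intros m Hm. destruct (Hb m Hm) as [Hg Hq].
  split; [ lra | ]. intros k. eapply Rle_trans; [ apply Hq | ].
  apply Rmult_le_compat_r; [ apply pos_INR | ]. apply pow_incr. lra.
Qed.

Lemma whit_oddser_tends (mu s sigma : C) (r G G0 Q0 : R) (kappa : nat -> C)
  (g : C -> C) (q : nat -> C -> C) (j : nat) (t : R) :
  let gN N := scaled_g (whit_g (s + sigma * INR N)) (INR N) (kappa N) in
  let qN N := scaled_q (whit_q (s + sigma * INR N)) (INR N) in
  0 < r -> gamma_regular (around mu r) -> Cmod sigma <= 1 ->
  even_infinity (fun N => forall m, around mu r m -> Cmod (gN N m) <= G) ->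
  regular mu r g q G0 Q0 -> (forall k m, q k m = ((- sigma) ^ k)%C) ->
  (forall m, around mu r m -> ctends even_infinity (fun N => gN N m) (g m)) ->
  ctends even_infinity (fun N => oddser (gN N) (qN N) j mu t) (oddser g q j mu t).
Proof.
  intros gN qN Hr HS Hsig HG Hreg Hq Hg.
  set (B := Cmod s + (Cmod mu + r)).
  assert (Hs := Cmod_ge_0 s). assert (Hmu := Cmod_ge_0 mu).
  assert (HB : 0 <= B) by (unfold B; lra).
  assert (M1 := Rmax_l (Rmax G 0) G0). assert (M2 := Rmax_r (Rmax G 0) G0).
  assert (M3 := Rmax_l G 0). assert (M4 := Rmax_r G 0).
  set (G' := Rmax (Rmax G 0) G0) in *.
  apply (oddser_tends mu r G' (Rmax (2 * B + 2) Q0)); try assumption.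
  - destruct HG as [N1 HG]. exists (S N1). intros N HN HE. specialize (HG N ltac:(lia) HE).
    apply (regular_weaken mu r _ _ G' (2 * B + 2)); [ lra | apply Rmax_l | ].
    split; [ split; [ lra | split; [ lra | ] ] | ].
    + intros m Hm. split; [ specialize (HG m Hm); lra | ]. apply around_bound in Hm; [ | lra ].
      intros k. apply scaled_whit_q_bound; [ apply (le_INR 1); lia | exact HB | | unfold B; lra ].
      eapply Rle_trans; [ apply Cmod_triangle | ].
      rewrite Cmod_mult, Cmod_R, Rabs_pos_eq by apply pos_INR. generalize (pos_INR N). unfold B. nra.
    + intros E. destruct (regular_whit mu (s + sigma * INR N) r ltac:(lra)) as [G1 [Q1 [_ HH]]].
      destruct (HH E) as [Hg1 Hq1].
      split; [ apply Hol_scaled_g | intros k; apply Hol_scaled_q ]; solve [ lra | auto ].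
  - apply (regular_weaken mu r _ _ G0 Q0); [ exact M2 | apply Rmax_r | exact Hreg ].
  - intros m k _. rewrite Hq. apply ctends_even.
    apply ctends_ext with (fun N => Cpoch ((m - s) + - sigma * INR N) k * RtoC ((/ INR N) ^ k))%C.
    + intros N. unfold qN, scaled_q, whit_q. f_equal. f_equal. ring.
    + apply Cpoch_large.
Qed.

Lemma plus_oddser_tends (mu c : C) (r : R) (j : nat) (t : R) :
  0 < r -> gamma_regular (around mu r) ->
  ctends even_infinity (fun N => oddser (plus_g c N) (plus_q c N) j mu t)
    (oddser (besJ_g c) besJ_q j mu t).
Proof.
  intros Hr HS. set (B := 1 + Cmod c + (Cmod mu + r)).
  assert (Hc := Cmod_ge_0 c). assert (Hmu := Cmod_ge_0 mu).
  assert (HB : 0 <= B) by (unfold B; lra).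
  destruct (invG_bounded B HB) as [K1 [HK1 H1]].
  destruct (egam_bounded B HB) as [K2 [HK2 H2]].
  destruct (regular_besJ mu c r ltac:(lra)) as [G0 HJ].
  apply ctends_ext with (fun N =>
    oddser (scaled_g (whit_g (c + 1 * INR N)) (INR N) (/ gamma_scale c N)%C)
      (scaled_q (whit_q (c + 1 * INR N)) (INR N)) j mu t).
  { intros N. now rewrite Cmult_1_l. }
  apply (whit_oddser_tends mu c 1 r (K2 * K1) G0 1 (fun N => / gamma_scale c N)%C);
    try assumption; [ rewrite Cmod_1; lra | | reflexivity | ].
  - apply even_infinity_intro. intros N HN HE m Hm. apply around_bound in Hm; [ | lra ].
    rewrite Cmult_1_l. fold (plus_g c N). rewrite plus_g_eq, Cmod_opp, Cmod_mult by assumption.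
    assert (Hs : Cmod (c + m)%C <= Cmod c + (Cmod mu + r))
      by (eapply Rle_trans; [ apply Cmod_triangle | lra ]).
    apply Rmult_le_compat; try apply Cmod_ge_0; [ apply H2; [ unfold B; lra | exact HN ] | ].
    apply H1. eapply Rle_trans; [ apply Cmod_minus_le | ]. rewrite Cmod_1. unfold B. lra.
  - intros m _. apply ctends_ext_loc with (fun N => - (egam N (c + m) * invG (1 - (c + m))))%C.
    + apply even_infinity_intro. intros N HN HE. rewrite Cmult_1_l. symmetry. now apply plus_g_eq.
    + apply ctends_even, ctends_opp, ctends_mult; [ apply egam_tends | apply ctends_const ].
Qed.

Lemma minus_oddser_tends (mu c : C) (r : R) (j : nat) (t : R) :
  0 < r -> gamma_regular (around mu r) ->
  (forall m, around mu r m -> invG (c - m) <> 0%C) ->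
  ctends even_infinity (fun N => oddser (minus_g c N) (minus_q c N) j mu t)
    (oddser besI_g besI_q j mu t).
Proof.
  intros Hr HS Hnz. assert (Hc := Cmod_ge_0 c). assert (Hmu := Cmod_ge_0 mu).
  destruct (gamma_ratio_bounded (Cmod c + (Cmod mu + r)) ltac:(lra)) as [K1 [HK1 H1]].
  assert (E : forall N, (- (c + INR N) = - c + - (1) * INR N)%C) by (intros N; ring).
  apply ctends_ext with (fun N =>
    oddser (scaled_g (whit_g (- c + - (1) * INR N)) (INR N) (gamma_scale c N / INR N)%C)
      (scaled_q (whit_q (- c + - (1) * INR N)) (INR N)) j mu t).
  { intros N. now rewrite <- E. }
  apply (whit_oddser_tends mu (- c) (- (1)) r K1 1 1 (fun N => gamma_scale c N / INR N)%C);
    try assumption; [ rewrite Cmod_m1; lra | | apply regular_besI | | ].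
  - apply even_infinity_intro. intros N HN _ m Hm. pose proof (Hnz m Hm) as Hnzm.
    apply around_bound in Hm; [ | lra ]. rewrite <- E. fold (minus_g c N). rewrite minus_g_eq by exact HN.
    apply H1; [ | exact HN | exact Hnzm ]. eapply Rle_trans; [ apply Cmod_minus_le | lra ].
  - intros k m. replace (- - (1))%C with (RtoC 1) by ring. symmetry. apply Cpow_1_l.
  - intros m Hm. apply ctends_ext_loc with (fun N => gamma_ratio N (c - m)).
    + apply even_infinity_intro. intros N HN _. rewrite <- E. symmetry. now apply minus_g_eq.
    + now apply ctends_even, gamma_ratio_tends, Hnz.
Qed.

(** * The kernels *)

(** For a family with x d/dx f_j = f_(j+1), the value at [x = y] is the limit of
    the quotient. *)
Definition cross (f : nat -> R -> C) (x y : R) : C :=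
  if Req_EM_T x y then ((f 1%nat x * f 1%nat x - f 0%nat x * f 2%nat x) / x)%C
  else ((f 0%nat x * f 1%nat y - f 1%nat x * f 0%nat y) / (x - y))%C.

(** Off the diagonal the determinant is a combination of the difference quotients
    of its two functions, which gives the diagonal value. *)
Lemma diag_ext_cross (k : R -> R -> C) (h : R -> R -> C) (f : nat -> R -> C) (x y : R) :
  0 < x -> 0 < y ->
  (forall j z, 0 < z -> cderive (f j) z (f (S j) z / z)%C) ->
  (forall u v, 0 < u -> 0 < v ->
     k u v = (h u v * ((f 0%nat u * f 1%nat v - f 1%nat u * f 0%nat v) / (u - v)))%C) ->
  ctends (locally' x) (h x) (h x x) ->
  diag_ext k x y = (h x y * cross f x y)%C.
Proof.
  intros Hx Hy Hf Hk Hh. unfold diag_ext, cross.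
  destruct (Req_EM_T x y) as [<- | Hxy]; [ | now apply Hk ].
  apply Clim_eq.
  assert (Hx0 : RtoC x <> 0%C) by (apply RtoC_neq_0; lra).
  apply ctends_ext_loc with
    (fun v => h x v * (f 1%nat x * ((f 0%nat v - f 0%nat x) / (v - x))
                       - f 0%nat x * ((f 1%nat v - f 1%nat x) / (v - x))))%C.
  - assert (Hpos : locally' x (fun v : R => v <> x /\ 0 < v)).
    { destruct (locally_pos x Hx) as [d Hd]. exists d. intros v Hv Hvx. split; [ exact Hvx | now apply Hd ]. }
    revert Hpos. apply filter_imp. intros v [Hvx Hv]. rewrite Hk by assumption.
    assert (D1 : (RtoC v - RtoC x)%C <> 0%C)
      by (rewrite <- RtoC_minus; apply RtoC_neq_0, Rminus_eq_contra, Hvx).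
    assert (D2 : (RtoC x - RtoC v)%C <> 0%C)
      by (rewrite <- RtoC_minus; apply RtoC_neq_0, Rminus_eq_contra; auto).
    field. split; assumption.
  - apply ctends_mult; [ exact Hh | ].
    replace ((f 1%nat x * f 1%nat x - f 0%nat x * f 2%nat x) / x)%C
      with (f 1%nat x * (f 1%nat x / x) - f 0%nat x * (f 2%nat x / x))%C by (field; exact Hx0).
    apply ctends_minus; [ | ];
      (apply ctends_mult; [ now apply ctends_const | ]);
      apply cderive_quotient, Hf; exact Hx.
Qed.

Lemma ctends_cross (fn : nat -> nat -> R -> C) (f : nat -> R -> C) (x y : R) :
  0 < x -> (forall j z, ctends even_infinity (fun N => fn N j z) (f j z)) ->
  ctends even_infinity (fun N => cross (fn N) x y) (cross f x y).
Proof.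
  intros Hx H. unfold cross.
  assert (Hx0 : RtoC x <> 0%C) by (apply RtoC_neq_0; lra).
  destruct (Req_EM_T x y) as [E | Hxy].
  - apply ctends_div; [ exact Hx0 | | now apply ctends_const ].
    apply ctends_minus; [ | ]; now apply ctends_mult.
  - apply ctends_div; [ | | now apply ctends_const ].
    + rewrite <- RtoC_minus. apply RtoC_neq_0. lra.
    + apply ctends_minus; [ | ]; now apply ctends_mult.
Qed.

Lemma cross_scale (f fs : nat -> R -> C) (kappa : C) (N x y : R) :
  0 < N -> 0 < x -> (forall j z, 0 < z -> f j (z / N) = (kappa * fs j z)%C) -> 0 < y ->
  (1 / N * cross f (x / N) (y / N) = kappa * kappa * cross fs x y)%C.
Proof.
  intros HN Hx Hf Hy. unfold cross.
  assert (HN0 : RtoC N <> 0%C) by (apply RtoC_neq_0; lra).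
  assert (Hx0 : RtoC x <> 0%C) by (apply RtoC_neq_0; lra).
  destruct (Req_EM_T (x / N) (y / N)) as [E | E]; destruct (Req_EM_T x y) as [E' | E'].
  - rewrite !Hf, RtoC_div by lra. field. split; assumption.
  - exfalso. apply E'. apply Rmult_eq_reg_r with (/ N); [ exact E | ].
    apply Rinv_neq_0_compat. lra.
  - exfalso. apply E. now rewrite E'.
  - rewrite !Hf, !RtoC_div by lra.
    assert (D : (RtoC x - RtoC y)%C <> 0%C) by (rewrite <- RtoC_minus; apply RtoC_neq_0; lra).
    field. repeat split; assumption.
Qed.

Definition whit (a mu : C) (j : nat) (x : R) : C := oddser (whit_g a) (whit_q a) j mu (ln x).

Definition half_exp (x : R) : C := RtoC (exp (- x / 2)).

Lemma cderive_whit (a mu : C) (r : R) (j : nat) (x : R) :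
  0 < r -> gamma_regular (around mu r) -> 0 < x ->
  cderive (whit a mu j) x (whit a mu (S j) x / x)%C.
Proof.
  intros Hr HS Hx. destruct (regular_whit mu a r ltac:(lra)) as [G [Q Hreg]].
  apply cderive_comp_ln; [ exact Hx | ]. now apply (cderive_oddser mu r G Q).
Qed.

Lemma whittaker_value (a mu : C) (r x : R) :
  0 < r <= / 4 -> gamma_regular (around mu r) -> Rabs (2 * Re mu) < 1 -> 0 < x ->
  invG (- a - mu) <> 0%C -> invG (- a + mu) <> 0%C ->
  (/ sqrt x * WhittakerW (a + 1 / 2) mu x)%C = (half_exp x * whit a mu 0 x)%C.
Proof.
  intros Hr HS Hre Hx H1 H2.
  rewrite (WhittakerW_oddser a mu r x) by assumption. unfold half_exp, whit.
  field. apply RtoC_neq_0. generalize (sqrt_lt_R0 x Hx). lra.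
Qed.

Lemma whittaker_minus_value (a mu : C) (r x : R) :
  0 < r <= / 4 -> gamma_regular (around mu r) -> Rabs (2 * Re mu) < 1 -> 0 < x ->
  ~ is_integer (a + mu)%C -> ~ is_integer (a - mu)%C ->
  (/ sqrt x * WhittakerW (a - 1 / 2) mu x)%C
  = (half_exp x * ((whit a mu 1 x - a * whit a mu 0 x) / (a * a - mu * mu)))%C.
Proof.
  intros Hr HS Hre Hx H1 H2.
  assert (N1 : forall w, ~ is_integer w -> w <> 0%C) by (intros w Hw E; apply Hw; exists 0%Z; exact E).
  assert (Hz : (a * a - mu * mu)%C <> 0%C).
  { replace (a * a - mu * mu)%C with ((a + mu) * (a - mu))%C by ring.
    apply Cmult_neq_0; now apply N1. }
  replace (a - 1 / 2)%C with ((a - 1) + 1 / 2)%C by field.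
  rewrite (whittaker_value (a - 1) mu r x) by
    (try assumption; apply invG_neq_0; intros H;
     first [ apply H1, is_integer_opp, (is_integer_plus _ 1);
             replace (- (a + mu) + 1)%C with (- (a - 1) - mu)%C by ring; exact H
           | apply H2, is_integer_opp, (is_integer_plus _ 1);
             replace (- (a - mu) + 1)%C with (- (a - 1) + mu)%C by ring; exact H ]).
  f_equal. unfold whit. rewrite <- (oddser_lowering mu a r (ln x)) by (try assumption; lra).
  field. exact Hz.
Qed.

Definition parameters (z z' a mu : C) (r : R) : Prop :=
  z = (a + mu)%C /\ z' = (a - mu)%C /\ ~ is_integer z /\ ~ is_integer z' /\
  Rabs (2 * Re mu) < 1 /\ 0 < r <= / 4 /\ gamma_regular (around mu r).

Lemma parameters_shift (z z' a mu : C) (r : R) (N : nat) :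
  parameters z z' a mu r ->
  parameters (z + INR N) (z' + INR N) (a + INR N) mu r.
Proof.
  intros [-> [-> [H1 [H2 H]]]]. split; [ ring | split; [ ring | split; [ | split; [ | exact H ] ] ] ].
  - intros E. apply H1. rewrite INR_IZR_INZ in E. now apply is_integer_plus in E.
  - intros E. apply H2. rewrite INR_IZR_INZ in E. now apply is_integer_plus in E.
Qed.

Lemma parameters_a (z z' a mu : C) (r : R) :
  parameters z z' a mu r -> ((z + z') / 2)%C = a /\ ((z - z') / 2)%C = mu.
Proof. intros [-> [-> _]]. split; field. Qed.

Lemma not_integer_neq_0 (w : C) : ~ is_integer w -> w <> 0%C.
Proof. intros Hw E. apply Hw. exists 0%Z. exact E. Qed.

Lemma Cinv_neq_0 (w : C) : w <> 0%C -> (/ w)%C <> 0%C.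
Proof. intros Hw E. generalize (Cinv_r w Hw). rewrite E, Cmult_0_r. intros H. apply RtoC_inj in H. lra. Qed.

Lemma plus_INR_neq_0 (w : C) (N : nat) : ~ is_integer w -> (w + INR N)%C <> 0%C.
Proof.
  intros Hw. apply not_integer_neq_0. intros E. apply Hw.
  rewrite INR_IZR_INZ in E. now apply is_integer_plus in E.
Qed.

Lemma invG_opp_neq_0 (w : C) : ~ is_integer w -> invG (- w) <> 0%C.
Proof. intros Hw. apply invG_neq_0. intros H. now apply Hw, is_integer_opp. Qed.

Lemma phi_value (z z' a mu : C) (r x : R) :
  parameters z z' a mu r -> 0 < x ->
  phi z z' x = (half_exp x * whit a mu 0 x)%C.
Proof.
  intros P Hx. destruct (parameters_a _ _ _ _ _ P) as [Ea Emu].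
  unfold phi. rewrite Ea, Emu. destruct P as [Hz [Hz' [N1 [N2 [Hre [Hr HS]]]]]].
  apply (whittaker_value a mu r x); try assumption.
  - replace (- a - mu)%C with (- z)%C by (rewrite Hz; ring). now apply invG_opp_neq_0.
  - replace (- a + mu)%C with (- z')%C by (rewrite Hz'; ring). now apply invG_opp_neq_0.
Qed.

Lemma phi_minus_value (z z' a mu : C) (r x : R) :
  parameters z z' a mu r -> 0 < x ->
  phi_minus z z' x = (half_exp x * ((whit a mu 1 x - a * whit a mu 0 x) / (z * z')))%C.
Proof.
  intros P Hx. destruct (parameters_a _ _ _ _ _ P) as [Ea Emu].
  unfold phi_minus. rewrite Ea, Emu. destruct P as [Hz [Hz' [N1 [N2 [Hre [Hr HS]]]]]].
  rewrite (whittaker_minus_value a mu r x) by (try assumption; now rewrite <- ?Hz, <- ?Hz').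
  replace (z * z')%C with (a * a - mu * mu)%C by (rewrite Hz, Hz'; ring). reflexivity.
Qed.

(** This symmetry derives psi and K_{--} from phi and K_{++}. *)
Lemma parameters_opp (z z' a mu : C) (r : R) :
  parameters z z' a mu r -> parameters (- z') (- z) (- a) mu r.
Proof.
  intros [-> [-> [N1 [N2 H]]]]. split; [ ring | split; [ ring | split; [ | split; [ | exact H ] ] ] ];
    intros E; [ apply N2 | apply N1 ]; now apply is_integer_opp.
Qed.

Lemma psi_phi (z z' : C) (x : R) : psi z z' x = phi (- z') (- z) x.
Proof. unfold psi, phi. f_equal. f_equal; field. Qed.

Lemma psi_minus_phi_minus (z z' : C) (x : R) : psi_minus z z' x = phi_minus (- z') (- z) x.
Proof. unfold psi_minus, phi_minus. f_equal. f_equal; field. Qed.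

Lemma Kmm_Kpp (z z' : C) (x y : R) : Kmm z z' x y = Kpp (- z') (- z) x y.
Proof.
  unfold Kmm, Kpp. f_equal. apply functional_extensionality. intros u.
  apply functional_extensionality. intros v.
  now rewrite !psi_phi, !psi_minus_phi_minus, (Cmult_comm (CGamma (- z))).
Qed.

Lemma ctends_half_exp (x : R) : ctends (locally' x) half_exp (half_exp x).
Proof.
  unfold half_exp. apply (ctends_filter_le _ (locally x)); [ apply filter_le_within | ].
  apply ctends_RtoC.
  apply (ex_derive_continuous (V := R_NormedModule) (fun x => exp (- x / 2)) x).
  auto_derive. exact I.
Qed.

Lemma ctends_half_exp_infinity (x : R) : ctends even_infinity (fun N => half_exp (x / INR N)) 1.
Proof.
  apply ctends_value with (half_exp 0).
  { unfold half_exp. replace (- 0 / 2) with 0 by field. now rewrite exp_0. }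
  apply ctends_even. unfold half_exp.
  apply (ctends_RtoC (F := eventually) (fun N => exp (- (x / INR N) / 2))).
  apply (filterlim_comp _ _ _ (fun N => x * / INR N) (fun y => exp (- y / 2)) eventually (locally 0)).
  - apply filterlim_K_div_INR.
  - apply (ex_derive_continuous (V := R_NormedModule) (fun x => exp (- x / 2)) 0).
    auto_derive. exact I.
Qed.

(** phi_- is a combination of phi and of the t-derivative of its series part, so
    the determinant is that of the series part and its t-derivative. *)
Lemma Kpp_value (z z' a mu : C) (r x y : R) :
  parameters z z' a mu r -> 0 < x -> 0 < y ->
  Kpp z z' x y
  = (invG z * invG z' / (z * z') * (half_exp x * half_exp y) * cross (whit a mu) x y)%C.
Proof.
  intros P Hx Hy. pose proof P as [Hz [Hz' [N1 [N2 [Hre [Hr HS]]]]]].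
  unfold Kpp. apply (diag_ext_cross _ (fun x y =>
    invG z * invG z' / (z * z') * (half_exp x * half_exp y))%C (whit a mu) x y Hx Hy).
  - intros j w Hw. now apply (cderive_whit a mu r).
  - intros u v Hu Hv.
    rewrite !(phi_value z z' a mu r), !(phi_minus_value z z' a mu r), !CGamma_eq
      by assumption.
    assert (G1 := invG_neq_0 z N1). assert (G2 := invG_neq_0 z' N2).
    assert (Z1 := not_integer_neq_0 z N1). assert (Z2 := not_integer_neq_0 z' N2).
    unfold Cdiv. set (i := (/ (RtoC u - RtoC v))%C). field. repeat split; assumption.
  -
    apply ctends_mult; [ now apply ctends_const | ].
    apply ctends_mult; [ now apply ctends_const | apply ctends_half_exp ].
Qed.

(** With z z' = a^2 - mu^2 the terms in a^2 cancel. *)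
Lemma Kpm_value (z z' a mu : C) (r x y : R) :
  parameters z z' a mu r -> 0 < x -> 0 < y ->
  Kpm z z' x y
  = (sqrt_sin_sin z z' / PI * (half_exp x * half_exp y) / (z * z')
     * ((- (mu * mu) * (whit a mu 0 x * whit (- a) mu 0 y) + whit a mu 1 x * whit (- a) mu 1 y
        + a * (whit a mu 1 x * whit (- a) mu 0 y - whit a mu 0 x * whit (- a) mu 1 y)) / (x + y)))%C.
Proof.
  intros P Hx Hy. pose proof P as [Hz [Hz' [N1 [N2 _]]]].
  assert (Z1 := not_integer_neq_0 z N1). assert (Z2 := not_integer_neq_0 z' N2).
  unfold Kpm. assert (P' := parameters_opp _ _ _ _ _ P).
  rewrite psi_phi, psi_minus_phi_minus, (phi_value z z' a mu r x P Hx),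
    (phi_minus_value z z' a mu r x P Hx), (phi_value _ _ _ _ _ y P' Hy),
    (phi_minus_value _ _ _ _ _ y P' Hy).
  assert (Hxy : (RtoC x + RtoC y)%C <> 0%C) by (rewrite <- RtoC_plus; apply RtoC_neq_0; lra).
  assert (Hpi : RtoC PI <> 0%C) by apply RtoC_neq_0, PI_neq0.
  assert (Emu : (mu * mu)%C = (a * a - z * z')%C) by (rewrite Hz, Hz'; ring).
  rewrite Emu. field. repeat split; assumption.
Qed.

Lemma whit_scale (a mu : C) (r N x : R) (kappa : C) (j : nat) :
  0 < r -> gamma_regular (around mu r) -> 0 < N -> 0 < x -> kappa <> 0%C ->
  whit a mu j (x / N)
  = (/ kappa * oddser (scaled_g (whit_g a) N kappa) (scaled_q (whit_q a) N) j mu (ln x))%C.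
Proof.
  intros Hr HS HN Hx Hk.
  destruct (regular_whit mu a r ltac:(lra)) as [G [Q Hreg]].
  destruct (regular_scaled mu r (whit_g a) (whit_q a) N kappa ltac:(lra) HN
    (ex_intro _ G (ex_intro _ Q Hreg))) as [G' [Q' Hreg']].
  unfold whit. rewrite ln_div by assumption.
  rewrite <- (oddser_scale mu r G Q G' Q' _ _ N kappa j (ln x)) by assumption. field. exact Hk.
Qed.

Lemma Kpp_scale (z z' a mu : C) (r N x y : R) (kappa : C) :
  parameters z z' a mu r -> 0 < N -> 0 < x -> 0 < y -> kappa <> 0%C ->
  (1 / N * Kpp z z' (x / N) (y / N)
   = (invG z / kappa) * (invG z' / kappa) / (z * z') * (half_exp (x / N) * half_exp (y / N))
     * cross (fun j x => oddser (scaled_g (whit_g a) N kappa) (scaled_q (whit_q a) N) j mu (ln x)) x y)%C.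
Proof.
  intros P HN Hx Hy Hk. pose proof P as [_ [_ [N1 [N2 [_ [Hr HS]]]]]].
  rewrite (Kpp_value _ _ a mu r) by (try (apply Rdiv_lt_0_compat; assumption); exact P).
  replace (1 / N * (invG z * invG z' / (z * z') * (half_exp (x / N) * half_exp (y / N)) *
      cross (whit a mu) (x / N) (y / N)))%C
    with (invG z * invG z' / (z * z') * (half_exp (x / N) * half_exp (y / N)) *
      (1 / N * cross (whit a mu) (x / N) (y / N)))%C by (unfold Cdiv; ring).
  rewrite (cross_scale _ (fun j x =>
      oddser (scaled_g (whit_g a) N kappa) (scaled_q (whit_q a) N) j mu (ln x)) (/ kappa)%C)
    by (try assumption; intros j w Hw; apply (whit_scale a mu r); try assumption; lra).
  field. repeat split; first [ now apply not_integer_neq_0 | exact Hk ].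
Qed.

Lemma ctends_N2_over_zz' (z z' : C) :
  ~ is_integer z -> ~ is_integer z' ->
  ctends even_infinity (fun N => INR N * INR N / ((z + INR N) * (z' + INR N)))%C 1.
Proof.
  intros N1 N2.
  apply ctends_ext_loc with (fun N => 1 / ((1 + z * / INR N) * (1 + z' * / INR N)))%C.
  - apply even_infinity_intro. intros N HN _.
    assert (HN0 : RtoC (INR N) <> 0%C) by (apply RtoC_neq_0, not_0_INR; lia).
    assert (S1 := plus_INR_neq_0 z N N1). assert (S2 := plus_INR_neq_0 z' N N2).
    field. repeat split; try assumption; rewrite Cplus_comm; assumption.
  - apply ctends_value with (1 / ((1 + 0) * (1 + 0)))%C; [ field | ].
    apply ctends_div; [ | now apply ctends_const | ].
    + replace ((1 + 0) * (1 + 0))%C with (RtoC 1) by ring. apply RtoC_neq_0; lra.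
    + apply ctends_mult; [ | ];
        (apply ctends_plus; [ now apply ctends_const | apply ctends_even, ctends_div_INR ]).
Qed.

Lemma sqrt_sin_sin_shift (z z' : C) (N : nat) :
  Nat.Even N -> sqrt_sin_sin (z + INR N) (z' + INR N) = sqrt_sin_sin z z'.
Proof. intros [M ->]. unfold sqrt_sin_sin. now rewrite !Csin_shift_even. Qed.

Lemma invG_neg_even_tends (s : C) :
  ctends even_infinity (fun N => invG (- (s + INR N)) / gamma_scale s N)%C (- (Csin (PI * s) / PI))%C.
Proof.
 
  apply ctends_ext_loc with (fun N => - (egam N s * invG (1 - s)))%C.
  - apply even_infinity_intro. intros N HN HE.
    replace (- (s + INR N))%C with (- s - INR N)%C by ring.
    rewrite invG_neg_even by assumption. fold (gamma_scale s N). field. apply gamma_scale_neq_0.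
  - rewrite <- invG_reflection. apply ctends_even, ctends_opp.
    apply ctends_mult; [ apply egam_tends | now apply ctends_const ].
Qed.

Lemma gamma_scale_mult (z z' a mu : C) (r : R) (N : nat) :
  parameters z z' a mu r ->
  (gamma_scale z N * gamma_scale z' N = gamma_scale a N * gamma_scale a N)%C.
Proof.
  intros [-> [-> _]]. unfold gamma_scale, Cminus. rewrite !Rcpow_plus, Rcpow_opp.
  field. apply Rcpow_pos_neq_0.
Qed.

Lemma Klim_pp_value (z0 z0' c mu : C) (r x y : R) :
  parameters z0 z0' c mu r -> 0 < x -> 0 < y ->
  Klim_pp z0 z0' x y = cross (fun j x => oddser (besJ_g c) besJ_q j mu (ln x)) x y.
Proof.
  intros P Hx Hy. destruct (parameters_a _ _ _ _ _ P) as [Ec Emu].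
  destruct P as [_ [_ [N1 [N2 [Hre [Hr HS]]]]]].
  destruct (regular_besJ mu c r ltac:(lra)) as [G Hreg].
  unfold Klim_pp. rewrite (diag_ext_cross _ (fun _ _ => RtoC 1)
    (fun j x => oddser (besJ_g c) besJ_q j mu (ln x)) x y Hx Hy).
  - ring.
  - intros j w Hw. apply cderive_comp_ln; [ exact Hw | ].
    apply (cderive_oddser mu r G 1); try assumption. lra.
  - intros u v Hu Hv. rewrite !(limA_oddser z0 z0' r), !(limA_tilde_oddser z0 z0' r)
      by (try assumption; now rewrite Emu).
    rewrite Ec, Emu. ring.
  - apply ctends_const.
Qed.

Lemma Klim_mm_value (z0 z0' c mu : C) (r x y : R) :
  parameters z0 z0' c mu r -> 0 < x -> 0 < y ->
  Klim_mm z0 z0' x y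
  = (Csin (PI * z0) * Csin (PI * z0') / PI ^ 2
     * cross (fun j x => oddser besI_g besI_q j mu (ln x)) x y)%C.
Proof.
  intros P Hx Hy. destruct (parameters_a _ _ _ _ _ P) as [Ec Emu].
  destruct P as [_ [_ [N1 [N2 [Hre [Hr HS]]]]]].
  unfold Klim_mm. apply (diag_ext_cross _
    (fun _ _ => Csin (PI * z0) * Csin (PI * z0') / PI ^ 2)%C
    (fun j x => oddser besI_g besI_q j mu (ln x)) x y Hx Hy).
  - intros j w Hw. apply cderive_comp_ln; [ exact Hw | ].
    apply (cderive_oddser mu r 1 1); [ lra | exact HS | apply regular_besI ].
  - intros u v Hu Hv. rewrite !(limB_oddser z0 z0' r), !(limB_tilde_oddser z0 z0' r)
      by (try assumption; now rewrite Emu).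
    rewrite Emu. unfold Cdiv. set (i := (/ (RtoC u - RtoC v))%C). set (p := (/ PI ^ 2)%C).
    field.
  - apply ctends_const.
Qed.

Lemma Klim_pm_value (z0 z0' c mu : C) (r x y : R) :
  parameters z0 z0' c mu r -> 0 < x -> 0 < y ->
  Klim_pm z0 z0' x y
  = (sqrt_sin_sin z0 z0' / PI
     * ((oddser (besJ_g c) besJ_q 1 mu (ln x) * oddser besI_g besI_q 0 mu (ln y)
         - oddser (besJ_g c) besJ_q 0 mu (ln x) * oddser besI_g besI_q 1 mu (ln y)) / (x + y)))%C.
Proof.
  intros P Hx Hy. destruct (parameters_a _ _ _ _ _ P) as [Ec Emu].
  destruct P as [_ [_ [N1 [N2 [Hre [Hr HS]]]]]].
  unfold Klim_pm. rewrite !(limB_oddser z0 z0' r), !(limB_tilde_oddser z0 z0' r),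
    !(limA_oddser z0 z0' r), !(limA_tilde_oddser z0 z0' r)
    by (try assumption; now rewrite Emu).
  rewrite Ec, Emu. rewrite ?RtoC_div, ?RtoC_mult by apply PI_neq0. unfold Cdiv.
  set (i := (/ (RtoC x + RtoC y))%C). set (p := (/ RtoC PI)%C). field.
Qed.

(** The exponential factors tend to 1, so only the prefactors [p] and the series
    contribute. *)
Lemma kernel_limit (p : nat -> C) (f : nat -> nat -> R -> C) (g : nat -> R -> C)
  (p0 : C) (x y : R) :
  0 < x -> ctends even_infinity p p0 ->
  (forall j w, ctends even_infinity (fun N => f N j w) (g j w)) ->
  ctends even_infinity
    (fun N => p N * (half_exp (x / INR N) * half_exp (y / INR N)) * cross (f N) x y)%C
    (p0 * cross g x y)%C.
Proof.
  intros Hx Hp Hf. apply ctends_value with (p0 * (1 * 1) * cross g x y)%C; [ ring | ].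
  apply ctends_mult; [ | now apply (ctends_cross f) ].
  apply ctends_mult; [ exact Hp | ]. apply ctends_mult; apply ctends_half_exp_infinity.
Qed.

Lemma Kpp_tends (z0 z0' c mu : C) (r xi eta : R) :
  parameters z0 z0' c mu r -> 0 < xi -> 0 < eta ->
  ctends even_infinity
    (fun N => 1 / INR N * Kpp (z0 + INR N) (z0' + INR N) (xi / INR N)%R (eta / INR N)%R)%C
    (Klim_pp z0 z0' xi eta).
Proof.
  intros P Hxi Heta. rewrite (Klim_pp_value z0 z0' c mu r) by assumption.
  pose proof P as [Hz [Hz' [N1 [N2 [Hre [Hr HS]]]]]].
  apply ctends_value with (1 * cross (fun j x => oddser (besJ_g c) besJ_q j mu (ln x)) xi eta)%C; [ ring | ].
  eapply ctends_ext_loc; [ | apply (kernel_limit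
    (fun N => (gamma_ratio N z0 * gamma_ratio N z0') * (INR N * INR N / ((z0 + INR N) * (z0' + INR N))))%C
    (fun N j x => oddser (plus_g c N) (plus_q c N) j mu (ln x))
    (fun j x => oddser (besJ_g c) besJ_q j mu (ln x)) 1 xi eta Hxi) ].
  - apply even_infinity_intro. intros N HN HE.
    assert (HN0 : 0 < INR N) by (apply lt_0_INR; lia). symmetry.
    rewrite (Kpp_scale _ _ (c + INR N) mu r (INR N) xi eta (/ gamma_scale c N)%C) by
      (try assumption; try apply Cinv_neq_0, gamma_scale_neq_0; now apply parameters_shift).
    f_equal. f_equal. unfold gamma_ratio. fold (gamma_scale z0 N). fold (gamma_scale z0' N).
    transitivity (invG (z0 + INR N) * invG (z0' + INR N) * (gamma_scale c N * gamma_scale c N)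
      / ((z0 + INR N) * (z0' + INR N)))%C;
      [ | rewrite <- (gamma_scale_mult z0 z0' c mu r N P) ];
      field; repeat split; first [ apply plus_INR_neq_0; assumption | apply gamma_scale_neq_0 | apply RtoC_neq_0; lra ].
  - apply ctends_value with (1 * 1 * 1)%C; [ ring | ].
    apply ctends_mult; [ apply ctends_mult | now apply ctends_N2_over_zz' ];
      now apply ctends_even, gamma_ratio_tends, invG_neq_0.
  - intros j w. apply (plus_oddser_tends mu c r); [ lra | exact HS ].
Qed.

Lemma Kmm_tends (z0 z0' c mu : C) (r xi eta : R) :
  parameters z0 z0' c mu r -> (forall m, around mu r m -> invG (c - m) <> 0%C) ->
  0 < xi -> 0 < eta ->
  ctends even_infinity
    (fun N => 1 / INR N * Kmm (z0 + INR N) (z0' + INR N) (xi / INR N)%R (eta / INR N)%R)%C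
    (Klim_mm z0 z0' xi eta).
Proof.
  intros P Hnz Hxi Heta. rewrite (Klim_mm_value z0 z0' c mu r) by assumption.
  pose proof P as [Hz [Hz' [N1 [N2 [Hre [Hr HS]]]]]].
  eapply ctends_ext_loc; [ | apply (kernel_limit
    (fun N => ((invG (- (z0 + INR N)) / gamma_scale z0 N) * (invG (- (z0' + INR N)) / gamma_scale z0' N))
      * (INR N * INR N / ((z0 + INR N) * (z0' + INR N))))%C
    (fun N j x => oddser (minus_g c N) (minus_q c N) j mu (ln x))
    (fun j x => oddser besI_g besI_q j mu (ln x)) _ xi eta Hxi) ].
  - apply even_infinity_intro. intros N HN HE.
    assert (HN0 : 0 < INR N) by (apply lt_0_INR; lia).
    assert (HNC : RtoC (INR N) <> 0%C) by (apply RtoC_neq_0; lra). symmetry. rewrite Kmm_Kpp.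
    rewrite (Kpp_scale _ _ (- (c + INR N)) mu r (INR N) xi eta (gamma_scale c N / INR N)%C) by
      (try assumption;
       try (apply Cmult_neq_0; [ apply gamma_scale_neq_0 | now apply Cinv_neq_0 ]);
       now apply parameters_opp, parameters_shift).
    f_equal. f_equal.
    transitivity (invG (- (z0 + INR N)) * invG (- (z0' + INR N)) * (INR N * INR N)
      / (gamma_scale c N * gamma_scale c N) / ((z0 + INR N) * (z0' + INR N)))%C;
      [ | rewrite <- (gamma_scale_mult z0 z0' c mu r N P) ];
      field; repeat split; first [ apply plus_INR_neq_0; assumption | apply gamma_scale_neq_0 | assumption ].
  - apply ctends_value with ((- (Csin (PI * z0) / PI)) * (- (Csin (PI * z0') / PI)) * 1)%C;
      [ field; apply RtoC_neq_0, PI_neq0 | ].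
    apply ctends_mult; [ apply ctends_mult; apply invG_neg_even_tends | now apply ctends_N2_over_zz' ].
  - intros j w. apply (minus_oddser_tends mu c r); [ lra | exact HS | exact Hnz ].
Qed.

Lemma Kpm_tends (z0 z0' c mu : C) (r xi eta : R) :
  parameters z0 z0' c mu r -> (forall m, around mu r m -> invG (c - m) <> 0%C) ->
  0 < xi -> 0 < eta ->
  ctends even_infinity
    (fun N => 1 / INR N * Kpm (z0 + INR N) (z0' + INR N) (xi / INR N)%R (eta / INR N)%R)%C
    (Klim_pm z0 z0' xi eta).
Proof.
  intros P Hnz Hxi Heta.
  rewrite (Klim_pm_value z0 z0' c mu r) by assumption.
  pose proof P as [Hz [Hz' [N1 [N2 [Hre [Hr HS]]]]]].
  assert (Hxy : (RtoC xi + RtoC eta)%C <> 0%C) by (rewrite <- RtoC_plus; apply RtoC_neq_0; lra).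
  set (f := fun N j => oddser (plus_g c N) (plus_q c N) j mu (ln xi)).
  set (g := fun N j => oddser (minus_g c N) (minus_q c N) j mu (ln eta)).
  apply ctends_ext_loc with (fun N =>
    sqrt_sin_sin z0 z0' / PI
    * (INR N * INR N / ((z0 + INR N) * (z0' + INR N)))
    * (half_exp (xi / INR N) * half_exp (eta / INR N))
    * ((((- (mu * mu)) * (f N 0%nat * g N 0%nat) + f N 1%nat * g N 1%nat) * (1 * / INR N)
       + (1 + c * / INR N) * (f N 1%nat * g N 0%nat - f N 0%nat * g N 1%nat)) / (xi + eta)))%C.
  - apply even_infinity_intro. intros N HN HE.
    assert (HN0 : 0 < INR N) by (apply lt_0_INR; lia).
    rewrite (Kpm_value _ _ (c + INR N) mu r) by
      (try (apply Rdiv_lt_0_compat; assumption); now apply parameters_shift).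
    rewrite sqrt_sin_sin_shift by exact HE.
    assert (Hk := Cinv_neq_0 _ (gamma_scale_neq_0 c N)).
    assert (Hk' : (gamma_scale c N / INR N)%C <> 0%C)
      by (apply Cmult_neq_0; [ apply gamma_scale_neq_0 | apply Cinv_neq_0, RtoC_neq_0; lra ]).
    rewrite !(whit_scale (c + INR N) mu r (INR N) xi (/ gamma_scale c N)%C),
      !(whit_scale (- (c + INR N)) mu r (INR N) eta (gamma_scale c N / INR N)%C)
      by (try assumption; lra).
    fold (plus_g c N) (plus_q c N) (minus_g c N) (minus_q c N).
    fold (f N 0%nat) (f N 1%nat) (g N 0%nat) (g N 1%nat).
    assert (HNC : RtoC (INR N) <> 0%C) by (apply RtoC_neq_0; lra).
    assert (S1 := plus_INR_neq_0 z0 N N1). assert (S2 := plus_INR_neq_0 z0' N N2). assert (Hnf := gamma_scale_neq_0 c N).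
    rewrite !RtoC_div by lra. field.
    repeat split; try assumption; try apply RtoC_neq_0, PI_neq0.
  - apply ctends_value with (sqrt_sin_sin z0 z0' / PI * 1 * (1 * 1)
      * ((((- (mu * mu)) * (oddser (besJ_g c) besJ_q 0 mu (ln xi) * oddser besI_g besI_q 0 mu (ln eta))
            + oddser (besJ_g c) besJ_q 1 mu (ln xi) * oddser besI_g besI_q 1 mu (ln eta)) * 0
        + (1 + 0) * (oddser (besJ_g c) besJ_q 1 mu (ln xi) * oddser besI_g besI_q 0 mu (ln eta)
         - oddser (besJ_g c) besJ_q 0 mu (ln xi) * oddser besI_g besI_q 1 mu (ln eta))) / (xi + eta)))%C.
    { field. split; [ exact Hxy | apply RtoC_neq_0, PI_neq0 ]. }
    assert (Hf : forall j, ctends even_infinity (fun N => f N j) (oddser (besJ_g c) besJ_q j mu (ln xi)))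
      by (intros j; apply (plus_oddser_tends mu c r); [ lra | exact HS ]).
    assert (Hg : forall j, ctends even_infinity (fun N => g N j) (oddser besI_g besI_q j mu (ln eta)))
      by (intros j; apply (minus_oddser_tends mu c r); [ lra | exact HS | exact Hnz ]).
    assert (Hd : forall s : C, ctends even_infinity (fun N => s * / INR N)%C 0)
      by (intros s; apply ctends_even, ctends_div_INR).
    apply ctends_mult; [ apply ctends_mult; [ apply ctends_mult; [ | ] | ] | ].
    + now apply ctends_const.
    + now apply ctends_N2_over_zz'.
    + apply ctends_mult; [ apply ctends_half_exp_infinity | apply ctends_half_exp_infinity ].
    + apply ctends_div; [ exact Hxy | | now apply ctends_const ].
      apply ctends_plus; [ | ]; (apply ctends_mult; [ | ]).
      * apply ctends_plus; [ apply ctends_mult; [ now apply ctends_const | ] | ];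
          apply ctends_mult; auto.
      * apply Hd.
      * apply ctends_plus; [ now apply ctends_const | apply Hd ].
      * apply ctends_minus; [ | ]; apply ctends_mult; auto.
Qed.

Lemma admissible_parameters (z0 z0' : C) :
  admissible z0 z0' ->
  exists c mu r, parameters z0 z0' c mu r /\
    forall m, around mu r m -> invG (c - m) <> 0%C.
Proof.
  intros [N1 [N2 H]]. set (mu := ((z0 - z0') / 2)%C). set (c := ((z0 + z0') / 2)%C).
  assert (Hz : z0 = (c + mu)%C) by (unfold c, mu; field).
  assert (Hz' : z0' = (c - mu)%C) by (unfold c, mu; field).
  assert (E2 : (2 * mu)%C = (z0 - z0')%C) by (unfold mu; field).
  assert (E2' : 2 * Re mu = Re z0 - Re z0').
  { replace (2 * Re mu) with (Re (2 * mu)%C) by (cbn; unfold Re; ring). rewrite E2. reflexivity. }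
  assert (Hre : Rabs (2 * Re mu) < 1).
  { rewrite E2'. destruct H as [-> | [_ [_ [m [H1 H2]]]]].
    - rewrite re_conj, Rminus_diag, Rabs_R0. lra.
    - apply Rabs_def1; lra. }
  assert (Hnear : exists r, 0 < r <= / 4 /\ forall m, around mu r m -> invG (c - m) <> 0%C).
  { destruct (Ceq_dec mu 0) as [E | Hmu].
    - assert (Hc : invG c <> 0%C).
      { apply invG_neq_0. replace c with z0 by (rewrite Hz, E; ring). exact N1. }
      destruct (invG_neq_0_nearby c (- (1)) Hc) as [r1 [Hr1 Hr2]].
      exists (Rmin r1 (/ 4)). split; [ split; [ apply Rmin_pos; lra | apply Rmin_r ] | ].
      intros m [[Hmu _] | [_ Hm]]; [ contradiction | ].
      replace (c - m)%C with (c + - (1) * m)%C by ring. apply Hr2.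
      eapply Rle_trans; [ exact Hm | apply Rmin_l ].
    - exists (/ 4). split; [ lra | ]. intros m [[_ [-> | ->]] | [E _]]; [ | | contradiction ].
      + rewrite <- Hz'. now apply invG_neq_0.
      + replace (c - - mu)%C with z0 by (rewrite Hz; ring). now apply invG_neq_0. }
  destruct Hnear as [r [Hr Hnz]].
  assert (HS : gamma_regular (around mu r)) by (apply gamma_regular_around; lra).
  exists c, mu, r. split; [ | exact Hnz ].
  exact (conj Hz (conj Hz' (conj N1 (conj N2 (conj Hre (conj Hr HS)))))).
Qed.

Theorem theorem5p1 (z0 z0' : C) (xi eta : R) (e d : block_sign) :
  admissible z0 z0' -> 0 < xi -> 0 < eta ->
  filterlim
    (fun N : nat =>
       (1 / INR N
        * matrix_Whittaker_kernel (z0 + INR N) (z0' + INR N) e d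
            (xi / INR N)%R (eta / INR N)%R)%C)
    (within Nat.Even eventually)
    (locally (limit_kernel z0 z0' e d xi eta)).
Proof.
  intros Hadm Hxi Heta.
  destruct (admissible_parameters z0 z0' Hadm) as [c [mu [r [P Hnz]]]].
  apply ctends_filterlim.
  destruct e, d; simpl.
  - now apply (Kpp_tends z0 z0' c mu r).
  - now apply (Kpm_tends z0 z0' c mu r).
  - unfold Kmp, Klim_mp.
    apply ctends_ext with (fun N =>
      - (1 / INR N * Kpm (z0 + INR N) (z0' + INR N) (eta / INR N)%R (xi / INR N)%R))%C;
      [ intros N; ring | ].
    apply ctends_opp. now apply (Kpm_tends z0 z0' c mu r).
  - now apply (Kmm_tends z0 z0' c mu r).
Qed.
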